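(* Let $d\ge2$ be an integer and let $(\varphi_x)_{x\in T}$ be, under $\mathbb P^G$, the Gaussian free field on the $(d+1)$-regular tree $T$ with unit weights. Define $h_*\in\mathbb R$ as the unique value such that $\lambda_{h_*}=1$. Then: - for $h<h_*$, $\mathbb P^G$-a.s., $\{x\in T:\varphi_x\ge h\}$ has an infinite component; - for $h>h_*$, $\mathbb P^G$-a.s., $\{x\in T:\varphi_x\ge h\}$ only has finite components.
   Context: $T$ is the $(d+1)$-regular tree with unit weights. Under $P_x$, $(Z_k)_{k\ge0}$ is simple random walk on $T$ started at $x$, and $g(x,y)=\frac1{d+1}E_x[\sum_{k\ge0}1\{Z_k=y\}]$. Under $\mathbb P^G$, $(\varphi_x)_{x\in T}$ is a centered Gaussian field with covariance $g(\cdot,\cdot)$. Components are connected components of the subgraph of $T$ induced by the given vertex set. $\nu$ is the centered Gaussian law on $\mathbb R$ with variance $\sigma^2=g(x,x)=\frac{d}{d^2-1}$. $L$ is the operator on $L^2(\nu)$ given by $(Lf)(a)=d\,E^Y\big[f\big(\tfrac ad+\sqrt{1-d^{-2}}\,Y\big)\big]$ with $Y$ distributed according to $\nu$. For $h\in\mathbb R$, $\pi_h$ is multiplication by $1_{[h,\infty)}$, $L_h=\pi_hL\pi_h$ (a self-adjoint, non-negative, Hilbert–Schmidt operator on $L^2(\nu)$), and $$\lambda_h=\|L_h\|_{L^2(\nu)\to L^2(\nu)}=\sup\{\langle f,L_hf\rangle_\nu:\ \|f\|_{L^2(\nu)}=1\}.$$ The map $h\mapsto\lambda_h$ is a decreasing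 homeomorphism of $\mathbb R$ onto $(0,d)$, so $h_*$ is well defined. *)

(* Defs.v *)
From HB Require Import structures.
From mathcomp Require Import all_boot all_order all_algebra.
From mathcomp Require Import all_classical all_reals all_analysis.

Set Implicit Arguments.
Unset Strict Implicit.
Unset Printing Implicit Defensive.
Import Order.TTheory GRing.Theory Num.Theory.
Import numFieldNormedType.Exports.
Local Open Scope classical_set_scope.
Local Open Scope ring_scope.

Section Graph.
Variables (V : choiceType) (adj : rel V).

(* In a simple graph, a [ucycle] of size at most 2 is degenerate (empty, or an
   edge run back and forth), so only simple cycles of size > 2 are excluded. *)
Record regular_tree (k : nat) : Prop := {
  tree_inhabited : inhabited V ;
  tree_sym : symmetric adj ;
  tree_irrefl : irreflexive adj ;
  tree_connected : forall x y, exists2 p, path adj x p & last x p = y ;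
  tree_acyclic : forall c : seq V, (2 < size c)%N -> ~ ucycle adj c ;
  tree_regular : forall x, ([set y | adj x y] #= `I_k)%card
}.

Definition connected_in (A : set V) (x y : V) : Prop :=
  exists p : seq V,
    [/\ path adj x p, last x p = y & forall z, z \in x :: p -> A z].

Definition is_component (A C : set V) : Prop :=
  exists2 x, A x & C = [set y | connected_in A x y].

End Graph.

Section Walk.
Variables (R : realType) (V : choiceType) (adj : rel V) (d : nat).
Context {dW : measure_display} {W : measurableType dW}.

(* [V] carries the discrete sigma-algebra; it is countable in the case of
   interest, so measurability is only asked on singletons. *)
Definition simple_random_walk (x : V) (P : probability W R)
    (Z : nat -> W -> V) : Prop :=
  (forall k y, measurable [set w | Z k w = y]) /\
  (forall n (z : nat -> V),
    P [set w | forall k, (k <= n)%N -> Z k w = z k] =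
    ((z 0%N == x)%:R * \prod_(k < n) ((adj (z k) (z k.+1))%:R / d.+1%:R))%:E).

Definition green (Px : V -> probability W R) (Z : nat -> W -> V)
    (x y : V) : \bar R :=
  ((d.+1%:R^-1)%:E *
   \int[Px x]_w (\sum_(0 <= k <oo) ((Z k w == y)%:R)%:E))%E.

End Walk.

Section Field.
Context {R : realType} {dO : measure_display} {Omega : measurableType dO}.

(* Gaussian law with mean [m] and variance [v]. [normal_prob] takes the standard
   deviation and is not a Dirac mass when the latter is 0. *)
Definition gaussian_law (m v : R) (B : set R) : \bar R :=
  if v == 0 then \d_m B else normal_prob m (Num.sqrt v) B.

Definition gaussian_variable (P : probability Omega R) (X : Omega -> R) : Prop :=
  exists m v : R, 0 <= v /\
    forall B : set R, measurable B -> P (X @^-1` B) = gaussian_law m v B.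

Definition centered_gaussian_field (V : Type) (P : probability Omega R)
    (phi : V -> {RV P >-> R}) (g : V -> V -> \bar R) : Prop :=
  [/\ forall (n : nat) (a : 'I_n -> R) (x : 'I_n -> V),
        gaussian_variable P (fun w => \sum_(i < n) a i * phi (x i) w),
      forall x, ('E_P[phi x] = 0)%E &
      forall x y, covariance P (phi x) (phi y) = g x y].

End Field.

Section Operator.
Variables (R : realType) (d : nat).

Definition nu : probability (measurableTypeR R) R :=
  normal_prob 0 (Num.sqrt (d%:R / (d%:R ^+ 2 - 1))).

(* The operators are given on representatives; they respect nu-a.e. equality. *)
Definition opL (f : R -> R) (a : R) : R :=
  d%:R * \int[nu]_y f (a / d%:R + Num.sqrt (1 - d%:R ^- 2) * y).

Definition pih (h : R) (f : R -> R) (a : R) : R := \1_`[h, +oo[ a * f a.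

Definition opLh (h : R) (f : R -> R) : R -> R := pih h (opL (pih h f)).

Definition opnorm2 (mu : {measure set (measurableTypeR R) -> \bar R})
    (A : (R -> R) -> R -> R) : \bar R :=
  ereal_sup [set ('N[mu]_2%:E[EFin \o A f])%E |
    f in [set f : R -> R | f \in Lfun mu 2%:E /\
                           ('N[mu]_2%:E[EFin \o f] <= 1)%E]].

Definition lambda (h : R) : \bar R := opnorm2 nu (opLh h).

End Operator.

(* Main.v *)
Require Import Defs.
From mathcomp Require Import all_boot all_order all_algebra.
From mathcomp Require Import all_classical all_reals all_analysis.
From mathcomp Require Import measurable_realfun lebesgue_integral_under ring lra.

Import Order.TTheory GRing.Theory Num.Theory.
Import numFieldNormedType.Exports.
Local Open Scope classical_set_scope.
Local Open Scope ring_scope.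
Set Implicit Arguments.
Unset Strict Implicit.
Unset Printing Implicit Defensive.

(** Consider a directed edge [(p, x)] and the branch of the tree behind [x].
    By the Markov property of the field, given [phi p] and everything outside
    the branch, [phi x] is distributed as [phi p / d + sqrt (1 - d^-2) * Y] with
    [Y] of law [nu]. Writing [Q] for this kernel, so that [opL d = d * Q], the
    probability that the exploration of [{phi >= h}] in the branch does not
    reach depth [n], given [phi p = a], is [Q t_n a] with [t_0 = 0] and
    [t_(n+1) = 1_(<h) + 1_(>=h) * (Q t_n) ^ d]. With [s_n = 1 - t_n] the question
    becomes whether [s_n] tends to 0, and the linearization of its recursion at
    0 is [s |-> L_h s]. The condition [lambda d hstar = 1] thus separates
    extinction from survival.

    Two facts about the operator carry the argument. First, if [L_(h1)] does not
    increase the norm and [h1 < h2], then [L_(h2)] is a strict contraction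
    ([strict_monotonicity]): the mass that [L_(h1)] puts on [[h1, h2)] is lost,
    and a function can make this loss relatively small only by sitting far to
    the right, where [L] contracts anyway. Secondly, if [L_h] increases the norm
    of some function, there are a bounded [v >= 0], not null, and [t < 1] with
    [v <= t * L_h v] ([subeigenfunction]): the norms of the iterates of a
    self-adjoint operator form a log-convex sequence, so they grow
    geometrically, and a truncated Neumann series does the rest.

    Above [hstar], Bernoulli's inequality gives [s_(n+1) <= L_h s_n], the right
    hand side decays geometrically in norm, and almost surely every one of the
    countably many directed edges leads to a finite open cluster.

    Below [hstar], a small multiple [u] of [v] satisfies
    [u <= 1_(>=h) * (1 - (1 - Q u) ^ d)], hence [s_n >= u] for all [n]. So the
    probability that no vertex at depth [m] of a given branch starts an infinite
    open path is at most [int r_m d nu], where [r_0 = 1 - u] and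
    [r_(m+1) = (Q r_m) ^ d]. The sequence [r_m] decreases to a solution of
    [r = (Q r) ^ d]; since [nu] is invariant under [Q],
    [int r <= int (Q r) ^ 2 <= int Q r = int r], which forces [Q r] to be 0 or 1
    almost everywhere. As [r <= 1 - u] rules out the value 1, the limit vanishes
    and an infinite open path exists almost surely.

    The Markov property comes from the closed form
    [g(x, y) = d / (d^2 - 1) * d ^ (- dist x y)] of the Green function
    ([green_series]): for [y] outside the branch behind [x], the covariance of
    [phi x] and [phi y] is that of [phi p] and [phi y] divided by [d]. This
    determines the joint characteristic functions, and a monotone class argument
    started from cosines ([trig_monotone_class]) extends the resulting identity
    to bounded measurable functions ([markov_step], [functional_mean]). *)

(** * Bounded measurable functions *)

(** This class is closed under products, and all its members are integrable for
    a probability. *)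
Definition bounded_measurable {R : realType} {dT} {T : measurableType dT}
    (f : T -> R) : Prop :=
  measurable_fun setT f /\ exists M : R, forall x, `|f x| <= M.

Section BoundedMeasurable.
Context {R : realType} {dT : measure_display} {T : measurableType dT}.
Implicit Types f g : T -> R.
Local Notation bm := (@bounded_measurable R _ T).

Lemma bm_cst (c : R) : bm (fun=> c).
Proof. by split; [exact: measurable_cst|exists `|c|]. Qed.

Lemma bmD f g : bm f -> bm g -> bm (fun x => f x + g x).
Proof.
move=> [mf [M fM]] [mg [N gN]]; split; first exact: measurable_funD.
by exists (M + N) => x; rewrite (le_trans (ler_normD _ _))// lerD.
Qed.

Lemma bmM f g : bm f -> bm g -> bm (fun x => f x * g x).
Proof.
move=> [mf [M fM]] [mg [N gN]]; split; first exact: measurable_funM.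
by exists (M * N) => x; rewrite normrM ler_pM.
Qed.

Lemma bmZ (c : R) f : bm f -> bm (fun x => c * f x).
Proof. by move=> bf; apply: bmM => //; exact: bm_cst. Qed.

Lemma bmB f g : bm f -> bm g -> bm (fun x => f x - g x).
Proof.
move=> bf bg; have := bmD bf (bmZ (-1) bg).
by under eq_fun do rewrite mulN1r.
Qed.

Lemma bmX f n : bm f -> bm (fun x => f x ^+ n).
Proof.
move=> bf; elim: n => [|n IH]; first by under eq_fun do rewrite expr0; exact: bm_cst.
by under eq_fun do rewrite exprS; exact: bmM.
Qed.

Lemma bm_sum I (s : seq I) (F : I -> T -> R) :
  (forall i, bm (F i)) -> bm (fun x => \sum_(i <- s) F i x).
Proof.
move=> bF; elim: s => [|i s IH].
  by under eq_fun do rewrite big_nil; exact: bm_cst.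
by under eq_fun do rewrite big_cons; exact: bmD.
Qed.

Lemma bm_indic (A : set T) : measurable A -> bm (\1_A).
Proof.
move=> mA; split; first exact: measurable_indic.
by exists 1 => x; rewrite indicE; case: (_ \in _); rewrite ?normr1 ?normr0.
Qed.

Lemma bm_cos f (c : R) : measurable_fun setT f -> bm (fun x => cos (f x + c)).
Proof.
move=> mf; split; last by exists 1 => x; rewrite ler_norml cos_geN1 cos_le1.
apply: measurableT_comp; last exact: measurable_funD.
by apply: continuous_measurable_fun; exact: continuous_cos.
Qed.

Lemma bm_comp dU (U : measurableType dU) (f : U -> R) (X : T -> U) :
  bounded_measurable f -> measurable_fun setT X -> bm (fun x => f (X x)).
Proof.
move=> [mf [M fM]] mX; split; first exact: (measurableT_comp mf).
by exists M.
Qed.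

Variable P : probability T R.
Local Notation E f := (\int[P]_x (f x)).

Lemma bm_integrable f : bm f -> P.-integrable setT (EFin \o f).
Proof.
move=> [mf [M fM]]; apply: measurable_bounded_integrable => //.
- exact: le_lt_trans (probability_le1 P measurableT) (ltry _).
- exists M; split; first exact: num_real.
  by move=> x Mx y _; exact: le_trans (fM y) (ltW Mx).
Qed.

Lemma ED f g : bm f -> bm g -> E (fun x => f x + g x) = E f + E g.
Proof. by move=> bf bg; rewrite RintegralD//; exact: bm_integrable. Qed.

Lemma EB f g : bm f -> bm g -> E (fun x => f x - g x) = E f - E g.
Proof. by move=> bf bg; rewrite RintegralB//; exact: bm_integrable. Qed.

Lemma EZ (c : R) f : bm f -> E (fun x => c * f x) = c * E f.
Proof. by move=> bf; rewrite RintegralZl//; exact: bm_integrable. Qed.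

Lemma Elin f g (c : R) : bm f -> bm g ->
  E (fun x => f x + c * g x) = E f + c * E g.
Proof. by move=> bf bg; rewrite (ED bf (bmZ c bg)) EZ. Qed.

Lemma Ecst (c : R) : E (fun=> c) = c.
Proof. by rewrite Rintegral_cst// -[X in _ * X]/(fine (P setT)) probability_setT mulr1. Qed.

Lemma le_E f g : bm f -> bm g -> (forall x, f x <= g x) -> E f <= E g.
Proof. by move=> bf bg fg; apply: le_Rintegral => //; exact: bm_integrable. Qed.

Lemma EFinE f : bm f -> (E f)%:E = (\int[P]_x (f x)%:E)%E.
Proof. by move=> bf; rewrite fineK//; apply: integrable_fin_num => //; exact: bm_integrable. Qed.

Lemma E_indic (A : set T) : measurable A -> (E (\1_A : T -> R))%:E = P A.
Proof. by move=> mA; rewrite EFinE ?integral_indic ?setIT//; exact: bm_indic. Qed.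

(** Dominated convergence with a constant as the dominating function. *)
Lemma E_cvg (f_ : nat -> T -> R) f (M : R) :
  (forall n, measurable_fun setT (f_ n)) -> measurable_fun setT f ->
  (forall n x, `|f_ n x| <= M) -> (forall x, f_ n x @[n --> \oo] --> f x) ->
  E (f_ n) @[n --> \oo] --> E f.
Proof.
move=> mf_ mf fM ff.
have M0 : bm (cst M) by exact: bm_cst.
have ff' : {ae P, forall x, setT x -> (f_ n x)%:E @[n --> \oo] --> (f x)%:E}.
  by apply: aeW => x _; apply: cvg_EFin; [exact: nearW|exact: ff].
have [_ _ ] := @dominated_convergence _ _ _ P setT measurableT
  (fun n x => (f_ n x)%:E) (fun x => (f x)%:E) (EFin \o cst M)
  (fun n => (measurable_EFinP _ _ ).2 (mf_ n)) ((measurable_EFinP _ _).2 mf)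
  ff'
  (bm_integrable M0) (aeW _ (fun x n _ => fM n x)).
move=> h.
have bf : bm f.
  split => //; exists M => x; apply: (cvgr_to_le (cvg_norm (ff x))).
  by near=> n; exact: fM.
rewrite -(EFinE bf) in h; exact: (fine_cvg h).
Unshelve. all: by end_near. Qed.

End BoundedMeasurable.

Section RealIntegrable.
Context {R : realType} d (T : measurableType d) (mu : {measure set T -> \bar R}).
Implicit Types f g : T -> R.
Local Notation intb f := (mu.-integrable setT (fun x => (f x)%:E)).

Lemma integrableR_D f g : intb f -> intb g -> intb (fun x => f x + g x).
Proof. by move=> fi gi; have := integrableD measurableT fi gi; apply: eq_integrable. Qed.

Lemma integrableR_Z (c : R) f : intb f -> intb (fun x => c * f x).
Proof. by move=> fi; have := integrableZl measurableT c fi; apply: eq_integrable. Qed.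

Lemma integrableR_le f g : measurable_fun setT f -> (forall x, `|f x| <= g x) ->
  intb g -> intb f.
Proof.
move=> mf fg; apply: le_integrable => //; first exact/measurable_EFinP.
by move=> x _; rewrite lee_fin (le_trans (fg x))// ler_norm.
Qed.

Lemma integrableR_sum I (s : seq I) (F : I -> T -> R) :
  (forall i, intb (F i)) -> intb (fun x => \sum_(i <- s) F i x).
Proof.
move=> iF; elim: s => [|i s IH].
  have := integrable0 mu setT; apply: eq_integrable => // x _ /=.
  by rewrite big_nil.
have := integrableR_D (iF i) IH; apply: eq_integrable => // x _.
by rewrite big_cons.
Qed.

Lemma Rintegral_sum I (s : seq I) (F : I -> T -> R) :
  (forall i, intb (F i)) ->
  \int[mu]_x (\sum_(i <- s) F i x) = \sum_(i <- s) \int[mu]_x F i x.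
Proof.
move=> iF; elim: s => [|i s IH].
  under eq_Rintegral do rewrite big_nil.
  by rewrite big_nil /Rintegral integral0.
rewrite big_cons -IH -RintegralD; [|by []|exact: iF|exact: integrableR_sum].
by apply: eq_Rintegral => x _; rewrite big_cons.
Qed.

End RealIntegrable.

(** * Cosines determine a law *)

Section TrigMonotoneClass.
Import HBNNSimple.
Variable R : realType.
Local Notation bm := (@bounded_measurable R _ (measurableTypeR R)).

Lemma bernoulli_ge (x : R) n : -1 <= x -> 1 + n%:R * x <= (1 + x) ^+ n.
Proof.
move=> x1; elim: n => [|n IH]; first by rewrite mul0r addr0 expr0.
rewrite exprS; apply: (@le_trans _ _ ((1 + x) * (1 + n%:R * x))); last first.
  by apply: ler_wpM2l => //; lra.
rewrite -natr1; have : 0 <= n%:R * x ^+ 2 by rewrite mulr_ge0// sqr_ge0.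
by nra.
Qed.

(** Multiply by [(1 + z) ^+ N >= 1 + N%:R * z]: the product is
    [(1 - z ^+ 2) ^+ N <= 1]. *)
Lemma expr_1B_le (z : R) N : 0 <= z <= 1 -> (1 - z) ^+ N <= (1 + N%:R * z)^-1.
Proof.
move=> /andP[z0 z1]; have h : 0 < 1 + N%:R * z by rewrite ltr_pwDl// mulr_ge0.
rewrite -[leRHS]mul1r ler_pdivlMr//.
apply: (@le_trans _ _ ((1 - z) ^+ N * (1 + z) ^+ N)).
  by apply: ler_wpM2l; [rewrite exprn_ge0// subr_ge0|apply: bernoulli_ge; lra].
by rewrite -exprMn exprn_ile1//; nra.
Qed.

(** With [r = s ^+ 2], Bernoulli applied to [s^-1] bounds [n%:R * s ^+ n]; the
    other factor [s ^+ n] tends to 0. *)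
Lemma cvg_natr_expr (r : R) : 0 <= r < 1 -> n%:R * r ^+ n @[n --> \oo] --> 0.
Proof.
move=> /andP[r0 r1].
have [->|rn0] := eqVneq r 0.
  rewrite (_ : (fun n => _) = cst 0); first exact: cvg_cst.
  by apply/funext => -[|n]; rewrite ?mul0r// exprS !mul0r mulr0.
pose s := Num.sqrt r.
have s0 : 0 < s by rewrite sqrtr_gt0 lt_neqAle eq_sym rn0.
have s1 : s < 1 by rewrite -(sqrtr1 R) ltr_sqrt.
have rE n : r ^+ n = s ^+ n * s ^+ n by rewrite -exprMn -expr2 sqr_sqrtr.
pose C := (s^-1 - 1)^-1.
have C0 : 0 < s^-1 - 1 by rewrite subr_gt0 invf_gt1.
have key n : n%:R * s ^+ n <= C.
  rewrite /C -[leRHS]mul1r ler_pdivlMr// mulrAC.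
  have : n%:R * (s^-1 - 1) <= s^-1 ^+ n.
    have := @bernoulli_ge (s^-1 - 1) n; rewrite (_ : 1 + (s^-1 - 1) = s^-1); last by ring.
    by move=> h; have := h ltac:(lra); lra.
  move=> /(ler_wpM2r (exprn_ge0 n (ltW s0)))/le_trans; apply.
  by rewrite -exprMn mulVf ?gt_eqF// expr1n.
apply: (squeeze_cvgr (f := cst 0) (h := fun n => C * s ^+ n)).
- near=> n; rewrite mulr_ge0 ?exprn_ge0//= rE mulrA ler_wpM2r// exprn_ge0//.
  exact: ltW.
- exact: cvg_cst.
- by rewrite -[X in _ --> X](mulr0 C); apply: cvgMl_tmp; apply: cvg_expr; rewrite gtr0_norm.
Unshelve. all: by end_near. Qed.

(** The powers below sharpen any profile with values in [[0, 1]] into a step at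
    height 1/2: the extra factor [n] in the exponent also settles the value at 1/2. *)
Lemma cvg_sharpen (y : R) : 0 <= y <= 1 ->
  (1 - y ^+ n) ^+ (n * 2 ^ n)%N @[n --> \oo] --> ((y < 1 / 2)%R%:R : R).
Proof.
move=> /andP[y0 y1].
have yn n : 0 <= y ^+ n <= 1 by rewrite exprn_ge0//= exprn_ile1.
have NE n : (n * 2 ^ n)%:R * y ^+ n = n%:R * (2 * y) ^+ n.
  by rewrite natrM natrX exprMn mulrA.
have [y2|y2] := ltP y (1 / 2).
  apply: (squeeze_cvgr (f := fun n => 1 - n%:R * (2 * y) ^+ n) (h := cst 1)).
  - near=> n; have := yn n => /andP[a b]; rewrite exprn_ile1 ?andbT//; last 2 first.
      by lra.
      by lra.
    have := @bernoulli_ge (- y ^+ n) (n * 2 ^ n).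
    by rewrite mulrN NE => -> //; lra.
  - rewrite -[X in _ --> X]subr0; apply: cvgB; first exact: cvg_cst.
    by apply: cvg_natr_expr; apply/andP; split; lra.
  - exact: cvg_cst.
apply: (squeeze_cvgr (f := cst 0) (h := fun n => n%:R^-1)).
- near=> n; have := yn n => /andP[a b]; rewrite exprn_ge0 ?subr_ge0//=.
  have n0 : (0 < n)%N by near: n; exists 1%N.
  apply: (le_trans (expr_1B_le _ (yn n))).
  rewrite lef_pV2 ?posrE ?ltr0n//; last by rewrite ltr_pwDl// mulr_ge0.
  rewrite NE; have : 1 <= (2 * y) ^+ n by rewrite exprn_ege1//; lra.
  move=> h; rewrite (le_trans (ler_peMr _ h))//.
  by rewrite lerDr.
- exact: cvg_cst.
- apply/(gtr0_cvgV0 (f := fun n : nat => n%:R : R)); last exact: cvgr_idn.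
  by near=> n; rewrite ltr0n; near: n; exists 1%N.
Unshelve. all: by end_near. Qed.

Variable H : (R -> R) -> Prop.
Hypothesis Hlin : forall f g c, bm f -> bm g -> H f -> H g ->
  H (fun x => f x + c * g x).
Hypothesis Hlim : forall (f_ : nat -> R -> R) f M,
  (forall n, bm (f_ n)) -> (forall n, H (f_ n)) -> bm f ->
  (forall n x, `|f_ n x| <= M) -> (forall x, f_ n x @[n --> \oo] --> f x) -> H f.
Hypothesis Hcos : forall t c, H (fun x => cos (t * x + c)).

Let bmcos t c : bm (fun x => cos (t * x + c)).
Proof. by apply: bm_cos; apply: measurable_funM. Qed.

(** The functions that can be multiplied by any cosine without leaving [H].
    Unlike [H], this class is stable under multiplication by cosines. *)
Let H' f := bm f /\ forall t c, H (fun x => f x * cos (t * x + c)).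

Let H'lin f g c : H' f -> H' g -> H' (fun x => f x + c * g x).
Proof.
move=> [bf Hf] [bg Hg]; split; first by apply: bmD => //; exact: bmZ.
move=> t e; under eq_fun do rewrite mulrDl -mulrA.
by apply: Hlin => //; apply: bmM.
Qed.

Let H'lim (f_ : nat -> R -> R) f M :
  (forall n, H' (f_ n)) -> bm f ->
  (forall n x, `|f_ n x| <= M) -> (forall x, f_ n x @[n --> \oo] --> f x) -> H' f.
Proof.
move=> Hf bf fM ff; split => // t c.
apply: (Hlim (M := M) (f_ := fun n x => f_ n x * cos (t * x + c))).
- by move=> n; apply: bmM; [case: (Hf n)|exact: bmcos].
- by move=> n; case: (Hf n).
- exact: bmM.
- move=> n x; rewrite normrM -[leRHS]mulr1 ler_pM//.
  by rewrite ler_norml cos_geN1 cos_le1.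
- by move=> x; apply: cvgMr_tmp; exact: ff.
Qed.

Let H'1 : H' (fun=> 1).
Proof. by split; [exact: bm_cst|move=> t c; under eq_fun do rewrite mul1r]. Qed.

(** A product of two cosines is half the sum of two cosines. *)
Let H'cos f s b : H' f -> H' (fun x => f x * cos (s * x + b)).
Proof.
move=> [bf Hf]; split; first exact: bmM.
move=> t c.
have -> : (fun x => f x * cos (s * x + b) * cos (t * x + c)) =
  (fun x => 0 * cos (0 * x + 0) +
   2^-1 * (f x * cos ((s + t) * x + (b + c)) +
     1 * (f x * cos ((s - t) * x + (b - c))))).
  apply/funext => x.
  have -> : (s + t) * x + (b + c) = (s * x + b) + (t * x + c) by ring.
  have -> : (s - t) * x + (b - c) = (s * x + b) - (t * x + c) by ring.
  by rewrite (cosB (s * x + b)) (cosD (s * x + b)); field.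
apply: Hlin.
- by apply: bmZ.
- by apply: bmD; [exact: bmM|apply: bmZ; exact: bmM].
- rewrite (_ : (fun _ => _) = (fun x => cos (0 * x + 0) + -1 * cos (0 * x + 0))).
    exact: Hlin.
  by apply/funext => x; ring.
- by apply: Hlin => //; exact: bmM.
Qed.

Let H'H f : H' f -> H f.
Proof.
move=> [_ /(_ 0 0)]; suff -> : (fun x => f x * cos (0 * x + 0)) = f by [].
by apply/funext => x; rewrite mul0r addr0 cos0 mulr1.
Qed.

(** Powers of [(1 + cos) / 2] are sharpened into a square wave. *)
Let H'step s b : H' (fun x => (cos (s * x + b) < 0)%R%:R).
Proof.
pose g x : R := (1 + cos (s * x + b)) / 2.
have g01 x : 0 <= g x <= 1.
  by rewrite /g; have := cos_geN1 (s * x + b); have := cos_le1 (s * x + b); lra.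
have mg : measurable_fun setT g.
  by apply: measurable_funM => //; apply: measurable_funD => //; case: (bmcos s b).
have Hg f : H' f -> H' (fun x => f x * g x).
  move=> Hf; have Z : H' (fun x => 0 : R).
    by rewrite (_ : (fun=> 0) = (fun=> 1 + -1 * 1)); [exact: H'lin|apply/funext => x; ring].
  have h := H'lin 2^-1 Z (H'lin 1 Hf (H'cos s b Hf)).
  rewrite (_ : (fun x => f x * g x) =
    (fun x => 0 + 2^-1 * (f x + 1 * (f x * cos (s * x + b))))) //.
  by apply/funext => x; rewrite /g; field.
have Hgn f n : H' f -> H' (fun x => f x * g x ^+ n).
  move=> Hf; elim: n => [|n IH]; first by under eq_fun do rewrite expr0 mulr1.
  by under eq_fun do rewrite exprSr mulrA; exact: Hg.
have Hgnm n m : H' (fun x => (1 - g x ^+ n) ^+ m).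
  elim: m => [|m IH]; first by under eq_fun do rewrite expr0.
  under eq_fun do rewrite exprSr mulrBr mulr1 -mulN1r.
  exact: H'lin IH (Hgn _ _ IH).
apply: (H'lim (M := 1) (f_ := fun n x => (1 - g x ^+ n) ^+ (n * 2 ^ n)%N)) => //.
- have -> : (fun x => (cos (s * x + b) < 0)%R%:R) = \1_(g @^-1` `]-oo, (1 / 2)[) :> (R -> R).
    apply/funext => x; rewrite indicE; congr ((nat_of_bool _)%:R).
    apply/idP/idP => [h|/set_mem]; last by rewrite /= in_itv/= /g; lra.
    by apply/mem_set; rewrite /= in_itv/= /g; lra.
  by apply: bm_indic; rewrite -[X in measurable X]setTI; exact: mg.
- move=> n x; have /andP[a c] := g01 x.
  have a' : 0 <= g x ^+ n by rewrite exprn_ge0.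
  have c' : g x ^+ n <= 1 by rewrite exprn_ile1.
  by rewrite ger0_norm ?exprn_ge0 ?exprn_ile1// ?subr_ge0//; lra.
- move=> x; have := cvg_sharpen (g01 x).
  suff -> : (cos (s * x + b) < 0) = (g x < 1 / 2) by [].
  by apply/idP/idP; rewrite /g; lra.
Qed.

(** On a bounded window, a wide enough sine wave is positive exactly on the right
    of its zero. *)
Let Hray a : H (\1_(`]a, +oo[ : set R)).
Proof.
apply: H'H; apply: (H'lim (M := 1)
  (f_ := fun n x => (cos (n.+1%:R^-1 * x + (pi / 2 - n.+1%:R^-1 * a)) < 0)%R%:R)).
- by move=> n; exact: H'step.
- exact: bm_indic.
- by move=> n x; case: (_ < _); rewrite ?normr1 ?normr0.
- move=> x; apply: cvg_near_cst; near=> n.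
  rewrite indicE; congr ((nat_of_bool _)%:R).
  rewrite addrA [_ + pi / 2]addrC -addrA -mulrBr addrC cosDpihalf oppr_lt0.
  have n0 : 0 < n.+1%:R^-1 :> R by rewrite invr_gt0.
  have : n.+1%:R^-1 * `|x - a| < pi.
    rewrite mulrC ltr_pdivrMr//; apply: (@lt_le_trans _ _ n.+1%:R).
      rewrite (@lt_trans _ _ n%:R)// ?ltr_nat//.
      by near: n; exact: nbhs_infty_gtr.
    by rewrite ler_peMl// (le_trans _ (pi_ge2 _))// ler1n.
  have [xa|xa|->] := ltgtP a x.
  - rewrite gtr0_norm ?subr_gt0// => h; rewrite sin_gt0_pi.
      by apply/esym/mem_set; rewrite /= in_itv/= xa.
    by rewrite h mulr_gt0 ?subr_gt0.
  - rewrite ltr0_norm ?subr_lt0// => h; rewrite memNset; last first.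
      by rewrite /= in_itv/= andbT; apply/negP; rewrite -leNgt ltW.
    apply/negbTE; rewrite -leNgt -oppr_ge0 -sinN ltW// sin_gt0_pi// -mulrN h.
    by rewrite mulr_gt0// oppr_gt0 subr_lt0.
  - by rewrite subrr mulr0 sin0 ltxx memNset//= in_itv/= ltxx.
Unshelve. all: by end_near. Qed.

Let H0 : H (fun=> 0).
Proof.
rewrite (_ : (fun _ => _) = (fun x => cos (0 * x + 0) + -1 * cos (0 * x + 0))).
  exact: Hlin.
by apply/funext => x; ring.
Qed.

Let H1 : H (fun=> 1).
Proof. exact: H'H. Qed.

Let Hsum (F : nat -> R -> R) n : (forall i, bm (F i)) -> (forall i, H (F i)) ->
  H (fun x => \sum_(i < n) F i x).
Proof.
move=> bF HF; elim: n => [|n IH].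
  by rewrite (_ : (fun _ => _) = fun=> 0)//; apply/funext => x; rewrite big_ord0.
rewrite (_ : (fun _ => _) = fun x => \sum_(i < n) F i x + 1 * F n x).
  by apply: Hlin => //; exact: bm_sum.
by apply/funext => x; rewrite big_ord_recr /= mul1r.
Qed.

Let Hindic (B : set (measurableTypeR R)) : measurable B -> H (\1_B).
Proof.
rewrite (RGenOInfty.measurableE R) => mB.
pose P (A : set R) := H (\1_A).
apply: (@dynkin_induction _ (measurableTypeR R) (@RGenOInfty.G R) P _ _ _ _ _ _ B) => //.
- exact: (RGenOInfty.measurableE R).
- move=> _ _ [x ->] [y ->]; exists (Num.max x y).
  by apply/seteqP; split => z /=; rewrite !in_itv/= !andbT gt_max;
    [move=> [-> ->]|move/andP].
- by rewrite /P indicT.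
- by move=> _ [x ->]; exact: Hray.
- move=> A mA PA; rewrite /P (_ : \1_(~` A) = fun x => 1 + -1 * \1_A x).
    by apply: Hlin => //; [exact: bm_cst|exact: bm_indic].
  by apply/funext => x; rewrite !indicE in_setC; case: (x \in A) => /=; ring.
- move=> F mF tF PF.
  have Fsum n x : \sum_(i < n) \1_(F i) x = (if pselect (exists k, F k x) is left e
      then (sval (cid e) < n)%N%:R else 0) :> R.
    case: pselect => [e|nF]; last first.
      rewrite big1// => i _; rewrite indicE memNset// => Fi; apply: nF.
      by exists (i : nat).
    case: (cid e) => k Fk /=; elim: n => [|n IH]; first by rewrite big_ord0.
    rewrite big_ord_recr /= IH indicE.
    have [->|nk] := eqVneq n k; first by rewrite ltnn ltnSn mem_set// add0r.
    rewrite memNset ?addr0; last first.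
      move=> Fn; move/eqP : nk; apply; apply: (tF n k) => //.
      by exists x.
    by rewrite ltnS [in RHS]leq_eqVlt (eq_sym k n) (negbTE nk).
  apply: (Hlim (M := 1) (f_ := fun n x => \sum_(i < n) \1_(F i) x)).
  + by move=> n; apply: bm_sum => i; exact: bm_indic.
  + by move=> n; apply: (@Hsum (fun i => \1_(F i))) => // i; exact: bm_indic.
  + by apply: bm_indic; exact: bigcup_measurable.
  + by move=> n x; rewrite Fsum; case: pselect => [k|_]; rewrite ?normr0//;
      case: (_ < _)%N; rewrite ?normr1 ?normr0.
  + move=> x; under eq_fun do rewrite Fsum.
    case: pselect => [Fx|nFx]; apply: cvg_near_cst; near=> n.
      rewrite indicE mem_set//; last by case: (cid Fx) => k Fk; exists k.
      suff -> : (sval (cid Fx) < n)%N by [].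
      by near: n; exact: nbhs_infty_gt.
    by rewrite indicE memNset// => -[k _ Fk]; apply: nFx; exists k.
Unshelve. all: by end_near. Qed.

(** From cosines one obtains square waves, from square waves of growing period
    half-lines, from this pi-system all indicators, and then the bounded
    functions as limits of simple ones. The Fourier uniqueness theorem and its
    conditional versions are all instances. *)
Theorem trig_monotone_class f : bm f -> H f.
Proof.
move=> [mf [M fM]].
wlog f0 : f M mf fM / forall x, 0 <= f x.
  move=> wl; rewrite (_ : f = fun x => (f x + M) + - M * 1); last first.
    by apply/funext => x; ring.
  have bfM : bm (fun x => f x + M) by apply: bmD; [split => //; exists M|exact: bm_cst].
  apply: Hlin => //; first exact: bm_cst.
  case: bfM => mfM [N fN]; apply: (wl _ N) => // x.
  by have := fM x; rewrite ler_norml => /andP[]; lra.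
have mfE : measurable_fun setT (EFin \o f) by exact/measurable_EFinP.
pose a := nnsfun_approx measurableT mfE.
have acvg x : a n x @[n --> \oo] --> f x.
  have h : (a n x)%:E @[n --> \oo] --> (EFin \o f) x.
    by apply: cvg_nnsfun_approx => // y _; rewrite lee_fin.
  exact: (fine_cvg h).
have afM n x : `|a n x| <= M.
  rewrite ger0_norm; last exact: fun_ge0.
  apply: (@le_trans _ _ (f x)); last exact: le_trans (ler_norm _) (fM x).
  apply: (cvgr_to_ge (acvg x)); near=> m.
  have nm : (n <= m)%N by near: m; exact: nbhs_infty_ge.
  by have /lefP/(_ x) := nd_nnsfun_approx measurableT mfE nm.
apply: (Hlim (M := M) (f_ := fun n => a n)) => //.
- by move=> n; split => //; exists M.
- move=> n; rewrite (_ : (a n : R -> R) = fun x => a n x)//.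
  under eq_fun do rewrite fimfunE fsbig_finite//=.
  elim: (finmap.enum_fset _) => [|y s IH].
    by rewrite (_ : (fun _ => _) = fun=> 0)//; apply/funext => x; rewrite big_nil.
  under eq_fun do rewrite big_cons addrC.
  apply: Hlin => //.
  + by apply: bm_sum => z; apply: bmZ; exact: bm_indic.
  + exact: bm_indic.
  + exact: Hindic.
- by split => //; exists M.
Unshelve. all: by end_near. Qed.

End TrigMonotoneClass.

Section CosDeterminesLaw.
Context {R : realType} d1 (T1 : measurableType d1) (P1 : probability T1 R).
Context d2 (T2 : measurableType d2) (P2 : probability T2 R).
Variables (w1 X1 : T1 -> R) (w2 X2 : T2 -> R).
Hypotheses (bw1 : bounded_measurable w1) (bw2 : bounded_measurable w2).
Hypotheses (mX1 : measurable_fun setT X1) (mX2 : measurable_fun setT X2).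

(** With weights, the statement also identifies conditional expectations. *)
Lemma cos_determines_law :
  (forall t c, \int[P1]_x (w1 x * cos (t * X1 x + c)) =
               \int[P2]_x (w2 x * cos (t * X2 x + c))) ->
  forall f : R -> R, bounded_measurable f ->
    \int[P1]_x (w1 x * f (X1 x)) = \int[P2]_x (w2 x * f (X2 x)).
Proof.
move=> h f bf.
pose H (g : R -> R) := \int[P1]_x (w1 x * g (X1 x)) = \int[P2]_x (w2 x * g (X2 x)).
have b1 (g : R -> R) : bounded_measurable g -> bounded_measurable (fun x => w1 x * g (X1 x)).
  by move=> bg; apply: bmM => //; exact: (bm_comp bg).
have b2 (g : R -> R) : bounded_measurable g -> bounded_measurable (fun x => w2 x * g (X2 x)).
  by move=> bg; apply: bmM => //; exact: (bm_comp bg).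
have distr d (T : measurableType d) (P : probability T R) (w X : T -> R)
    (b : forall g : R -> R, bounded_measurable g -> bounded_measurable (fun x => w x * g (X x)))
    (g k : R -> R) c : bounded_measurable g -> bounded_measurable k ->
    \int[P]_x (w x * (g (X x) + c * k (X x))) =
    \int[P]_x (w x * g (X x)) + c * \int[P]_x (w x * k (X x)).
  move=> bg bk; rewrite -Elin; [|exact: b|exact: b].
  by apply: eq_Rintegral => x _; ring.
apply: (trig_monotone_class (H := H)) => //.
- move=> g k c bg bk Hg Hk; rewrite /H (distr _ _ _ _ _ b1)//.
  by rewrite (distr _ _ _ _ _ b2)// Hg Hk.
- move=> f_ g M bf_ Hf bg fM fg.
  have [M1 wM1] := bw1.2; have [M2 wM2] := bw2.2.
  have cvg d (T : measurableType d) (P : probability T R) (w X : T -> R)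
      (b : forall g : R -> R, bounded_measurable g -> bounded_measurable (fun x => w x * g (X x)))
      N : (forall x, `|w x| <= N) ->
      \int[P]_x (w x * f_ n (X x)) @[n --> \oo] --> \int[P]_x (w x * g (X x)).
    move=> wN; apply: (E_cvg (M := N * M)).
    + by move=> n; case: (b _ (bf_ n)).
    + by case: (b _ bg).
    + by move=> n x; rewrite normrM ler_pM.
    + by move=> x; apply: cvgMl_tmp; exact: fg.
  have c1 := cvg _ _ P1 w1 X1 b1 M1 wM1.
  have c2 := cvg _ _ P2 w2 X2 b2 M2 wM2.
  rewrite (_ : (fun n => _) = fun n => \int[P2]_x (w2 x * f_ n (X2 x))) in c1.
    exact: (cvg_unique _ c1 c2).
  by apply/funext => n; exact: Hf.
Qed.

End CosDeterminesLaw.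

(** * The normal law *)

Section Normal.
Variable R : realType.
Notation mu := (@lebesgue_measure R).

(** [normal_prob] is defined by integrating its density over sets; the
    Radon-Nikodym change of variables carries this over to functions. *)
Lemma ge0_integral_normal_prob (m s : R) (f : R -> \bar R) :
  measurable_fun setT f -> (forall x, 0 <= f x)%E ->
  (\int[normal_prob m s]_x f x = \int[mu]_x (f x * (normal_pdf m s x)%:E))%E.
Proof.
move=> mf f0.
have dom := normal_prob_dominates m s.
rewrite -(Radon_Nikodym_SigmaFinite.change_of_variables dom)//.
have RNi := Radon_Nikodym_SigmaFinite.f_integrable dom.
have mpdf : measurable_fun setT (fun x => (normal_pdf m s x)%:E).
  by apply/measurable_EFinP; exact: measurable_normal_pdf.
apply: ae_eq_integral => //.
- by apply: emeasurable_funM => //; exact: measurable_int RNi.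
- exact: emeasurable_funM.
- apply: ae_eqe_mul2l; apply: integral_ae_eq => //.
  by move=> A _ mA; rewrite -Radon_Nikodym_SigmaFinite.f_integral.
Qed.

Lemma integral_normal_prob (m s : R) (f : R -> R) :
  measurable_fun setT f -> mu.-integrable setT (fun x => (f x * normal_pdf m s x)%:E) ->
  (normal_prob m s).-integrable setT (EFin \o f) /\
  \int[normal_prob m s]_x f x = \int[mu]_x (f x * normal_pdf m s x).
Proof.
move=> mf fi; have mfE : measurable_fun setT (EFin \o f) by exact/measurable_EFinP.
have p0 x : (0 <= (normal_pdf m s x)%:E)%E by rewrite lee_fin normal_pdf_ge0.
split.
  apply/integrableP; split => //.
  rewrite ge0_integral_normal_prob //; last exact: measurableT_comp.
  move/integrableP : fi => [_]; apply: le_lt_trans.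
  rewrite le_eqVlt; apply/orP; left; apply/eqP; apply: eq_integral => x _ /=.
  by rewrite normrM EFinM [X in (_ * X%:E)%E]ger0_norm// normal_pdf_ge0.
congr fine; rewrite [LHS]integralE [RHS]integralE.
rewrite !ge0_integral_normal_prob//; last first.
- exact: measurable_funepos.
- exact: measurable_funeneg.
have pE x : 0 <= normal_pdf m s x by exact: normal_pdf_ge0.
congr (_ - _)%E; apply: eq_integral => x _; rewrite ?funeposE ?funenegE/=.
  by rewrite -EFin_max -EFinM -EFin_max maxr_pMl// mul0r.
by rewrite -EFin_max -EFinM -EFin_max maxr_pMl// mul0r mulNr.
Qed.

(** Links integrals over the line to segments, where the fundamental theorem of
    calculus applies. *)
Lemma cvg_integral_symmetric (f : R -> R) : mu.-integrable setT (EFin \o f) ->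
  \int[mu]_(x in `[- n%:R, n%:R]) f x @[n --> \oo] --> \int[mu]_x f x.
Proof.
move=> fi; have mf := measurable_int _ fi.
pose f_ (n : nat) x := ((f \_ (`[- n%:R, n%:R]%classic)) x)%:E.
have mf_ n : measurable_fun setT (f_ n).
  apply/measurable_EFinP/(measurable_restrictT _ _).1 => //.
  by apply: measurable_funTS; exact/measurable_EFinP.
have f_f : {ae mu, forall x, setT x -> f_ n x @[n --> \oo] --> (f x)%:E}.
  apply: aeW => x _; apply: cvg_near_cst; near=> n.
  rewrite /f_ patchE mem_set// /= in_itv/= -ler_norml ltW//.
  by near: n; exact: nbhs_infty_gtr.
have f_le : {ae mu, forall x n, setT x -> (`|f_ n x| <= (`|f x|)%:E)%E}.
  apply: aeW => x n _; rewrite /f_ patchE; case: ifPn => _ //=.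
  by rewrite normr0 lee_fin.
have [_ _] := @dominated_convergence _ _ _ mu setT measurableT f_ (EFin \o f)
  (fun x => `|(f x)%:E|%E) mf_ mf f_f (integrable_abse fi) f_le.
have e : (\int[mu]_x (f x)%:E = (\int[mu]_x f x)%:E)%E.
  by rewrite fineK//; exact: integrable_fin_num.
rewrite e => /fine_cvg; apply: cvg_trans; apply: near_eq_cvg; near=> n.
rewrite /= /Rintegral integral_mkcond; congr fine; apply: eq_integral => x _.
by rewrite /f_ restrict_EFin.
Unshelve. all: by end_near. Qed.

Variable s : R.
Hypothesis s0 : 0 < s.
Local Notation p := (normal_pdf 0 s).
Local Notation q := (normal_pdf 0 (Num.sqrt 2 * s)).

Let pE x : p x = normal_peak s * expR (- x ^+ 2 / (s ^+ 2 *+ 2)).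
Proof. by rewrite normal_pdfE ?gt_eqF// /normal_fun subr0. Qed.

Let s2 : 0 < Num.sqrt 2 * s. Proof. by rewrite mulr_gt0// sqrtr_gt0. Qed.

Let qE x : q x = normal_peak (Num.sqrt 2 * s) * expR (- x ^+ 2 / (s ^+ 2 *+ 4)).
Proof.
rewrite normal_pdfE ?gt_eqF// /normal_fun subr0; congr (_ * expR (_ / _)).
by rewrite exprMn sqr_sqrtr// -[RHS]mulr_natr -[LHS]mulr_natr; ring.
Qed.

(** Polynomial factors are absorbed by a slightly wider Gaussian. *)
Lemma poly_normal_pdf_le : exists2 K, 0 <= K & forall x, (1 + x ^+ 2) * p x <= K * q x.
Proof.
have N0 : 0 < normal_peak s by rewrite normal_peak_gt0 ?gt_eqF.
have N'0 : 0 < normal_peak (Num.sqrt 2 * s) by rewrite normal_peak_gt0 ?gt_eqF.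
have s4 : 0 < s ^+ 2 *+ 4 by rewrite pmulrn_lgt0// exprn_gt0.
exists ((1 + s ^+ 2 *+ 4) * normal_peak s / normal_peak (Num.sqrt 2 * s)) => [|x].
  by rewrite !mulr_ge0 ?invr_ge0// ?ltW// addr_gt0.
rewrite qE mulrA divfK ?gt_eqF// pE.
have -> : - x ^+ 2 / (s ^+ 2 *+ 2) = - x ^+ 2 / (s ^+ 2 *+ 4) + - x ^+ 2 / (s ^+ 2 *+ 4).
  rewrite -[s ^+ 2 *+ 4]mulr_natr -[s ^+ 2 *+ 2]mulr_natr; field.
  by rewrite gt_eqF.
rewrite expRD; set e := expR _; have e0 : 0 < e by exact: expR_gt0.
suff h : (1 + x ^+ 2) * e <= 1 + s ^+ 2 *+ 4.
  rewrite (_ : (1 + x ^+ 2) * (normal_peak s * (e * e)) =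
    ((1 + x ^+ 2) * e) * (normal_peak s * e)); last by ring.
  by rewrite -[leRHS]mulrA ler_wpM2r// mulr_ge0// ltW.
rewrite /e mulNr expRN ler_pdivrMr ?expR_gt0//.
apply: (@le_trans _ _ ((1 + s ^+ 2 *+ 4) * (1 + x ^+ 2 / (s ^+ 2 *+ 4)))); last first.
  by apply: ler_wpM2l; [rewrite addr_ge0// ltW|exact: expR_ge1Dx].
rewrite mulrDr mulr1 mulrDl mul1r [(s ^+ 2 *+ 4) * _]mulrC divfK ?gt_eqF//.
have : 0 <= x ^+ 2 / (s ^+ 2 *+ 4) by rewrite divr_ge0 ?sqr_ge0// ltW.
by move: s4; lra.
Qed.

Lemma integrable_poly_normal (f : R -> R) C : measurable_fun setT f ->
  (forall x, `|f x| <= C * (1 + x ^+ 2)) ->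
  mu.-integrable setT (fun x => (f x * p x)%:E).
Proof.
move=> mf fC; have [K K0 Kpq] := poly_normal_pdf_le.
apply: (@le_integrable _ _ _ mu setT measurableT _ (fun x => (C * K)%:E * (q x)%:E)%E).
- apply/measurable_EFinP/measurable_funM => //; exact: measurable_normal_pdf.
- move=> x _; rewrite /= lee_fin !normrM (ger0_norm (normal_pdf_ge0 _ _ x)).
  rewrite [X in _ <= _ * X]ger0_norm ?normal_pdf_ge0//.
  have C0 : 0 <= C.
    have := fC 0; rewrite expr0n addr0 mulr1; exact: le_trans.
  rewrite (ger0_norm C0) (ger0_norm K0) -mulrA.
  apply: (@le_trans _ _ (C * (1 + x ^+ 2) * p x)).
    by apply: ler_wpM2r => //; exact: normal_pdf_ge0.
  by rewrite -mulrA ler_wpM2l.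
- by apply: integrableZl => //; exact: integrable_normal_pdf.
Qed.

Let dp (x : R) : is_derive x 1 p (- x / s ^+ 2 * p x).
Proof.
rewrite (_ : p = fun x => normal_peak s * expR (- x ^+ 2 / (s ^+ 2 *+ 2))); last first.
  by apply/funext => y; rewrite pE.
apply: is_derive_eq.
rewrite /GRing.scale/= -[s ^+ 2 *+ 2]mulr_natr; field.
by rewrite gt_eqF.
Qed.

(** Gaussian integration by parts (Stein's identity). *)
Lemma normal_integration_by_parts (G g : R -> R) C :
  (forall x : R, is_derive x 1 G (g x)) -> continuous g ->
  (forall x : R, `|G x| <= C * (1 + x ^+ 2)) ->
  (forall x : R, `|g x| <= C * (1 + x ^+ 2)) ->
  (forall x : R, `|x * G x| <= C * (1 + x ^+ 2)) ->
  \int[mu]_x (x * G x * p x) = s ^+ 2 * \int[mu]_x (g x * p x).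
Proof.
move=> dG cg GC gC xGC.
have cG : continuous G.
  by move=> x; apply: differentiable_continuous; apply/derivable1_diffP; case: (dG x).
have cp : continuous p by apply: continuous_normal_pdf; rewrite gt_eqF.
have mG : measurable_fun setT G by exact: continuous_measurable_fun.
have mg : measurable_fun setT g by exact: continuous_measurable_fun.
have mxG : measurable_fun setT (fun x : R => x * G x) by apply: measurable_funM.
have i1 := integrable_poly_normal mg gC.
have i2 := integrable_poly_normal mxG xGC.
pose f x := g x * p x - (s ^- 2) * (x * G x * p x).
have i2' : mu.-integrable setT (fun x : R => (s ^- 2 * (x * G x * p x))%:E).
  under eq_fun do rewrite EFinM; exact: integrableZl.
have fi : mu.-integrable setT (EFin \o f).
  rewrite (_ : EFin \o f = (fun x => (g x * p x)%:E - (s ^- 2 * (x * G x * p x))%:E)%E).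
    exact: integrableB.
  by apply/funext => x; rewrite -EFinB.
have cf : continuous f.
  move=> x; apply: cvgB; first by apply: cvgM; [exact: cg|exact: cp].
  apply: cvgMl_tmp; apply: cvgM; last exact: cp.
  by apply: cvgM; [exact: cvg_id|exact: cG].
have dGp (x : R) : is_derive x 1 (fun x => G x * p x) (f x).
  apply: (is_derive_eq (is_deriveM (dG x) (dp x))); rewrite /f /GRing.scale/=; field.
  by rewrite gt_eqF.
have cGp : continuous (fun x => G x * p x).
  by move=> x; apply: cvgM; [exact: cG|exact: cp].
have FTC n : \int[mu]_(x in `[- n.+1%:R, n.+1%:R]) f x =
    G n.+1%:R * p n.+1%:R - G (- n.+1%:R) * p (- n.+1%:R).
  rewrite /Rintegral (@continuous_FTC2 _ f (fun x => G x * p x))//.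
  - by rewrite gtrN.
  - exact: continuous_subspaceT.
  - split; [move=> x _; by case: (dGp x)| |].
      by apply: cvg_at_right_filter; exact: cGp.
    by apply: cvg_at_left_filter; exact: cGp.
  - by move=> x _; rewrite derive1E; case: (dGp x).
have [K K0 Kpq] := poly_normal_pdf_le.
have C0 : 0 <= C by have := GC 0; rewrite expr0n addr0 mulr1; exact: le_trans.
have Gpq x : `|G x * p x| <= C * K * q x.
  rewrite normrM (ger0_norm (normal_pdf_ge0 _ _ x)).
  apply: (@le_trans _ _ (C * (1 + x ^+ 2) * p x)).
    by apply: ler_wpM2r => //; exact: normal_pdf_ge0.
  by rewrite -!mulrA ler_wpM2l.
have qn : q n.+1%:R @[n --> \oo] --> 0.
  pose M := normal_peak (Num.sqrt 2 * s) * (s ^+ 2 *+ 4).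
  have s4 : 0 < s ^+ 2 *+ 4 by rewrite pmulrn_lgt0// exprn_gt0.
  apply: (squeeze_cvgr (f := cst 0) (h := fun n => M * n.+1%:R^-1)).
  - near=> n; rewrite normal_pdf_ge0/= qE /M -mulrA ler_wpM2l ?normal_peak_ge0//.
    rewrite mulNr expRN -[leRHS]invrK lef_pV2 ?posrE ?expR_gt0//; last first.
      by rewrite invr_gt0 divr_gt0.
    rewrite invf_div; apply: le_trans (expR_ge1Dx _).
    apply: (@le_trans _ _ (n.+1%:R ^+ 2 / (s ^+ 2 *+ 4))); last by rewrite lerDr.
    by rewrite ler_wpM2r ?invr_ge0 ?(ltW s4)// expr2 ler_peMl// ler1n.
  - exact: cvg_cst.
  - by rewrite -[X in _ --> X](mulr0 M); apply: cvgMl_tmp; exact: cvg_harmonic.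
have f0 : \int[mu]_x f x = 0.
  have h : G n.+1%:R * p n.+1%:R - G (- n.+1%:R) * p (- n.+1%:R)
      @[n --> \oo] --> \int[mu]_x f x.
    by under eq_fun do rewrite -FTC; have := cvg_integral_symmetric fi; rewrite -cvg_shiftS.
  apply: (cvg_unique _ h) => //.
  apply: norm_cvg0.
  apply: (squeeze_cvgr (f := cst 0) (h := fun n => 2 * (C * K) * q n.+1%:R)).
  - near=> n; rewrite normr_ge0/=.
    have qN : q (- n.+1%:R) = q n.+1%:R by rewrite !qE sqrrN.
    have := Gpq (- n.+1%:R); have := Gpq n.+1%:R; rewrite qN.
    by have := ler_normB (G n.+1%:R * p n.+1%:R) (G (- n.+1%:R) * p (- n.+1%:R)); lra.
  - exact: cvg_cst.
  - by rewrite -[X in _ --> X](mulr0 (2 * (C * K))); exact: cvgMl_tmp.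
move: f0; rewrite /f RintegralB// RintegralZl// => /eqP; rewrite subr_eq0 => /eqP ->.
by rewrite mulrA divff ?mul1r// expf_neq0// gt_eqF.
Unshelve. all: by end_near. Qed.

Let bound1 (x : R) : `|x| <= 1 * (1 + x ^+ 2).
Proof. by rewrite mul1r -(real_normK (num_real x)); nra. Qed.

Let mcos t c : measurable_fun setT (fun x : R => cos (t * x + c)).
Proof. by case: (@bm_cos R _ _ (fun x => t * x) c) => //; exact: measurable_funM. Qed.

Lemma integral_normal_sqr :
  (normal_prob 0 s).-integrable setT (fun x => (x ^+ 2)%:E) /\
  \int[normal_prob 0 s]_x (x ^+ 2) = s ^+ 2.
Proof.
have msq : measurable_fun setT (fun x : R => x ^+ 2) by exact: measurable_funX.
have [||i e] := @integral_normal_prob 0 s (fun x => x ^+ 2) => //.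
  apply: (@integrable_poly_normal _ 1) => // x.
  by rewrite ger0_norm ?sqr_ge0// mul1r lerDr.
split=> //; rewrite e.
have := @normal_integration_by_parts id (cst 1) 1.
under eq_Rintegral do rewrite -expr2.
move=> ->//.
- rewrite /= -[RHS]mulr1; congr (_ * _).
  under eq_Rintegral do rewrite mul1r.
  by rewrite /Rintegral integral_normal_pdf.
- by move=> x; exact: cvg_cst.
- by move=> x; rewrite normr1 mul1r lerDl sqr_ge0.
- by move=> x; rewrite -expr2 ger0_norm ?sqr_ge0// mul1r lerDr.
Qed.

Lemma integral_normal_id :
  (normal_prob 0 s).-integrable setT (fun x => x%:E) /\
  \int[normal_prob 0 s]_x x = 0.
Proof.
have [||i e] := @integral_normal_prob 0 s (fun x => x) => //.
  by apply: (@integrable_poly_normal _ 1) => // x.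
split=> //; rewrite e.
transitivity (\int[mu]_x (x * 1 * p x)).
  by apply: eq_Rintegral => x _; rewrite mulr1.
rewrite (@normal_integration_by_parts (fun=> 1) (fun=> 0) 1).
- under eq_Rintegral do rewrite mul0r.
  by rewrite /Rintegral integral0 mulr0.
- by move=> x; exact: cvg_cst.
- by move=> x; rewrite normr1 mul1r lerDl sqr_ge0.
- by move=> x; rewrite normr0 mul1r addr_ge0 ?sqr_ge0.
- by move=> x; rewrite mulr1.
Qed.

(** As a function of [t], the integral [F] satisfies [F' t = - s ^+ 2 * t * F t]:
    differentiate under the integral, then integrate by parts. *)
Lemma integral_normal_cos t c :
  \int[normal_prob 0 s]_x cos (t * x + c) = expR (- (s * t) ^+ 2 / 2) * cos c.
Proof.
have icos t' : mu.-integrable setT (fun x => (cos (t' * x + c) * p x)%:E).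
  apply: (@integrable_poly_normal _ 1) => // x; rewrite mul1r.
  apply: (@le_trans _ _ 1); last by rewrite lerDl sqr_ge0.
  by rewrite ler_norml cos_geN1 cos_le1.
have [_ ->] := @integral_normal_prob 0 s _ (mcos t c) (icos t).
pose F t := \int[mu]_x (cos (t * x + c) * p x).
pose S t := \int[mu]_x (- (x * sin (t * x + c)) * p x).
have dcos (t' x : R) : is_derive t' 1 (fun t : R => cos (t * x + c) * p x)
    (- (x * sin (t' * x + c)) * p x).
  apply: is_derive_eq; rewrite /GRing.scale/=; ring.
have dF (t' : R) : is_derive t' 1 F (S t').
  have h1 (x y : R) : `]t' - 1, t' + 1[%classic x -> setT y ->
      derivable (fun t : R => cos (t * y + c) * p y) x 1 by move=> _ _; case: (dcos x y).
  have h2 (x y : R) : `]t' - 1, t' + 1[%classic x -> setT y ->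
      `|partial1of2 (fun t x : R => cos (t * x + c) * p x) x y| <= `|y| * p y.
    move=> _ _; rewrite partial1of2E derive_val normrM.
    rewrite [X in _ * X <= _]ger0_norm ?normal_pdf_ge0// ler_wpM2r ?normal_pdf_ge0//.
    by rewrite normrN normrM ler_piMr// ler_norml sin_geN1 sin_le1.
  have h0 : `]t' - 1, t' + 1[%classic t' by rewrite /= in_itv/= ltrDl ltrBlDr ltrDl ltr01.
  have hG y : 0 <= `|y| * p y by rewrite mulr_ge0// normal_pdf_ge0.
  have iG : mu.-integrable setT (EFin \o (fun y => `|y| * p y)).
    apply: (@integrable_poly_normal _ 1) => [|x]; first exact: normr_measurable.
    by rewrite normr_id.
  have dr := @derivable_under_integral R _ _ mu _ setT measurableT t' _ _ h0
    (fun x _ => icos x) h1 _ hG iG h2.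
  have de := @differentiation_under_integral R _ _ mu _ setT measurableT t' _ _ h0
    (fun x _ => icos x) h1 _ hG iG h2.
  apply: DeriveDef => //; rewrite -derive1E de.
  apply: eq_Rintegral => x _ /=.
  by rewrite partial1of2E derive_val.
have SF t' : S t' = - (s ^+ 2 * t') * F t'.
  pose g (x : R) := - (t' * cos (t' * x + c)).
  have dG (x : R) : is_derive x 1 (fun x => - sin (t' * x + c)) (g x).
    by apply: is_derive_eq; rewrite /g /GRing.scale/=; ring.
  have bcos x : `|cos x| <= 1 :> R by rewrite ler_norml cos_geN1 cos_le1.
  have bsin x : `|sin x| <= 1 :> R by rewrite ler_norml sin_geN1 sin_le1.
  have cg : continuous g.
    move=> x; apply: (@cvgN _ R^o); apply: cvgMl_tmp.
    apply: (continuous_comp (f := fun x => t' * x + c)); last exact: continuous_cos.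
    by apply: (@cvgD _ R^o); [apply: cvgMl_tmp; exact: cvg_id|exact: cvg_cst].
  have t1 x : (1 + `|t'|) * (1 + x ^+ 2) >= 1 + x ^+ 2.
    by rewrite ler_peMl ?addr_ge0 ?sqr_ge0// lerDl.
  have IBP := @normal_integration_by_parts _ g (1 + `|t'|) dG cg.
  transitivity (\int[mu]_x (x * (- sin (t' * x + c)) * p x)).
    by apply: eq_Rintegral => x _; ring.
  rewrite IBP.
  - transitivity (s ^+ 2 * (- t' * F t')); last by ring.
    congr (_ * _); rewrite -RintegralZl; [|by []|exact: icos].
    by apply: eq_Rintegral => x _; rewrite /g; ring.
  - move=> x; rewrite normrN (le_trans (bsin _))// (le_trans _ (t1 x))//.
    by rewrite lerDl sqr_ge0.
  - move=> x; rewrite normrN normrM.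
    apply: (@le_trans _ _ `|t'|).
      by rewrite ler_piMr.
    have := sqr_ge0 x; have := normr_ge0 t'; nra.
  - move=> x; rewrite mulrN normrN normrM.
    apply: (@le_trans _ _ `|x|); first by rewrite ler_piMr.
    by rewrite (le_trans (bound1 x))// mul1r.
have dcst (x : R) : is_derive x 1 (fun t => expR ((s * t) ^+ 2 / 2) * F t) 0.
  have dE : is_derive x 1 (fun t => expR ((s * t) ^+ 2 / 2))
      (s ^+ 2 * x * expR ((s * x) ^+ 2 / 2)).
    by apply: is_derive_eq; rewrite /GRing.scale/=; field.
  apply: (is_derive_eq (is_deriveM dE (dF x))).
  by rewrite SF /GRing.scale/=; ring.
have h := @is_derive_0_is_cst R _ t 0 dcst.
have e0 : expR ((s * t) ^+ 2 / 2) != 0 by rewrite gt_eqF// expR_gt0.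
rewrite -/(F t) mulNr expRN.
apply: (mulfI e0); rewrite mulrA divff// mul1r h.
rewrite mulr0 expr0n mul0r expR0 mul1r /F.
under eq_Rintegral do rewrite mul0r add0r.
rewrite RintegralZl//; last exact: integrable_normal_pdf.
by rewrite /Rintegral integral_normal_pdf mulr1.
Qed.

End Normal.

(** * Branches of a regular tree *)

Section Tree.
Variables (V : choiceType) (adj : rel V) (d : nat).
Hypothesis tree : regular_tree adj d.+1.
Implicit Types (p x y z : V) (s : seq V).

Let symA : symmetric adj := tree_sym tree.
Let irrA : irreflexive adj := tree_irrefl tree.

(** [s] continues the directed edge [(p, x)]. In a tree this local condition
    amounts to being a simple path ([uniq_nb], [nb_uniq]), and unlike simplicity
    it can be checked step by step. *)
Fixpoint nonbacktracking p x s : bool :=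
  if s is y :: s' then [&& adj x y, y != p & nonbacktracking x y s'] else true.
Local Notation nb := nonbacktracking.

Lemma nb_path p x s : adj p x -> nb p x s -> path adj p (x :: s).
Proof.
elim: s p x => [|y s IH] p x px; first by rewrite /= px.
by case/and3P => xy _ nbs; rewrite [path _ _ _]/= px; exact: IH.
Qed.

Lemma uniq_nb p x s : path adj p (x :: s) -> uniq (p :: x :: s) -> nb p x s.
Proof.
elim: s p x => [//|y s IH] p x /and3P[px xy ys] u /=.
rewrite xy (IH x y) ?andbT //=.
- by apply: contraTneq u => ->; rewrite /= !inE eqxx !orbT.
- by rewrite xy.
- by move: u => /andP[].
Qed.

(** A non-backtracking walk that returns to its starting point would, at its
    first return, close a simple cycle of length at least three. *)
Lemma nb_uniq p x s : adj p x -> nb p x s -> uniq (p :: x :: s).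
Proof.
elim: s p x => [|y s IH] p x px nbs.
  by rewrite /= inE andbT; apply: contraTneq px => ->; rewrite irrA.
have [xy yp nbys] := and3P nbs.
have u := IH _ _ xy nbys.
rewrite cons_uniq u andbT; apply/negP => pin.
have [s1 [s2 def_s]] : exists s1 s2, [:: x, y & s] = s1 ++ p :: s2.
  by case/splitPr: pin => s1 s2; exists s1, s2.
have := nb_path px nbs; rewrite def_s in u *; rewrite cat_path => /andP[ps1 /= /andP[lp _]].
have sz : (2 < size (p :: s1))%N.
  case: s1 def_s {u ps1 lp} => [|a [|b s1]]//= [].
  - by move=> xp; rewrite xp irrA in px.
  - by move=> _ yp'; rewrite yp' eqxx in yp.
apply: (tree_acyclic tree sz); rewrite /ucycle /cycle rcons_path ps1 lp /=.
by move: u; rewrite cat_uniq /= => /and3P[-> /norP[-> _] _].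
Qed.

Definition branch p x : set V := [set y | exists2 s, nb p x s & last x s = y].

Lemma branch_root p x : branch p x x. Proof. by exists [::]. Qed.

Lemma branch_child p x y z : adj x y -> y != p -> branch x y z -> branch p x z.
Proof. by move=> xy yp [s nbs <-]; exists (y :: s); rewrite //= xy yp. Qed.

Lemma branchN p x : adj p x -> ~ branch p x p.
Proof.
move=> px [s nbs e]; have := nb_uniq px nbs; rewrite cons_uniq => /andP[/negP h _].
by apply: h; rewrite -[X in X \in _]e mem_last.
Qed.

(** Rerooting along the first walk turns two walks leaving [x] by different
    edges towards the same vertex into one closed non-backtracking walk. *)
Lemma branch_disjoint x y y' z : adj x y -> adj x y' -> y != y' ->
  branch x y z -> ~ branch x y' z.
Proof.
move=> xy xy' yy' [s nbs <-] [s' nbs' e].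
elim: s x y y' s' xy xy' yy' nbs nbs' e => [|a s IH] x y y' s' xy xy' yy' /=.
  move=> _ nbs' e; apply: (@branchN y x); first by rewrite symA.
  by exists (y' :: s') => //=; rewrite xy' eq_sym yy'.
move=> /and3P[ya ax nbs] nbs' e.
apply: (IH y a x (y' :: s')) => //=; first by rewrite symA.
by rewrite xy' eq_sym yy'.
Qed.

(** An edge splits the tree into the two branches at its ends. *)
Lemma branch_opp p x y : adj p x -> ~ branch p x y -> branch x p y.
Proof.
move=> px nT; have [q0 xq0 e0] := tree_connected tree x y.
move: e0; case/shortenP: xq0 => q xq u _ e; case: q xq u e => [|a q] xq u /= e.
  by case: nT; rewrite -e; exact: branch_root.
have nbq := uniq_nb xq u; have [ap|ap] := eqVneq a p.
  by exists q; rewrite -?ap.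
by case: nT; exists (a :: q) => //=; rewrite ap nbq; case/andP: xq => ->.
Qed.

Definition simple_path x y s := [/\ path adj x s, uniq (x :: s) & last x s = y].

(** Two paths that leave [x] by different edges end in disjoint branches. *)
Lemma simple_path_unique x y s s' : simple_path x y s -> simple_path x y s' -> s = s'.
Proof.
elim: s x s' => [|a s IH] x [|b s'] //.
- by move=> [_ _ /= <-] [_ + /= e]; rewrite cons_uniq -[X in X \in _]e mem_last.
- by move=> [_ + /= e] [_ _ /= ex]; rewrite -ex in e; rewrite cons_uniq -[X in X \in _]e mem_last.
move=> [ps us ls] [ps' us' ls'].
have xa : adj x a by case/andP: ps.
have xb : adj x b by case/andP: ps'.
have [ab|ab] := eqVneq a b; last first.
  exfalso; apply: (branch_disjoint xa xb ab (z := y)).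
    by exists s => //; exact: uniq_nb.
  by exists s' => //; exact: uniq_nb.
rewrite -ab in ps' us' ls' *; congr cons; apply: (IH a); split => //.
- by case/andP: ps.
- by case/andP: us.
- by case/andP: ps'.
- by case/andP: us'.
Qed.

Lemma simple_path_exists x y : exists s, simple_path x y s.
Proof.
have [q0 xq0 e0] := tree_connected tree x y.
by move: e0; case/shortenP: xq0 => q xq u _ e; exists q.
Qed.

Definition dist x y : nat := size (sval (cid (simple_path_exists x y))).

Lemma dist_simple_path x y s : simple_path x y s -> dist x y = size s.
Proof. by rewrite /dist; case: cid => /= s' h h'; rewrite (simple_path_unique h h'). Qed.

Lemma dist_xx x : dist x x = 0%N.
Proof. exact: (@dist_simple_path x x [::]). Qed.

Lemma dist_branch p x y : adj p x -> branch p x y -> dist p y = (dist x y).+1.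
Proof.
move=> px [s nbs e].
have ps := nb_path px nbs; have us := nb_uniq px nbs.
rewrite (@dist_simple_path x y s); last by split=> //; [case/andP: ps|case/andP: us].
by rewrite (@dist_simple_path p y (x :: s)).
Qed.

Lemma branch_exists x y : x != y -> exists2 p, adj x p & branch x p y.
Proof.
move=> xy; have [[|p s] [ps us e]] := simple_path_exists x y.
  by rewrite -e eqxx in xy.
by exists p; [case/andP: ps|exists s => //; exact: uniq_nb].
Qed.

Let nbrs_exists x : exists s : seq V,
  [/\ uniq s, size s = d.+1 & forall y, (y \in s) = adj x y].
Proof.
exists (finmap.enum_fset (fset_set [set y | adj x y])); split.
- exact: finmap.fset_uniq.
- exact: card_fset_set (tree_regular tree x).
- move=> y; transitivity (y \in [set y | adj x y]).
    apply: in_fset_set; apply/finite_setP; exists d.+1; exact: tree_regular tree x.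
  by apply/idP/idP; rewrite inE.
Qed.

Definition nbrs x : seq V := sval (cid (nbrs_exists x)).
Lemma nbrs_uniq x : uniq (nbrs x). Proof. by rewrite /nbrs; case: cid => s []. Qed.
Lemma size_nbrs x : size (nbrs x) = d.+1. Proof. by rewrite /nbrs; case: cid => s []. Qed.
Lemma mem_nbrs x y : (y \in nbrs x) = adj x y.
Proof. by rewrite /nbrs; case: cid => s []. Qed.

Definition kids p x : seq V := rem p (nbrs x).

Lemma mem_kids p x y : (y \in kids p x) = adj x y && (y != p).
Proof. by rewrite /kids mem_rem_uniq ?nbrs_uniq// inE mem_nbrs andbC. Qed.

Lemma kids_uniq p x : uniq (kids p x).
Proof. by rewrite rem_uniq ?nbrs_uniq. Qed.

Lemma size_kids p x : adj p x -> size (kids p x) = d.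
Proof. by move=> px; rewrite size_rem ?size_nbrs// mem_nbrs symA. Qed.

Lemma perm_nbrs p x : adj p x -> perm_eq (nbrs x) (p :: kids p x).
Proof. by move=> px; apply: perm_to_rem; rewrite mem_nbrs symA. Qed.

End Tree.

(** * The Green function *)

Section Green.
Variables (R : realType) (V : choiceType) (adj : rel V) (d : nat).
Hypothesis tree : regular_tree adj d.+1.
Hypothesis d2 : (2 <= d)%N.
Implicit Types (p x y z : V) (s : seq V).
Local Notation nbrs := (nbrs tree).
Local Notation dist := (dist tree).
Local Notation kids := (kids tree).

Fixpoint walks k x : seq (seq V) :=
  if k is k'.+1 then flatten [seq [seq y :: s | s <- walks k' y] | y <- nbrs x]
  else [:: [::]].

Lemma walks_path k x s : s \in walks k x -> path adj x s /\ size s = k.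
Proof.
elim: k x s => [|k IH] x s /=; first by rewrite inE => /eqP ->.
move=> /flatten_mapP[y]; rewrite mem_nbrs => xy /mapP[s' /IH[ps <-] ->].
by rewrite /= xy ps.
Qed.

Lemma walks_uniq k x : uniq (walks k x).
Proof.
elim: k x => [//|k IH] x /=.
have : uniq (nbrs x) by exact: nbrs_uniq.
elim: (nbrs x) => [//|y l IHl] /= /andP[yl ul].
rewrite cat_uniq IHl// andbT map_inj_uniq ?IH//=; last by move=> s s' [].
apply/hasPn => s /flatten_mapP[y' y'l /mapP[s' _ ->]].
by apply/mapP => -[s'' _ [yy' _]]; rewrite yy' (negbTE yl) in y'l.
Qed.

Definition transition k x y : R :=
  (\sum_(s <- walks k x) (last x s == y)%:R) / d.+1%:R ^+ k.

Let dn0 : (d.+1%:R : R) != 0. Proof. by rewrite pnatr_eq0. Qed.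

Lemma transition0 x y : transition 0 x y = (x == y)%:R.
Proof. by rewrite /transition big_seq1 expr0 divr1. Qed.

Lemma transitionS k x y :
  transition k.+1 x y = (\sum_(x' <- nbrs x) transition k x' y) / d.+1%:R.
Proof.
rewrite /transition /= big_flatten /= big_map -mulr_suml exprS invfM mulrA mulrAC.
by congr (_ / _ / _); apply: eq_bigr => x' _; rewrite big_map.
Qed.

Lemma size_walks k x : size (walks k x) = (d.+1 ^ k)%N.
Proof.
elim: k x => [//|k IH] x; rewrite /= size_flatten /shape -map_comp sumnE big_map.
under eq_bigr do rewrite /= size_map IH.
by rewrite big_const_seq count_predT size_nbrs iter_addn_0 expnS mulnC.
Qed.

(** The two neighbours at distances [n.-1] and [n.+1] occur with
    multiplicities 1 and [d], except at the root. *)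
Lemma sum_nbrs_dist (f : nat -> R) x y :
  \sum_(x' <- nbrs x) f (dist x' y) =
  if x == y then d.+1%:R * f 1%N
  else f (dist x y).-1 + d%:R * f (dist x y).+1.
Proof.
have [<-|xy] := eqVneq x y.
  transitivity (\sum_(x' <- nbrs x) f 1%N); last first.
    by rewrite big_const_seq count_predT size_nbrs iter_addr_0 mulr_natl.
  apply: eq_big_seq => x'; rewrite mem_nbrs => xx'.
  have x'x : adj x' x by rewrite (tree_sym tree).
  by rewrite (dist_branch tree x'x (branch_root _ _ _)) dist_xx.
have [p xp bp] := branch_exists tree xy.
have px : adj p x by rewrite (tree_sym tree).
rewrite (perm_big _ (perm_nbrs tree px)) /= big_cons.
rewrite (dist_branch tree xp bp) /=; congr (_ + _).
transitivity (\sum_(x' <- kids p x) f (dist p y).+2); last first.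
  by rewrite big_const_seq count_predT size_kids// iter_addr_0 mulr_natl.
apply: eq_big_seq => x'; rewrite mem_kids => /andP[xx' x'p].
have x'x : adj x' x by rewrite (tree_sym tree).
rewrite (@dist_branch _ _ _ tree x' x y)// ?(dist_branch tree xp bp)//.
by apply: branch_child bp => //; rewrite eq_sym.
Qed.

(** The closed form of the Green function, see [green_series]. *)
Definition tree_green x y : R := d%:R / (d%:R ^+ 2 - 1) * d%:R ^- (dist x y).

Let d0 : (0 : R) < d%:R. Proof. by rewrite ltr0n; apply: leq_trans d2. Qed.
Let d21 : (0 : R) < d%:R ^+ 2 - 1.
Proof. by rewrite subr_gt0 -natrX ltr1n; apply: (@leq_trans (2 ^ 2)); rewrite ?leq_exp2r. Qed.

(** The equation satisfied by a Green function, [g = (1 + A g) / (d + 1)] with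
    [A] the adjacency operator. *)
Lemma tree_green_step x y : tree_green x y = ((x == y)%:R + \sum_(x' <- nbrs x) tree_green x' y) / d.+1%:R.
Proof.
rewrite /tree_green -mulr_sumr (sum_nbrs_dist (fun n => d%:R ^- n)).
have [->|xy] := eqVneq x y.
  rewrite dist_xx expr0 expr1 -[d.+1%:R]natr1 /=; field.
  by rewrite !gt_eqF//= natr1.
have [p xp bp] := branch_exists tree xy.
rewrite (dist_branch tree xp bp) /= !exprS -[d.+1%:R]natr1 add0r; field.
by rewrite !gt_eqF//= ?natr1// exprn_gt0.
Qed.

Definition green_sum n x y : R := (\sum_(k < n) transition k x y) / d.+1%:R.

Lemma green_sumS n x y :
  green_sum n.+1 x y = ((x == y)%:R + \sum_(x' <- nbrs x) green_sum n x' y) / d.+1%:R.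
Proof.
rewrite /green_sum big_ord_recl transition0 /=; congr ((_ + _) / _).
rewrite -mulr_suml exchange_big /= mulr_suml.
by apply: eq_bigr => k _; rewrite transitionS.
Qed.

Let kappa : R := 2 * Num.sqrt d%:R / d.+1%:R.
Let rho x y : R := (Num.sqrt d%:R) ^- (dist x y).

Let sd0 : 0 < Num.sqrt (d%:R : R). Proof. by rewrite sqrtr_gt0. Qed.
Let sdE : Num.sqrt (d%:R : R) * Num.sqrt d%:R = d%:R.
Proof. by rewrite -expr2 sqr_sqrtr// ltW. Qed.
Let sd1 : 1 < Num.sqrt (d%:R : R).
Proof. by rewrite -[X in X < _]sqrtr1 ltr_sqrt ?ltr1n. Qed.

Let kappa_lt1 : 0 <= kappa < 1.
Proof.
rewrite /kappa divr_ge0 ?mulr_ge0 ?(ltW sd0)//= ltr_pdivrMr ?ltr0n// mul1r -[d.+1%:R]natr1.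
by move: sd1 sdE; set r := Num.sqrt _ => r1 <-; nra.
Qed.

(** [rho] decays at half the exponential rate of the Green function, which
    makes it a strict supersolution of the walk. *)
Let rho_super x y : (\sum_(x' <- nbrs x) rho x' y) / d.+1%:R <= kappa * rho x y.
Proof.
rewrite /kappa -!mulrA [_^-1 * _]mulrC !mulrA ler_pM2r ?invr_gt0 ?ltr0n//.
rewrite (sum_nbrs_dist (fun n => (Num.sqrt d%:R) ^- n)) /rho.
move: sd1 sdE; set r := Num.sqrt _ => r1 rE.
have r0 : 0 < r by exact: lt_trans r1.
have [->|xy] := eqVneq x y.
  rewrite dist_xx expr0 expr1 invr1 mulr1 -[d.+1%:R]natr1 -rE ler_pdivrMr//; nra.
have [p xp bp] := branch_exists tree xy.
rewrite (dist_branch tree xp bp) /= !exprS -rE le_eqVlt; apply/orP; left; apply/eqP.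
by field; rewrite !gt_eqF// exprn_gt0.
Qed.

Let tree_green_le x y : 0 <= tree_green x y <= d%:R / (d%:R ^+ 2 - 1) * rho x y.
Proof.
have c0 : 0 < d%:R / (d%:R ^+ 2 - 1) :> R by rewrite divr_gt0.
rewrite /tree_green /rho; apply/andP; split.
  by rewrite mulr_ge0 ?invr_ge0 ?exprn_ge0// ltW.
rewrite ler_pM2l// lef_pV2 ?posrE ?exprn_gt0// -[in leRHS]sdE exprMn.
by rewrite ler_peMl ?exprn_ge0 ?exprn_ege1 ?(ltW sd0) ?(ltW sd1).
Qed.

(** Both terms satisfy the same one-step recursion. The initial error is at most
    a multiple of [rho], and [rho_super] damps it by [kappa] at every step. *)
Lemma green_sum_err n x y :
  `|tree_green x y - green_sum n x y| <= d%:R / (d%:R ^+ 2 - 1) * (kappa ^+ n * rho x y).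
Proof.
elim: n x => [|n IH] x.
  rewrite /green_sum big_ord0 mul0r subr0 expr0 mul1r.
  by have /andP[g0 g1] := tree_green_le x y; rewrite ger0_norm.
rewrite tree_green_step green_sumS -mulrBl opprD addrACA subrr add0r -sumrB.
rewrite normrM [X in _ * X]ger0_norm ?invr_ge0//.
have c0 : 0 < d%:R / (d%:R ^+ 2 - 1) :> R by rewrite divr_gt0.
apply: (@le_trans _ _ ((\sum_(x' <- nbrs x)
   d%:R / (d%:R ^+ 2 - 1) * (kappa ^+ n * rho x' y)) / d.+1%:R)).
  rewrite ler_wpM2r ?invr_ge0//; apply: le_trans (ler_norm_sum _ _ _) _.
  by apply: ler_sum => x' _; exact: IH.
rewrite -mulr_sumr -mulrA ler_wpM2l ?(ltW c0)// -mulr_sumr exprSr -[_ * _ * rho x y]mulrA -[_ * _ / _]mulrA.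
have /andP[k0 _] := kappa_lt1.
rewrite ler_wpM2l ?exprn_ge0//; exact: rho_super.
Qed.

Lemma green_sum_cvg x y : green_sum n x y @[n --> \oo] --> tree_green x y.
Proof.
have /andP[k0 k1] := kappa_lt1.
apply/subr_cvg0.
apply: norm_cvg0.
apply: (squeeze_cvgr (f := cst 0)
  (h := fun n => (d%:R / (d%:R ^+ 2 - 1) * rho x y) * kappa ^+ n)).
- by near=> n; rewrite normr_ge0/= distrC (le_trans (green_sum_err _ _ _))//
    le_eqVlt; apply/orP; left; apply/eqP; ring.
- exact: cvg_cst.
- rewrite -[X in _ --> X](mulr0 (d%:R / (d%:R ^+ 2 - 1) * rho x y)).
  by apply: cvgMl_tmp; apply: cvg_expr; rewrite ger0_norm.
Unshelve. all: by end_near. Qed.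

Section Law.
Context {dW : measure_display} {W : measurableType dW}.
Variables (x : V) (P : probability W R) (Z : nat -> W -> V).
Hypothesis srw : simple_random_walk adj d x P Z.

Let mZ k y : measurable [set w | Z k w = y]. Proof. by case: srw. Qed.

Let follows s := [set w | forall i, (i <= size s)%N -> Z i w = nth x (x :: s) i].

Let mfollows s : measurable (follows s).
Proof.
have -> : follows s = \bigcap_(i in [set i | (i <= size s)%N]) [set w | Z i w = nth x (x :: s) i].
  by apply/seteqP; split => w.
by apply: bigcap_measurable => [|i _]; [exists 0%N|exact: mZ].
Qed.

Let P_follows k s : s \in walks k x -> P (follows s) = (d.+1%:R ^- k)%:E.
Proof.
move=> /walks_path[ps <-]; case: srw => _ /(_ (size s) (nth x (x :: s))) -> /=.
rewrite eqxx mul1r; congr EFin.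
rewrite -[RHS]mul1r -exprVn.
transitivity (\prod_(i < size s) (d.+1%:R^-1 : R)); last first.
  by rewrite prodr_const card_ord mul1r.
move/(pathP x): ps => ps; apply: eq_bigr => i _.
by have /= -> := ps i (ltn_ord i); rewrite mul1r.
Qed.

(** Walks of length [k] exhaust the mass, so bounding the law of [Z k] from
    below on each of two complementary events determines it. *)
Let E_transition (b : V -> bool) k :
  bounded_measurable (fun w => (b (Z k w))%:R : R) ->
  (\sum_(s <- walks k x) (b (last x s))%:R) / d.+1%:R ^+ k <=
  \int[P]_w ((b (Z k w))%:R : R).
Proof.
move=> bb.
have bF s : bounded_measurable (fun w => (b (last x s))%:R * \1_(follows s) w : R).
  by apply: bmZ; exact: bm_indic.
have -> : (\sum_(s <- walks k x) (b (last x s))%:R) / d.+1%:R ^+ k =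
    \int[P]_w (\sum_(s <- walks k x) ((b (last x s))%:R * \1_(follows s) w)).
  transitivity (\sum_(s <- walks k x) \int[P]_w ((b (last x s))%:R * \1_(follows s) w)).
    rewrite mulr_suml; apply: eq_big_seq => s sk; rewrite EZ; last exact: bm_indic.
    congr (_ * _); apply: EFin_inj.
    by rewrite -(P_follows sk) -(E_indic P (mfollows s)).
  elim: (walks k x) => [|s l IH].
    by under eq_Rintegral do rewrite big_nil; rewrite big_nil Ecst.
  rewrite big_cons IH -ED//; last exact: bm_sum.
  by under [RHS]eq_Rintegral do rewrite big_cons.
apply: le_E => // [|w]; first exact: bm_sum.
pose s0 := [seq Z i.+1 w | i <- iota 0 k].
have fs s : s \in walks k x -> follows s w -> s = s0 /\ last x s = Z k w.
  move=> /walks_path[_ sk] fw; split; last first.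
    by rewrite fw ?sk// -sk (last_nth x).
  apply: (@eq_from_nth _ x); first by rewrite size_map size_iota.
  move=> i ik; rewrite (nth_map 0%N) ?size_iota -?sk// nth_iota -?sk// add0n.
  by rewrite fw.
apply: (@le_trans _ _ (\sum_(s <- walks k x) ((b (Z k w))%:R * (s == s0)%:R))).
  rewrite big_seq [leRHS]big_seq; apply: ler_sum => s sk.
  rewrite indicE; have [fw|nf] := pselect (follows s w).
    by have [<- ->] := fs s sk fw; rewrite eqxx mem_set.
  by rewrite memNset// mulr0 mulr_ge0.
rewrite -mulr_sumr ler_piMr// -natr_sum.
rewrite (_ : (\sum_(s <- walks k x) (s == s0))%N = count_mem s0 (walks k x)).
  by rewrite count_uniq_mem ?walks_uniq//; case: (s0 \in _).
by rewrite -sum1_count [RHS]big_mkcond.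
Qed.

Let bmZ' k y : bounded_measurable (fun w => (Z k w == y)%:R : R).
Proof.
rewrite (_ : (fun w => _) = \1_[set w | Z k w = y]); first exact: bm_indic.
apply/funext => w; rewrite indicE; congr ((nat_of_bool _)%:R).
by apply/eqP/idP => [h|/set_mem//]; apply/mem_set.
Qed.

(** [E_transition] for an event and for its complement. *)
Lemma E_walk k y : \int[P]_w ((Z k w == y)%:R : R) = transition k x y.
Proof.
apply/eqP; rewrite eq_le; apply/andP; split; last by apply: (@E_transition (pred1 y) k); exact: bmZ'.
have nE b : ((~~ b)%:R : R) = 1 - b%:R by case: b; rewrite ?subrr ?subr0.
have := @E_transition (fun z => z != y) k; rewrite /=.
under eq_fun do rewrite nE.
move=> /(_ (bmB (bm_cst 1) (bmZ' k y))).
under eq_bigr do rewrite nE.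
rewrite EB ?Ecst//; last exact: bm_cst.
rewrite sumrB mulrBl big_const_seq count_predT size_walks iter_addr_0 natrX divff.
  by rewrite /transition; lra.
by rewrite expf_neq0.
Qed.

Lemma green_series y :
  ((d.+1%:R^-1)%:E * \int[P]_w (\sum_(0 <= k <oo) ((Z k w == y)%:R)%:E) =
   (tree_green x y)%:E)%E.
Proof.
rewrite integral_nneseries; [|by []| |]; last first.
  - by move=> n w _; rewrite lee_fin.
  - by move=> n; apply/measurable_EFinP; case: (bmZ' n y).
under eq_eseriesr => k _ do rewrite -(EFinE P (bmZ' k y)) E_walk.
rewrite -nneseriesZl//; last first.
  move=> n _; rewrite lee_fin /transition divr_ge0 ?exprn_ge0//.
  by apply: sumr_ge0.
apply/cvg_lim => //.
have -> : (fun n => (\sum_(0 <= k < n) ((d.+1%:R^-1)%:E * (transition k x y)%:E))%E) =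
    (fun n => (green_sum n x y)%:E).
  apply/funext => n; rewrite /green_sum big_mkord mulrC mulr_sumr -sumEFin.
  by apply: eq_bigr => k _; rewrite EFinM.
have h : (green_sum n x y)%:E @[n --> \oo] --> (tree_green x y)%:E.
  by apply: cvg_EFin; [exact: nearW|exact: green_sum_cvg].
exact: h.
Qed.
End Law.

End Green.

(** * Affine images of Gaussian variables *)

Section AffineMoments.
Context {R : realType} (s : R) (s0 : 0 < s).
Notation gamma := (@normal_prob R 0 s).

Lemma integral_normal_affine (m c : R) : gamma.-integrable setT (fun y => (m + c * y)%:E) /\
  \int[gamma]_y (m + c * y) = m.
Proof.
have [i1 e1] := integral_normal_id s0.
have i2 : gamma.-integrable setT (fun y => (c * y)%:E) by exact: integrableR_Z.
have i3 : gamma.-integrable setT (fun=> m%:E) by exact: bm_integrable (bm_cst m).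
split; first exact: integrableR_D.
by rewrite RintegralD// RintegralZl// e1 mulr0 addr0 Ecst.
Qed.

Lemma integral_normal_affine_sqr (m c : R) :
  gamma.-integrable setT (fun y => ((m + c * y) ^+ 2)%:E) /\
  \int[gamma]_y ((m + c * y) ^+ 2) = m ^+ 2 + (s * c) ^+ 2.
Proof.
have [i1 e1] := integral_normal_affine (m ^+ 2) (2 * m * c).
have [i2 e2] := integral_normal_sqr s0.
have i3 : gamma.-integrable setT (fun y => (c ^+ 2 * y ^+ 2)%:E) by exact: integrableR_Z.
have eq y : (m + c * y) ^+ 2 = (m ^+ 2 + 2 * m * c * y) + c ^+ 2 * y ^+ 2 by ring.
split.
  by under eq_fun do rewrite eq; exact: integrableR_D.
under eq_Rintegral do rewrite eq.
by rewrite RintegralD// RintegralZl// e1 e2 exprMn mulrC.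
Qed.

End AffineMoments.

Section GaussianLaw.
Variable R : realType.
Notation mu := (@lebesgue_measure R).
Notation gamma := (@normal_prob R 0 1).

Let bcos t c : @bounded_measurable R _ (measurableTypeR R) (fun x : R => cos (t * x + c)).
Proof. by apply: bm_cos; exact: measurable_funM. Qed.

Lemma integral_normal_pdfM (m s : R) (f : R -> R) : bounded_measurable f ->
  \int[normal_prob m s]_x f x = \int[mu]_x (f x * normal_pdf m s x).
Proof.
move=> [mf [M fM]].
have [//||//] := @integral_normal_prob R m s f.
apply: (@le_integrable _ _ _ mu setT measurableT _ (fun x => M%:E * (normal_pdf m s x)%:E)%E).
- apply/measurable_EFinP/measurable_funM => //; exact: measurable_normal_pdf.
- move=> x _; rewrite /= lee_fin !normrM (ger0_norm (normal_pdf_ge0 _ _ x)).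
  by rewrite ler_wpM2r ?normal_pdf_ge0// (le_trans (fM x))// ler_norm.
- by apply: integrableZl => //; exact: integrable_normal_pdf.
Qed.

Lemma integral_shift (g : R -> R) (m : R) : continuous g -> (forall x, 0 <= g x) ->
  \int[mu]_x g x = \int[mu]_x g (x + m).
Proof.
move=> cg g0; congr fine.
pose F (x : R) := x + m.
have F'1 : F^`()%classic = cst 1.
  by apply/funext => x; rewrite /F derive1E deriveD// derive_id derive_cst addr0.
rewrite (@increasing_ge0_integration_by_substitutionT _ F)//.
- by apply: eq_integral => x _; rewrite F'1 !fctE mulr1.
- by move=> x y xy; rewrite /F ltrD2r.
- by rewrite F'1 => ?; exact: cvg_cst.
- by rewrite F'1; exact: is_cvg_cst.
- by rewrite F'1; exact: is_cvg_cst.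
- exact: cvg_addrr_Ny.
- exact: cvg_addrr.
Qed.

#[local] Opaque Rintegral.

Lemma integral_normal_prob_cos (m s t c : R) : 0 < s ->
  \int[normal_prob m s]_x cos (t * x + c) = expR (- (s * t) ^+ 2 / 2) * cos (t * m + c).
Proof.
move=> s0.
rewrite -(@integral_normal_cos R s s0).
have b1 t' c' : @bounded_measurable R _ (measurableTypeR R) (fun x : R => 1 + cos (t' * x + c')).
  by apply: bmD => //; exact: bm_cst.
(* Adding 1 makes the integrand nonnegative, as [integral_shift] requires. *)
suff h : \int[normal_prob m s]_x (1 + cos (t * x + c)) =
         \int[normal_prob 0 s]_x (1 + cos (t * x + (t * m + c))).
  have D (P : probability (measurableTypeR R) R) t' c' :
      \int[P]_x (1 + cos (t' * x + c')) = 1 + \int[P]_x cos (t' * x + c').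
    by rewrite (ED P (bm_cst 1) (bcos t' c')) Ecst.
  exact: addrI (etrans (esym (D (normal_prob m s) t c))
    (etrans h (D (normal_prob 0 s) t (t * m + c)))).
have s_neq0 : s != 0 by rewrite gt_eqF.
apply: etrans (integral_normal_pdfM m s (b1 t c)) _.
apply: etrans _ (esym (integral_normal_pdfM 0 s (b1 t (t * m + c)))).
rewrite [LHS](@integral_shift (fun x => (1 + cos (t * x + c)) * normal_pdf m s x) m).
- apply: eq_Rintegral => x _; rewrite !normal_pdfE// /normal_fun addrK subr0.
  by rewrite mulrDr addrA.
- move=> x; apply: cvgM; last exact: continuous_normal_pdf.
  apply: (@cvgD _ R^o); first exact: cvg_cst.
  apply: (continuous_comp (f := fun x => t * x + c)); last exact: continuous_cos.
  by apply: (@cvgD _ R^o); [apply: cvgMl_tmp; exact: cvg_id|exact: cvg_cst].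
- move=> x; apply: mulr_ge0; last exact: normal_pdf_ge0.
  by have := cos_geN1 (t * x + c); lra.
Qed.

Lemma normal_prob_affine (m s : R) (f : R -> R) : 0 < s -> bounded_measurable f ->
  \int[normal_prob m s]_x f x = \int[gamma]_y f (m + s * y).
Proof.
move=> s0 bf.
have maff : measurable_fun setT (fun y : R => m + s * y).
  by apply: measurable_funD => //; exact: measurable_funM.
have e1 (P : probability (measurableTypeR R) R) (g : R -> R) :
    \int[P]_x g x = \int[P]_x (1 * g x).
  by apply: eq_Rintegral => x _; rewrite mul1r.
apply: (etrans (e1 _ _)); apply: (etrans _ (esym (e1 _ _))).
apply: (@cos_determines_law R _ _ (normal_prob m s) _ _ gamma (fun=> 1) id (fun=> 1)
  (fun y => m + s * y)); [exact: bm_cst|exact: bm_cst|exact: measurable_id|exact: maff| |exact: bf].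
move=> t c; apply: (etrans (esym (e1 _ _))); apply: (etrans _ (e1 _ _)).
apply: (etrans (integral_normal_prob_cos _ _ _ s0)).
transitivity (\int[gamma]_y cos ((t * s) * y + (t * m + c))).
  apply: (etrans _ (esym (integral_normal_prob_cos _ _ _ ltr01))).
  by rewrite mulr0 add0r mul1r [s * t]mulrC.
by apply: eq_Rintegral => y _; congr cos; ring.
Qed.

(** Covers the degenerate case of [gaussian_law] as well: for [v = 0] the map
    is constant. *)
Lemma gaussian_lawE (m v : R) (B : set R) : 0 <= v -> measurable B ->
  gaussian_law m v B = gamma ((fun y => m + Num.sqrt v * y) @^-1` B).
Proof.
move=> v0 mB; rewrite /gaussian_law; have [->|vn0] := eqVneq v 0.
  rewrite sqrtr0; under eq_fun do rewrite mul0r addr0.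
  rewrite diracE; have [mB'|mB'] := boolP (m \in B).
    rewrite (_ : _ @^-1` _ = setT) ?probability_setT//.
    by apply/seteqP; split => // x _ /=; exact/set_mem.
  rewrite (_ : _ @^-1` _ = set0) ?measure0//.
  by apply/seteqP; split => // x /= Bm; move/negP : mB'; apply; exact/mem_set.
have s0 : 0 < Num.sqrt v by rewrite sqrtr_gt0 lt_neqAle eq_sym vn0.
have mC : measurable ((fun y : R => m + Num.sqrt v * y) @^-1` B).
  rewrite -[X in measurable X]setTI.
  have : measurable_fun setT (fun y : R => m + Num.sqrt v * y).
    by apply: measurable_funD => //; exact: measurable_funM.
  exact.
exact (etrans (esym (E_indic (normal_prob m (Num.sqrt v)) mB))
  (etrans (f_equal EFin (normal_prob_affine m s0 (bm_indic mB))) (E_indic gamma mC))).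
Qed.

#[local] Transparent Rintegral.

Section EqLaw.
Context d1 (T1 : measurableType d1) (P1 : probability T1 R).
Context d2 (T2 : measurableType d2) (P2 : probability T2 R).
Variables (X1 : T1 -> R) (X2 : T2 -> R).
Hypotheses (mX1 : measurable_fun setT X1) (mX2 : measurable_fun setT X2).
Hypothesis law : forall B : set R, measurable B -> P1 (X1 @^-1` B) = P2 (X2 @^-1` B).

Lemma eq_law_integral (f : R -> \bar R) : measurable_fun setT f ->
  (forall x, 0 <= f x)%E -> (\int[P1]_w f (X1 w) = \int[P2]_w f (X2 w))%E.
Proof.
move=> mf f0.
rewrite -[LHS](@ge0_integral_pushforward _ _ _ _ _ _ mX1 P1 setT f)//.
rewrite -[RHS](@ge0_integral_pushforward _ _ _ _ _ _ mX2 P2 setT f)//.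
by apply: eq_measure_integral => A mA _; exact: law.
Qed.

Lemma eq_law_Rintegral (f : R -> R) : measurable_fun setT f ->
  P2.-integrable setT (fun w => (f (X2 w))%:E) ->
  P1.-integrable setT (fun w => (f (X1 w))%:E) /\
  \int[P1]_w f (X1 w) = \int[P2]_w f (X2 w).
Proof.
move=> mf i2.
have i1 : P1.-integrable setT (fun w => (f (X1 w))%:E).
  apply/integrableP; split; first by apply/measurable_EFinP; exact: measurableT_comp.
  have mfn : measurable_fun setT (fun x : R => `|(f x)%:E|%E).
    by apply: measurableT_comp => //; exact/measurable_EFinP.
  rewrite (@eq_law_integral (fun x => `|(f x)%:E|%E))//.
  by case/integrableP : i2.
split => //; congr fine.
have mfE : measurable_fun setT (EFin \o f) by exact/measurable_EFinP.
rewrite -[LHS](@integral_pushforward _ _ _ _ _ _ mX1 P1 setT (EFin \o f))//.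
rewrite -[RHS](@integral_pushforward _ _ _ _ _ _ mX2 P2 setT (EFin \o f))//.
by apply: eq_measure_integral => A mA _; exact: law.
Qed.

End EqLaw.
End GaussianLaw.

(** * Linear combinations of the field *)

Section GaussianField.
Context {R : realType} {dO : measure_display} {Omega : measurableType dO}.
Variables (V : Type) (P : probability Omega R) (phi : V -> {RV P >-> R}).
Variables (covar : V -> V -> R).
Hypothesis field : centered_gaussian_field phi (fun x y => (covar x y)%:E).
Notation gamma := (@normal_prob R 0 1).
Implicit Types (s : seq (R * V)).

Let mphi x : measurable_fun setT (phi x : Omega -> R).
Proof. exact: measurable_funP. Qed.

Let mfaff (m c : R) : measurable_fun setT (fun y : R => m + c * y).
Proof. by apply: measurable_funD => //; exact: measurable_funM. Qed.

Section OneVariable.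
Variables (X : Omega -> R) (mX : measurable_fun setT X) (m v : R).
Hypotheses (v0 : 0 <= v)
  (law : forall B : set R, measurable B -> P (X @^-1` B) = gaussian_law m v B).

Let law' (B : set R) : measurable B ->
  P (X @^-1` B) = gamma ((fun y => m + Num.sqrt v * y) @^-1` B).
Proof. by move=> mB; rewrite law// gaussian_lawE. Qed.

Lemma gaussian_id : P.-integrable setT (EFin \o X) /\ \int[P]_w X w = m.
Proof.
have [i e] := integral_normal_affine ltr01 m (Num.sqrt v).
have [i' e'] := eq_law_Rintegral (P2 := gamma) mX (mfaff m (Num.sqrt v)) law' (@measurable_id _ R setT) i.
by rewrite -e.
Qed.

Lemma gaussian_sqr : P.-integrable setT (fun w => ((X w) ^+ 2)%:E) /\
  \int[P]_w (X w ^+ 2) = m ^+ 2 + v.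
Proof.
have [i e] := integral_normal_affine_sqr ltr01 m (Num.sqrt v).
have msq : measurable_fun setT (fun x : R => x ^+ 2) by exact: measurable_funX.
have [i' e'] := eq_law_Rintegral (P2 := gamma) mX (mfaff m (Num.sqrt v)) law' msq i.
by rewrite mul1r sqr_sqrtr// in e; rewrite -e.
Qed.

Lemma gaussian_cos c : \int[P]_w cos (X w + c) = expR (- v / 2) * cos (m + c).
Proof.
have bc : bounded_measurable (fun y : R => cos (y + c)) by exact: bm_cos.
have i : gamma.-integrable setT (fun y => (cos ((m + Num.sqrt v * y) + c))%:E).
  exact: (bm_integrable gamma (bm_cos c (mfaff m (Num.sqrt v)))).
have [_ ->] := eq_law_Rintegral (P2 := gamma) mX (mfaff m (Num.sqrt v)) law' bc.1 i.
transitivity (\int[gamma]_y cos (Num.sqrt v * y + (m + c))).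
  by apply: eq_Rintegral => y _; congr cos; ring.
by rewrite (integral_normal_cos ltr01) mul1r sqr_sqrtr// mulNr.
Qed.

End OneVariable.

Definition lincomb s (w : Omega) : R := \sum_(a <- s) a.1 * phi a.2 w.

Definition cov s s' : R := \sum_(a <- s) \sum_(b <- s') a.1 * b.1 * covar a.2 b.2.

Lemma measurable_lincomb s : measurable_fun setT (lincomb s).
Proof.
rewrite /lincomb; elim: s => [|a s IH].
  by under eq_fun do rewrite big_nil; exact: measurable_cst.
under eq_fun do rewrite big_cons.
by apply: measurable_funD => //; apply: measurable_funM; [exact: measurable_cst|exact: mphi].
Qed.

Let lincomb_law s : exists m v : R, 0 <= v /\ forall B : set R, measurable B ->
  P (lincomb s @^-1` B) = gaussian_law m v B.
Proof.
have [h _ _] := field.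
rewrite (_ : lincomb s = fun w =>
    \sum_(i < size s) (tnth (in_tuple s) i).1 * phi (tnth (in_tuple s) i).2 w).
  exact: h.
by apply/funext => w; rewrite /lincomb big_tnth.
Qed.

Let phi_law x : exists m v : R, 0 <= v /\ forall B : set R, measurable B ->
  P (phi x @^-1` B) = gaussian_law m v B.
Proof.
have [m [v [v0 h]]] := lincomb_law [:: (1, x)]; exists m, v; split => // B mB.
rewrite -h// (_ : lincomb _ = phi x :> (Omega -> R))//.
by apply/funext => w; rewrite /lincomb big_seq1 mul1r.
Qed.

Let phi_int x : P.-integrable setT (fun w => (phi x w)%:E).
Proof. by have [m [v [v0 h]]] := phi_law x; have [] := gaussian_id (mphi x) v0 h. Qed.

Let phi_int2 x y : P.-integrable setT (fun w => (phi x w * phi y w)%:E).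
Proof.
have [m [v [v0 h]]] := phi_law x; have [i _] := gaussian_sqr (mphi x) v0 h.
have [m' [v' [v0' h']]] := phi_law y; have [i' _] := gaussian_sqr (mphi y) v0' h'.
apply: (integrableR_le _ _ (integrableR_D i i')); first exact: measurable_funM.
move=> w; rewrite normrM -[_ ^+ 2 in leRHS]real_normK ?num_real//.
rewrite -[phi y w ^+ 2]real_normK ?num_real//.
have := sqr_ge0 (`|phi x w| - `|phi y w|); have := normr_ge0 (phi x w).
have := normr_ge0 (phi y w); nra.
Qed.

Let E_phi x : \int[P]_w phi x w = 0.
Proof. by have [_ + _] := field => /(_ x); rewrite unlock /Rintegral => ->. Qed.

Lemma E_phi2 x y : \int[P]_w (phi x w * phi y w) = covar x y.
Proof.
have [_ e0 +] := field => /(_ x y); rewrite unlock !e0 /= unlock => h.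
rewrite /Rintegral -[RHS]/(fine (covar x y)%:E) -h; congr fine.
by apply: eq_integral => w _; rewrite fctE /= !subr0.
Qed.

Lemma covar_sym x y : covar x y = covar y x.
Proof. by rewrite -!E_phi2; under eq_Rintegral do rewrite mulrC. Qed.

Let E_lincomb s : \int[P]_w lincomb s w = 0.
Proof.
rewrite /lincomb Rintegral_sum => [|a]; last exact: integrableR_Z.
rewrite big1// => a _; transitivity (a.1 * \int[P]_w phi a.2 w).
  exact: (RintegralZl _ measurableT (phi_int a.2)).
by rewrite E_phi mulr0.
Qed.

Let E_lincomb2 s : \int[P]_w (lincomb s w ^+ 2) = cov s s.
Proof.
have i a b : P.-integrable setT (fun w => (a.1 * b.1 * (phi a.2 w * phi b.2 w))%:E).
  exact: integrableR_Z.
transitivity (\int[P]_w \sum_(a <- s) \sum_(b <- s) a.1 * b.1 * (phi a.2 w * phi b.2 w)).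
  apply: eq_Rintegral => w _; rewrite expr2 /lincomb mulr_suml; apply: eq_bigr => a _.
  by rewrite mulr_sumr; apply: eq_bigr => b _; ring.
rewrite Rintegral_sum => [|a]; last by apply: integrableR_sum => b; exact: i.
apply: eq_bigr => a _; rewrite Rintegral_sum => [|b]; last exact: i.
by apply: eq_bigr => b _; rewrite -E_phi2; exact: (RintegralZl _ measurableT (phi_int2 a.2 b.2)).
Qed.

(** A linear combination of the field is a Gaussian variable by hypothesis, and
    its mean and variance can be read off from first and second moments. *)
Lemma E_cos_lincomb s c :
  \int[P]_w cos (lincomb s w + c) = expR (- cov s s / 2) * cos c.
Proof.
have [m [v [v0 h]]] := lincomb_law s.
have [_ em] := gaussian_id (measurable_lincomb s) v0 h.
have [_ ev] := gaussian_sqr (measurable_lincomb s) v0 h.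
have m0 : m = 0 by rewrite -em E_lincomb.
rewrite E_lincomb2 m0 expr0n add0r in ev.
by rewrite (gaussian_cos (measurable_lincomb s) v0 h) m0 add0r ev.
Qed.

Lemma law_phi x (B : set R) : 0 < covar x x -> measurable B ->
  P (phi x @^-1` B) = normal_prob 0 (Num.sqrt (covar x x)) B.
Proof.
move=> g0 mB; have [m [v [v0 h]]] := phi_law x.
have [_ em] := gaussian_id (mphi x) v0 h.
have [_ ev] := gaussian_sqr (mphi x) v0 h.
have m0 : m = 0 by rewrite -em E_phi.
have vE : v = covar x x.
  by rewrite m0 expr0n add0r in ev; rewrite -ev -E_phi2; under eq_Rintegral do rewrite expr2.
by rewrite h// /gaussian_law m0 vE gt_eqF.
Qed.

End GaussianField.

(** * The transition operator *)

Section Operator.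
Variables (R : realType) (d : nat).
Hypothesis d2 : (2 <= d)%N.
Notation nu := (@nu R d).
Implicit Types f g : R -> R.
Local Notation bm := (@bounded_measurable R _ (measurableTypeR R)).

(** The standard deviation of [nu]. *)
Definition sigma : R := Num.sqrt (d%:R / (d%:R ^+ 2 - 1)).
(** Chosen so that [nu] is invariant: [sigma ^+ 2 / d ^+ 2 +
    (noise_scale * sigma) ^+ 2 = sigma ^+ 2]. *)
Definition noise_scale : R := Num.sqrt (1 - d%:R ^- 2).

Lemma d_gt0 : (0 : R) < d%:R. Proof. by rewrite ltr0n; apply: leq_trans d2. Qed.
Lemma d_ge2 : (2 : R) <= d%:R. Proof. by rewrite ler_nat. Qed.

Lemma sigma_gt0 : 0 < sigma.
Proof.
rewrite sqrtr_gt0 divr_gt0 ?d_gt0// subr_gt0 -natrX ltr1n.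
by apply: (@leq_trans (2 ^ 2)); rewrite ?leq_exp2r.
Qed.

Let dV2 : d%:R ^- 2 < 1 :> R.
Proof. by rewrite invf_lt1 ?exprn_gt0 ?d_gt0// exprn_egt1// ltr1n. Qed.

Lemma noise_scale_gt0 : 0 < noise_scale. Proof. by rewrite sqrtr_gt0 subr_gt0. Qed.

Lemma noise_scale_sqr : noise_scale ^+ 2 = 1 - d%:R ^- 2.
Proof. by rewrite sqr_sqrtr// subr_ge0 ltW. Qed.

(** The kernel of the stationary autoregressive chain of correlation [1 / d],
    also known as Mehler's kernel. *)
Definition mehler f (a : R) : R := \int[nu]_y f (a / d%:R + noise_scale * y).

Local Notation Q := mehler.

Lemma opLE f a : opL d f a = d%:R * Q f a. Proof. by []. Qed.

Let maff (a : R) : measurable_fun setT (fun y : R => a / d%:R + noise_scale * y).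
Proof. by apply: measurable_funD => //; exact: measurable_funM. Qed.

Lemma bmQ_in f a : bm f -> bm (fun y : R => f (a / d%:R + noise_scale * y)).
Proof. by move=> bf; exact: (bm_comp bf (maff a)). Qed.

Lemma Qlin f g k a : bm f -> bm g -> Q (fun x => f x + k * g x) a = Q f a + k * Q g a.
Proof. by move=> bf bg; exact: (Elin nu k (bmQ_in a bf) (bmQ_in a bg)). Qed.

Lemma QZ k f a : bm f -> Q (fun x => k * f x) a = k * Q f a.
Proof. by move=> bf; exact: (EZ nu k (bmQ_in a bf)). Qed.

Lemma Qcst k a : Q (fun=> k) a = k.
Proof. exact: Ecst. Qed.

Lemma le_Q f g a : bm f -> bm g -> (forall x, f x <= g x) -> Q f a <= Q g a.
Proof. by move=> bf bg fg; exact: (le_E nu (bmQ_in a bf) (bmQ_in a bg)). Qed.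

Lemma Q_ge0 f a : (forall x, 0 <= f x) -> 0 <= Q f a.
Proof. by move=> f0; apply: Rintegral_ge0. Qed.

Lemma Q_cvg (f_ : nat -> R -> R) f M a :
  (forall n, bm (f_ n)) -> bm f -> (forall n x, `|f_ n x| <= M) ->
  (forall x, f_ n x @[n --> \oo] --> f x) -> Q (f_ n) a @[n --> \oo] --> Q f a.
Proof.
move=> bf_ bf fM ff; apply: (E_cvg (M := M)).
- by move=> n; case: (bmQ_in a (bf_ n)).
- by case: (bmQ_in a bf).
- by move=> n x; exact: fM.
- by move=> x; exact: ff.
Qed.

Lemma Q_bound f M a : bm f -> (forall x, `|f x| <= M) -> `|Q f a| <= M.
Proof.
move=> bf fM; rewrite ler_norml -(Qcst M a); apply/andP; split.
  rewrite lerNl -[leRHS]mul1r -(QZ _ _ (bm_cst M)) // -[leLHS]mulN1r -(QZ _ _ bf).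
  apply: le_Q => [||x]; try exact: bmZ; try exact: bm_cst.
  by rewrite mulN1r mul1r lerNl; have := fM x; rewrite ler_norml => /andP[].
by apply: le_Q => // [|x]; [exact: bm_cst|exact: le_trans (ler_norm _) (fM x)].
Qed.

Lemma bm_Q f : bm f -> bm (Q f).
Proof.
move=> bf; have [M fM] := bf.2; split; last by exists M => a; exact: Q_bound.
have b1 : bm (fun x => f x + M * 1).
  by apply: bmD => //; apply: bmZ; exact: bm_cst.
suff h : measurable_fun setT (Q (fun x => f x + M * 1)).
  rewrite (_ : Q f = fun a => Q (fun x => f x + M * 1) a - M).
    by apply: measurable_funB.
  by apply/funext => a; rewrite Qlin ?Qcst ?mulr1 ?addrK//; exact: bm_cst.
pose F (z : measurableTypeR R * measurableTypeR R) : \bar R :=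
  (f (z.1 / d%:R + noise_scale * z.2) + M * 1)%:E.
have mF : measurable_fun setT F.
  apply/measurable_EFinP; apply: measurable_funD => //.
  apply: (measurableT_comp bf.1); apply: measurable_funD; apply: measurable_funM => //.
have F0 z : (0 <= F z)%E.
  rewrite lee_fin mulr1; have := fM (z.1 / d%:R + noise_scale * z.2).
  by rewrite ler_norml => /andP[]; lra.
have h := @measurable_fun_fubini_tonelli_F _ _ _ _ R nu F mF F0.
apply/measurable_EFinP.
rewrite (_ : EFin \o _ = fun x => \int[nu]_y F (x, y))%E//.
by apply/funext => a; exact: (EFinE nu (bmQ_in a b1)).
Qed.

Lemma Q_cos t c a :
  Q (fun x => cos (t * x + c)) a = expR (- (sigma * (t * noise_scale)) ^+ 2 / 2) * cos (t * (a / d%:R) + c).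
Proof.
rewrite -(integral_normal_cos sigma_gt0) /mehler.
by apply: eq_Rintegral => y _; congr cos; ring.
Qed.

Let bcos t c : bm (fun x : R => cos (t * x + c)).
Proof. by apply: bm_cos; exact: measurable_funM. Qed.

Let E_coscos s b t c : \int[nu]_x (cos (s * x + b) * cos (t * x + c)) =
  (expR (- (sigma * (s + t)) ^+ 2 / 2) * cos (b + c) +
   expR (- (sigma * (s - t)) ^+ 2 / 2) * cos (b - c)) / 2.
Proof.
rewrite -!(integral_normal_cos sigma_gt0) mulrC -ED; try exact: bcos.
rewrite -EZ; last by apply: bmD; exact: bcos.
apply: eq_Rintegral => x _.
have -> : (s + t) * x + (b + c) = (s * x + b) + (t * x + c) by ring.
have -> : (s - t) * x + (b - c) = (s * x + b) - (t * x + c) by ring.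
by rewrite (cosB (s * x + b)) (cosD (s * x + b)); field.
Qed.

(** Reversibility of the chain. For two cosines both sides are explicit and
    agree; the monotone class argument is applied to one function at a time. *)
Lemma Q_sym f g : bm f -> bm g ->
  \int[nu]_x (g x * Q f x) = \int[nu]_x (f x * Q g x).
Proof.
have lin f1 f2 k (w : R -> R) : bm f1 -> bm f2 -> bm w ->
    \int[nu]_x (w x * Q (fun y => f1 y + k * f2 y) x) =
    \int[nu]_x (w x * Q f1 x) + k * \int[nu]_x (w x * Q f2 x).
  move=> b1 b2 bw; rewrite -Elin; try by apply: bmM => //; exact: bm_Q.
  by apply: eq_Rintegral => x _; rewrite Qlin//; ring.
have lin' f1 f2 k (w : R -> R) : bm f1 -> bm f2 -> bm w ->
    \int[nu]_x ((f1 x + k * f2 x) * Q w x) =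
    \int[nu]_x (f1 x * Q w x) + k * \int[nu]_x (f2 x * Q w x).
  move=> b1 b2 bw; rewrite -Elin; try by apply: bmM => //; exact: bm_Q.
  by apply: eq_Rintegral => x _; ring.
have lim (f_ : nat -> R -> R) f0 M (w : R -> R) : (forall n, bm (f_ n)) -> bm f0 -> bm w ->
    (forall n x, `|f_ n x| <= M) -> (forall x, f_ n x @[n --> \oo] --> f0 x) ->
    \int[nu]_x (w x * Q (f_ n) x) @[n --> \oo] --> \int[nu]_x (w x * Q f0 x).
  move=> bf_ bf bw fM ff; have [N wN] := bw.2; apply: (E_cvg (M := N * M)).
  - by move=> n; case: (bmM bw (bm_Q (bf_ n))).
  - by case: (bmM bw (bm_Q bf)).
  - by move=> n x; rewrite normrM ler_pM// Q_bound.
  - by move=> x; apply: cvgMl_tmp; apply: Q_cvg ff.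
have lim' (f_ : nat -> R -> R) f0 M (w : R -> R) : (forall n, bm (f_ n)) -> bm f0 -> bm w ->
    (forall n x, `|f_ n x| <= M) -> (forall x, f_ n x @[n --> \oo] --> f0 x) ->
    \int[nu]_x (f_ n x * Q w x) @[n --> \oo] --> \int[nu]_x (f0 x * Q w x).
  move=> bf_ bf bw fM ff; have [N wN] := bw.2; apply: (E_cvg (M := M * N)).
  - by move=> n; case: (bmM (bf_ n) (bm_Q bw)).
  - by case: (bmM bf (bm_Q bw)).
  - by move=> n x; rewrite normrM ler_pM// Q_bound.
  - by move=> x; apply: cvgMr_tmp; exact: ff.
move=> + bg; move: f.
pose H (f : R -> R) := \int[nu]_x (g x * Q f x) = \int[nu]_x (f x * Q g x).
apply: (trig_monotone_class (H := H)).
- move=> f1 f2 k b1 b2 h1 h2; apply: (etrans (lin f1 f2 k g b1 b2 bg)).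
  apply: (etrans _ (esym (lin' f1 f2 k g b1 b2 bg))).
  exact: (congr2 (fun u v => u + k * v) h1 h2).
- move=> f_ f0 M bf_ Hf bf fM ff.
  have c1 := lim _ _ _ _ bf_ bf bg fM ff; have c2 := lim' _ _ _ _ bf_ bf bg fM ff.
  rewrite (_ : (fun n => _) = fun n => \int[nu]_x (f_ n x * Q g x)) in c1.
    exact: (cvg_unique _ c1 c2).
  by apply/funext => n; exact: Hf.
move=> t c; rewrite /H; move: g bg {H}.
pose H (g : R -> R) := \int[nu]_x (g x * Q (fun x0 : R => cos (t * x0 + c)) x) =
  \int[nu]_x (cos (t * x + c) * Q g x).
apply: (trig_monotone_class (H := H)).
- move=> f1 f2 k b1 b2 h1 h2; apply: (etrans (lin' f1 f2 k _ b1 b2 (bcos t c))).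
  apply: (etrans _ (esym (lin f1 f2 k _ b1 b2 (bcos t c)))).
  exact: (congr2 (fun u v => u + k * v) h1 h2).
- move=> f_ f0 M bf_ Hf bf fM ff.
  have c1 := lim' _ _ _ _ bf_ bf (bcos t c) fM ff.
  have c2 := lim _ _ _ _ bf_ bf (bcos t c) fM ff.
  rewrite (_ : (fun n => _) = fun n => \int[nu]_x (cos (t * x + c) * Q (f_ n) x)) in c1.
    exact: (cvg_unique _ c1 c2).
  by apply/funext => n; exact: Hf.
move=> s b; rewrite /H.
transitivity (expR (- (sigma * (t * noise_scale)) ^+ 2 / 2) *
    \int[nu]_x (cos (s * x + b) * cos ((t / d%:R) * x + c))).
  rewrite -EZ; last by apply: bmM; exact: bcos.
  apply: eq_Rintegral => x _; rewrite Q_cos mulrCA; congr (_ * (_ * cos _)).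
  by ring.
transitivity (expR (- (sigma * (s * noise_scale)) ^+ 2 / 2) *
    \int[nu]_x (cos (t * x + c) * cos ((s / d%:R) * x + b))); last first.
  rewrite -EZ; last by apply: bmM; exact: bcos.
  apply: eq_Rintegral => x _; rewrite Q_cos mulrCA; congr (_ * (_ * cos _)).
  by ring.
have c2 := noise_scale_sqr.
have e1 : - (sigma * (t * noise_scale)) ^+ 2 / 2 + - (sigma * (s + t / d%:R)) ^+ 2 / 2 =
   - (sigma * (s * noise_scale)) ^+ 2 / 2 + - (sigma * (t + s / d%:R)) ^+ 2 / 2.
  by rewrite !exprMn c2; field; rewrite gt_eqF// d_gt0.
have e2 : - (sigma * (t * noise_scale)) ^+ 2 / 2 + - (sigma * (s - t / d%:R)) ^+ 2 / 2 =
   - (sigma * (s * noise_scale)) ^+ 2 / 2 + - (sigma * (t - s / d%:R)) ^+ 2 / 2.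
  by rewrite !exprMn c2; field; rewrite gt_eqF// d_gt0.
have h (K E1 E2 c1 c3 : R) : K * ((E1 * c1 + E2 * c3) / 2) = (K * E1 * c1 + K * E2 * c3) / 2.
  by field.
by rewrite !E_coscos !h -!expRD e1 e2 [c + b]addrC -[cos (c - b)]cosN opprB.
Qed.

Lemma E_Q f : bm f -> \int[nu]_x Q f x = \int[nu]_x f x.
Proof.
move=> bf; have := Q_sym bf (bm_cst 1).
under eq_Rintegral do rewrite mul1r.
by under [in X in _ = X -> _]eq_Rintegral do rewrite Qcst mulr1.
Qed.

Lemma Q_pdf f a : bm f ->
  Q f a = \int[lebesgue_measure]_b (f b * normal_pdf (a / d%:R) (noise_scale * sigma) b).
Proof.
move=> bf.
have h1 := normal_prob_affine 0 sigma_gt0 (bmQ_in a bf).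
have s0 : 0 < noise_scale * sigma by rewrite mulr_gt0 ?noise_scale_gt0 ?sigma_gt0.
have h2 := normal_prob_affine (a / d%:R) s0 bf.
have h3 := integral_normal_pdfM (a / d%:R) (noise_scale * sigma) bf.
apply: (etrans _ h3); apply: (etrans _ (esym h2)); apply: (etrans h1).
by apply: eq_Rintegral => y _; congr f; ring.
Qed.

End Operator.

(** * The Markov property along edges *)

Section Markov.
Variables (R : realType) (V : choiceType) (adj : rel V) (d : nat).
Hypothesis tree : regular_tree adj d.+1.
Hypothesis d2 : (2 <= d)%N.
Context {dO : measure_display} {Omega : measurableType dO}.
Variables (P : probability Omega R) (phi : V -> {RV P >-> R}).
Local Notation tree_green := (@tree_green R V adj d tree).
Hypothesis field : centered_gaussian_field phi (fun x y => (tree_green x y)%:E).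
Local Notation lincomb := (lincomb phi).
Local Notation sigma := (@sigma R d).
Local Notation noise_scale := (@noise_scale R d).
Local Notation Q := (@mehler R d).
Local Notation branch := (branch adj).
Local Notation kids := (kids tree).
Local Notation bm := bounded_measurable.
Local Notation bmR := (@bounded_measurable R _ (measurableTypeR R)).
Implicit Types (p x y z : V) (s : seq (R * V)) (G M : Omega -> R).

Let mphi x : measurable_fun setT (phi x : Omega -> R).
Proof. exact: measurable_funP. Qed.

Let d_neq0 : (d%:R : R) != 0. Proof. by rewrite gt_eqF// d_gt0. Qed.

Lemma tree_green_diag x : tree_green x x = sigma ^+ 2.
Proof.
rewrite /tree_green dist_xx expr0 invr1 mulr1 /sigma sqr_sqrtr//.
rewrite divr_ge0// subr_ge0 -natrX ler1n expn_gt0.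
by rewrite (leq_trans _ d2).
Qed.

(** A path from [x] to a vertex outside the branch has to pass through [p]. *)
Lemma tree_green_outside p x y : adj p x -> ~ branch p x y -> tree_green x y = tree_green p y / d%:R.
Proof.
move=> px nb; have xp : adj x p by rewrite (tree_sym tree).
by rewrite /tree_green (dist_branch tree xp (branch_opp tree px nb)) (exprS _ (dist _ p y)) invfM; ring.
Qed.

Let cov_cons (a : R * V) s : cov tree_green (a :: s) (a :: s) =
  a.1 ^+ 2 * tree_green a.2 a.2 + 2 * a.1 * \sum_(b <- s) b.1 * tree_green a.2 b.2 + cov tree_green s s.
Proof.
rewrite /cov big_cons big_cons; under [X in _ + X = _]eq_bigr do rewrite big_cons.
rewrite big_split /= addrA; congr (_ + _); rewrite -addrA -expr2; congr (_ + _).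
rewrite -big_split mulr_sumr; apply: eq_bigr => b _ /=.
by rewrite [tree_green b.2 _](covar_sym field); ring.
Qed.

Let kap (t : R) := expR (- (sigma * (t * noise_scale)) ^+ 2 / 2).

(** The set of weights [G] that do not see the innovation of [phi x] given
    [phi p], tested against all Gaussian characters supported outside the
    branch. *)
Definition blind p x G := forall s, {in s, forall a, ~ branch p x a.2} ->
  forall t c, \int[P]_w (G w * cos (lincomb ((t, x) :: s) w + c)) =
    kap t * \int[P]_w (G w * cos (lincomb ((t / d%:R, p) :: s) w + c)).

(** [phi x - phi p / d] is uncorrelated with the field outside the branch; its
    variance gives the factor [kap t]. *)
Lemma blind1 p x : adj p x -> blind p x (fun=> 1).
Proof.
move=> px s outs t c.
under eq_Rintegral do rewrite mul1r.
under [X in _ = _ * X]eq_Rintegral do rewrite mul1r.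
rewrite !(E_cos_lincomb field) mulrA -expRD; congr (expR _ * _).
rewrite !cov_cons /= !tree_green_diag.
have -> : \sum_(b <- s) b.1 * tree_green x b.2 = d%:R^-1 * \sum_(b <- s) b.1 * tree_green p b.2.
  rewrite mulr_sumr; apply: eq_big_seq => b bs.
  by rewrite (tree_green_outside px (outs _ bs)); ring.
by rewrite !exprMn (noise_scale_sqr R d2); field.
Qed.

Lemma bm_cos_lincomb s (c : R) : bm (fun w => cos (lincomb s w + c)).
Proof. by apply: bm_cos; exact: measurable_lincomb. Qed.

Lemma bm_phi (f : R -> R) x : bmR f -> bm (fun w => f (phi x w)).
Proof. by move=> bf; exact: (bm_comp bf (mphi x)). Qed.

Let lincomb_cons (a : R * V) s w : lincomb (a :: s) w = a.1 * phi a.2 w + lincomb s w.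
Proof. by rewrite /lincomb big_cons. Qed.

(** A factor [f (phi y w)] may be replaced by a cosine of [phi y], and the product
    of two cosines just lengthens the linear combination. *)
Lemma blind_mul p x y G (f : R -> R) : bm G -> blind p x G -> ~ branch p x y ->
  bmR f -> blind p x (fun w => G w * f (phi y w)).
Proof.
move=> bG gG oy bf s outs t c.
pose w1 w := G w * cos (lincomb ((t, x) :: s) w + c).
pose w2 w := kap t * (G w * cos (lincomb ((t / d%:R, p) :: s) w + c)).
have b1 : bm w1 by apply: bmM => //; exact: bm_cos_lincomb.
have b2 : bm w2 by apply: bmZ; apply: bmM => //; exact: bm_cos_lincomb.
rewrite -EZ; last first.
  by apply: bmM; [apply: bmM => //; exact: bm_phi|exact: bm_cos_lincomb].
transitivity (\int[P]_w (w1 w * f (phi y w))).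
  by apply: eq_Rintegral => w _; rewrite /w1; ring.
transitivity (\int[P]_w (w2 w * f (phi y w))); last first.
  by apply: eq_Rintegral => w _; rewrite /w2; ring.
apply: (cos_determines_law b1 b2 (mphi y) (mphi y) _ bf) => r b.
have split_cos q u w : G w * cos (lincomb ((q, u) :: s) w + c) * cos (r * phi y w + b) =
    2^-1 * (G w * cos (lincomb ((q, u) :: (r, y) :: s) w + (c + b)) +
           G w * cos (lincomb ((q, u) :: (- r, y) :: s) w + (c - b))).
  rewrite !lincomb_cons /=; set A := q * _; set B := lincomb s w.
  have -> : A + (r * phi y w + B) + (c + b) = (A + B + c) + (r * phi y w + b) by ring.
  have -> : A + (- r * phi y w + B) + (c - b) = (A + B + c) - (r * phi y w + b) by ring.
  by rewrite (cosB (A + B + c)) (cosD (A + B + c)); field.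
have E_split q u : \int[P]_w (G w * cos (lincomb ((q, u) :: s) w + c) * cos (r * phi y w + b)) =
    2^-1 * (\int[P]_w (G w * cos (lincomb ((q, u) :: (r, y) :: s) w + (c + b))) +
            \int[P]_w (G w * cos (lincomb ((q, u) :: (- r, y) :: s) w + (c - b)))).
  have bb v e : bm (fun w => G w * cos (lincomb v w + e)).
    by apply: bmM => //; exact: bm_cos_lincomb.
  rewrite -ED//; rewrite -EZ; last exact: bmD.
  by apply: eq_Rintegral => w _; exact: split_cos.
have outs' q : {in (q, y) :: s, forall a, ~ branch p x a.2}.
  by move=> a; rewrite inE => /orP[/eqP ->//|]; exact: outs.
rewrite /w1 E_split !gG//.
transitivity (kap t * \int[P]_w
    (G w * cos (lincomb ((t / d%:R, p) :: s) w + c) * cos (r * phi y w + b))).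
  by rewrite E_split; ring.
rewrite -EZ.
  by apply: eq_Rintegral => w _; rewrite /w2; ring.
apply: bmM; first by apply: bmM => //; exact: bm_cos_lincomb.
by apply: bm_cos; apply: measurable_funM.
Qed.

(** The algebra of bounded functions generated by the field on [A]; as an
    inductive predicate it gives [blind_cylinder] by structural induction. *)
Inductive cylinder (A : set V) : (Omega -> R) -> Prop :=
| cylinder_cst c : cylinder A (fun=> c)
| cylinder_val y (f : R -> R) : A y -> bmR f -> cylinder A (fun w => f (phi y w))
| cylinderD M M' : cylinder A M -> cylinder A M' -> cylinder A (fun w => M w + M' w)
| cylinderM M M' : cylinder A M -> cylinder A M' -> cylinder A (fun w => M w * M' w).

Lemma cylinder_bm A M : cylinder A M -> bm M.
Proof.
elim=> [c|y f _ bf|M1 M2 _ b1 _ b2|M1 M2 _ b1 _ b2].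
- exact: bm_cst.
- exact: bm_phi.
- exact: bmD.
- exact: bmM.
Qed.

Lemma cylinderS A B M : A `<=` B -> cylinder A M -> cylinder B M.
Proof.
move=> AB; elim=> [c|y f Ay bf|M1 M2 _ b1 _ b2|M1 M2 _ b1 _ b2].
- exact: cylinder_cst.
- by apply: cylinder_val => //; exact: AB.
- exact: cylinderD.
- exact: cylinderM.
Qed.

Lemma cylinder_prod A (I : eqType) (r : seq I) (F : I -> Omega -> R) :
  {in r, forall i, cylinder A (F i)} -> cylinder A (fun w => \prod_(i <- r) F i w).
Proof.
elim: r => [|i r IH] h.
  by under eq_fun do rewrite big_nil; exact: cylinder_cst.
under eq_fun do rewrite big_cons; apply: cylinderM.
  by apply: h; rewrite inE eqxx.
by apply: IH => j jr; apply: h; rewrite inE jr orbT.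
Qed.

Lemma blind_cylinder p x M : adj p x -> cylinder (~` branch p x) M -> blind p x M.
Proof.
move=> px cM.
suff h G : bm G -> blind p x G -> blind p x (fun w => G w * M w).
  have := h _ (bm_cst 1) (blind1 px).
  by under eq_fun do rewrite mul1r.
elim: cM G => [c|y f Ay bf|M1 M2 c1 IH1 c2 IH2|M1 M2 c1 IH1 c2 IH2] G bG gG.
- move=> s outs t e.
  have b v r : bm (fun w => G w * cos (lincomb v w + r)).
    by apply: bmM => //; exact: bm_cos_lincomb.
  have h v r : \int[P]_w (G w * c * cos (lincomb v w + r)) =
      c * \int[P]_w (G w * cos (lincomb v w + r)).
    by rewrite -EZ//; apply: eq_Rintegral => w _; ring.
  by rewrite !h gG//; ring.
- exact: blind_mul.
- move=> s outs t e.
  have b1 := cylinder_bm c1; have b2 := cylinder_bm c2.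
  have h v r : \int[P]_w (G w * (M1 w + M2 w) * cos (lincomb v w + r)) =
      \int[P]_w (G w * M1 w * cos (lincomb v w + r)) +
      \int[P]_w (G w * M2 w * cos (lincomb v w + r)).
    rewrite -ED; try by apply: bmM; [exact: bmM|exact: bm_cos_lincomb].
    by apply: eq_Rintegral => w _; ring.
  by rewrite !h (IH1 _ bG gG)// (IH2 _ bG gG)//; ring.
- have b1 := cylinder_bm c1.
  have := IH2 _ (bmM bG b1) (IH1 _ bG gG).
  by under eq_fun do rewrite -mulrA.
Qed.

(** For cosines this is [blind_cylinder], because [Q] maps a cosine to a multiple
    of a cosine. *)
Lemma markov_step p x G (f : R -> R) : adj p x -> cylinder (~` branch p x) G -> bmR f ->
  \int[P]_w (G w * f (phi x w)) = \int[P]_w (G w * Q f (phi p w)).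
Proof.
move=> px cG; have bG := cylinder_bm cG; have gG := blind_cylinder px cG.
have [N GN] := bG.2.
pose H (f : R -> R) := \int[P]_w (G w * f (phi x w)) = \int[P]_w (G w * Q f (phi p w)).
move: f; apply: (trig_monotone_class (H := H)).
- move=> f g c bf bg hf hg; rewrite /H.
  transitivity (\int[P]_w (G w * f (phi x w)) + c * \int[P]_w (G w * g (phi x w))).
    rewrite -Elin; try by apply: bmM => //; exact: bm_phi.
    by apply: eq_Rintegral => w _; ring.
  rewrite hf hg -Elin; try by apply: bmM => //; apply: bm_phi; exact: bm_Q.
  by apply: eq_Rintegral => w _; rewrite Qlin//; ring.
- move=> f_ f M bf_ hf bf fM ff.
  have c1 : \int[P]_w (G w * f_ n (phi x w)) @[n --> \oo] --> \int[P]_w (G w * f (phi x w)).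
    apply: (E_cvg (M := N * M)).
    + by move=> n; case: (bmM bG (bm_phi x (bf_ n))).
    + by case: (bmM bG (bm_phi x bf)).
    + by move=> n w; rewrite normrM ler_pM.
    + by move=> w; apply: cvgMl_tmp; exact: ff.
  have c2 : \int[P]_w (G w * Q (f_ n) (phi p w)) @[n --> \oo] --> \int[P]_w (G w * Q f (phi p w)).
    apply: (E_cvg (M := N * M)).
    + by move=> n; case: (bmM bG (bm_phi p (bm_Q d (bf_ n)))).
    + by case: (bmM bG (bm_phi p (bm_Q d bf))).
    + by move=> n w; rewrite normrM ler_pM// Q_bound.
    + by move=> w; apply: cvgMl_tmp; exact: Q_cvg ff.
  rewrite (_ : (fun n => _) = fun n => \int[P]_w (G w * Q (f_ n) (phi p w))) in c1.
    exact: (cvg_unique _ c1 c2).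
  by apply/funext => n; exact: hf.
- move=> t c; rewrite /H.
  have := gG [::] (fun a => _) t c => /(_ ltac:(by [])).
  under eq_Rintegral do rewrite lincomb_cons /lincomb big_nil addr0 /=.
  move=> ->; rewrite -EZ; last by apply: bmM => //; exact: bm_cos_lincomb.
  apply: eq_Rintegral => w _.
  rewrite (Q_cos d2) lincomb_cons /lincomb big_nil addr0 /= -/(kap t).
  by rewrite mulrCA; congr (_ * (_ * cos _)); ring.
Qed.

(** Functionals of the branch at [x] seen from [p]: level by level, an affine
    expression in the product over the offspring. *)
Fixpoint functional (l : seq ((R -> R) * (R -> R))) p x : Omega -> R :=
  if l is (a, b) :: l' then fun w =>
    a (phi x w) + b (phi x w) * \prod_(y <- kids p x) functional l' x y w
  else fun=> 0.

Fixpoint mean_functional (l : seq ((R -> R) * (R -> R))) : R -> R :=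
  if l is (a, b) :: l' then fun u => a u + b u * (Q (mean_functional l') u) ^+ d
  else fun=> 0.

Fixpoint bm_levels (l : seq ((R -> R) * (R -> R))) : Prop :=
  if l is (a, b) :: l' then [/\ bmR a, bmR b & bm_levels l'] else True.

Lemma bm_mean l : bm_levels l -> bmR (mean_functional l).
Proof.
elim: l => [|[a b] l IH] /=; first by move=> _; exact: bm_cst.
move=> [ba bb /IH bl]; apply: bmD => //; apply: bmM => //; apply: bmX.
exact: bm_Q.
Qed.

Lemma functional_cylinder l p x : bm_levels l -> adj p x ->
  cylinder (branch p x) (functional l p x).
Proof.
elim: l p x => [|[a b] l IH] p x /=; first by move=> _ _; exact: cylinder_cst.
move=> [ba bb bl] px; apply: cylinderD.
  by apply: cylinder_val => //; exact: branch_root.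
apply: cylinderM; first by apply: cylinder_val => //; exact: branch_root.
apply: cylinder_prod => y; rewrite mem_kids => /andP[xy yp].
by apply: cylinderS (IH _ _ bl xy) => z; exact: branch_child.
Qed.

(** Given [phi x], the offspring branches are independent. They are integrated
    out one after the other, those that remain being part of the weight. *)
Lemma functional_mean l p x G : bm_levels l -> adj p x ->
  cylinder (~` branch p x) G ->
  \int[P]_w (G w * functional l p x w) =
  \int[P]_w (G w * Q (mean_functional l) (phi p w)).
Proof.
elim: l p x G => [|[a b] l IH] p x G bl px cG.
  by apply: eq_Rintegral => w _; rewrite /= Qcst.
have [ba bb bl'] := bl; have bG := cylinder_bm cG.
have bm' := bm_mean bl'.
set q := Q (mean_functional l) in IH *.
have bq : bmR q by exact: bm_Q.
(* Integrate the offspring out one branch at a time. *)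
have peel (r : seq V) M : uniq r -> {subset r <= kids p x} ->
    cylinder [set z | forall y, y \in r -> ~ branch x y z] M ->
    \int[P]_w (M w * \prod_(y <- r) functional l x y w) =
    \int[P]_w (M w * q (phi x w) ^+ size r).
  elim: r M => [|y r IHr] M /=.
    by move=> _ _ _; apply: eq_Rintegral => w _; rewrite big_nil expr0.
  move=> /andP[yr ur] rk cM.
  have := rk y; rewrite inE eqxx => /(_ isT); rewrite mem_kids => /andP[xy yp].
  have rk' : {subset r <= kids p x} by move=> z zr; apply: rk; rewrite inE zr orbT.
  have cM' : cylinder (~` branch x y) (fun w => M w * \prod_(y' <- r) functional l x y' w).
    apply: cylinderM; first by apply: cylinderS cM => z; apply; rewrite inE eqxx.
    apply: cylinder_prod => y' y'r; have := rk' _ y'r; rewrite mem_kids => /andP[xy' _].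
    apply: cylinderS (functional_cylinder bl' xy') => z bz' bz.
    apply: (branch_disjoint tree xy xy' _ bz bz').
    by apply: contraNneq yr => ->.
  transitivity (\int[P]_w ((M w * \prod_(y' <- r) functional l x y' w) * functional l x y w)).
    by apply: eq_Rintegral => w _; rewrite big_cons; ring.
  rewrite (IH x y _ bl' xy cM').
  transitivity (\int[P]_w ((M w * q (phi x w)) * \prod_(y' <- r) functional l x y' w)).
    by apply: eq_Rintegral => w _; ring.
  rewrite IHr//.
    by apply: eq_Rintegral => w _; rewrite exprS; ring.
  apply: cylinderM.
    by apply: cylinderS cM => z h y' y'r; apply: h; rewrite inE y'r orbT.
  apply: (@cylinder_val _ x q) => // y' /rk'; rewrite mem_kids => /andP[xy' _].
  exact: (branchN tree xy').
have cG' (f : R -> R) : bmR f -> cylinder [set z | forall y, y \in kids p x -> ~ branch x y z]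
    (fun w => G w * f (phi x w)).
  move=> bf; apply: cylinderM; last first.
    apply: (@cylinder_val _ x f) => // y; rewrite mem_kids => /andP[xy _].
    exact: (branchN tree xy).
  apply: cylinderS cG => z nb y; rewrite mem_kids => /andP[xy yp] bz.
  by apply: nb; exact: branch_child bz.
have := peel _ _ (kids_uniq tree p x) (fun _ h => h) (cG' _ bb).
rewrite size_kids// => e.
have bml := bm_mean bl.
rewrite -(markov_step px cG bml) /= -/q.
transitivity (\int[P]_w (G w * a (phi x w)) + \int[P]_w (G w * b (phi x w) *
    \prod_(y <- kids p x) functional l x y w)).
  rewrite -ED.
  - by apply: eq_Rintegral => w _; ring.
  - by apply: bmM => //; exact: bm_phi.
  - apply: (@cylinder_bm setT); apply: cylinderM.
      by apply: cylinderS (cG' _ bb).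
    apply: cylinder_prod => y; rewrite mem_kids => /andP[xy _].
    by apply: cylinderS (functional_cylinder bl' xy).
rewrite e -ED.
- by apply: eq_Rintegral => w _; ring.
- by apply: bmM => //; exact: bm_phi.
- apply: bmM; first by apply: bmM => //; exact: bm_phi.
  by apply: bmX; exact: bm_phi.
Qed.

End Markov.

(** * Strict monotonicity in the level *)

Section CauchySchwarz.
Context {R : realType} d (T : measurableType d) (mu : {measure set T -> \bar R}).
Local Notation intb f := (mu.-integrable setT (fun x => (f x)%:E)).

(** The quadratic polynomial [\int (t * u - v) ^+ 2] in [t] is nonnegative. *)
Lemma Rintegral_CauchySchwarz (u v : T -> R) :
  intb (fun x => u x ^+ 2) -> intb (fun x => v x ^+ 2) -> intb (fun x => u x * v x) ->
  (\int[mu]_x (u x * v x)) ^+ 2 <= (\int[mu]_x (u x ^+ 2)) * (\int[mu]_x (v x ^+ 2)).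
Proof.
move=> iu iv iuv.
set A := \int[mu]_x (u x ^+ 2); set B := \int[mu]_x (u x * v x); set C := \int[mu]_x (v x ^+ 2).
have q t : 0 <= t ^+ 2 * A + (-2 * t) * B + C.
  rewrite -(RintegralZl _ measurableT iu) -(RintegralZl _ measurableT iuv).
  rewrite -RintegralD; [|by []|exact: integrableR_Z|exact: integrableR_Z].
  rewrite -RintegralD; [|by []| |by []]; last first.
    by apply: integrableR_D; exact: integrableR_Z.
  apply: Rintegral_ge0 => x _.
  by rewrite (_ : _ + _ = (t * u x - v x) ^+ 2) ?sqr_ge0//; ring.
have A0 : 0 <= A by apply: Rintegral_ge0 => x _; exact: sqr_ge0.
have [A00|An0] := eqVneq A 0.
  have [->|Bn0] := eqVneq B 0; first by rewrite expr0n A00 mul0r.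
  have := q ((C + 1) / (2 * B)); rewrite A00 mulr0 add0r.
  rewrite (_ : -2 * ((C + 1) / (2 * B)) * B = - (C + 1)); last by field.
  lra.
have Ap : 0 < A by rewrite lt_neqAle eq_sym An0.
have := q (B / A); rewrite (_ : (B / A) ^+ 2 * A + -2 * (B / A) * B + C = C - B ^+ 2 / A).
  by rewrite subr_ge0 ler_pdivrMr// mulrC.
by field.
Qed.

End CauchySchwarz.

Section StrictMonotonicity.
Variables (R : realType) (d : nat).
Hypothesis d2 : (2 <= d)%N.
Notation nu := (@nu R d).
Notation mu := (@lebesgue_measure R).
Local Notation sigma := (@sigma R d).
Local Notation noise_scale := (@noise_scale R d).
Local Notation Q := (@mehler R d).
Local Notation bm := (@bounded_measurable R _ (measurableTypeR R)).
Implicit Types f g : R -> R.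

Definition sqnorm f : R := \int[nu]_x (f x ^+ 2).

Let s0 : 0 < noise_scale * sigma. Proof. by rewrite mulr_gt0 ?noise_scale_gt0 ?sigma_gt0. Qed.

Lemma normal_pdf_lb (m s B b : R) : 0 < s -> `|b - m| <= B ->
  normal_peak s * expR (- B ^+ 2 / (s ^+ 2 *+ 2)) <= normal_pdf m s b.
Proof.
move=> sp bB; rewrite normal_pdfE ?gt_eqF// /normal_fun ler_wpM2l ?normal_peak_ge0//.
rewrite ler_expR !mulNr lerN2 ler_wpM2r ?invr_ge0 ?mulrn_wge0 ?sqr_ge0//.
by rewrite -(real_normK (num_real (b - m))) lerXn2r// nnegrE (le_trans _ bB).
Qed.

Lemma integrable_compact f u v : bm f -> (forall x, ~~ (u <= x <= v) -> f x = 0) ->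
  mu.-integrable setT (fun x => (f x)%:E).
Proof.
move=> [mf [M fM]] f0.
have i : mu.-integrable setT (fun x => (\1_(`[u, v]%classic : set R) x)%:E).
  apply/integrableP; split; first by apply/measurable_EFinP; exact: measurable_indic.
  under eq_integral do rewrite gee0_abs ?lee_fin//.
  rewrite integral_indic//= setIT lebesgue_measure_itv/=.
  by case: ifP => _; rewrite ?ltry// -EFinB ltry.
apply: (integrableR_le mf _ (integrableR_Z `|M| i)) => x.
have [xuv|xuv] := boolP (u <= x <= v).
  rewrite indicE mem_set ?mulr1; last by rewrite /= in_itv.
  by rewrite (le_trans (fM x))// ler_norm.
by rewrite f0// normr0 mulr_ge0.
Qed.

Lemma Q_compact_ub f u v a : bm f -> (forall x, 0 <= f x) ->
  (forall x, ~~ (u <= x <= v) -> f x = 0) ->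
  Q f a <= normal_peak (noise_scale * sigma) * \int[mu]_x f x.
Proof.
move=> bf f0 fuv; have i := integrable_compact bf fuv.
rewrite (Q_pdf d2)// -RintegralZl//; apply: le_Rintegral => //.
- apply: (integrableR_le _ _ (integrableR_Z (normal_peak (noise_scale * sigma)) i)).
    by apply: measurable_funM; [exact: bf.1|exact: measurable_normal_pdf].
  move=> x; rewrite normrM !ger0_norm ?normal_pdf_ge0// mulrC ler_wpM2r//.
  by apply: normal_pdf_ub; rewrite gt_eqF.
- exact: integrableR_Z.
- by move=> x _; rewrite mulrC ler_wpM2r// normal_pdf_ub// gt_eqF.
Qed.

(** A lower bound for the density of [Q] at points of [[- B, B]], uniform in the
    starting points of [[- A, A]]. *)
Definition pdf_inf (A B : R) : R :=
  normal_peak (noise_scale * sigma) * expR (- (A + B) ^+ 2 / ((noise_scale * sigma) ^+ 2 *+ 2)).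

Lemma pdf_inf_gt0 A B : 0 < pdf_inf A B.
Proof. by rewrite mulr_gt0 ?expR_gt0// normal_peak_gt0// gt_eqF. Qed.

Lemma Q_compact_lb f A B a : bm f -> (forall x, 0 <= f x) ->
  (forall x, ~~ (- B <= x <= B) -> f x = 0) -> `|a| <= A ->
  pdf_inf A B * \int[mu]_x f x <= Q f a.
Proof.
move=> bf f0 fuv aA; have i := integrable_compact bf fuv.
rewrite (Q_pdf d2)// -RintegralZl//; apply: le_Rintegral => //.
- exact: integrableR_Z.
- apply: (integrableR_le _ _ (integrableR_Z (normal_peak (noise_scale * sigma)) i)).
    by apply: measurable_funM; [exact: bf.1|exact: measurable_normal_pdf].
  move=> x; rewrite normrM !ger0_norm ?normal_pdf_ge0// mulrC ler_wpM2r//.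
  by apply: normal_pdf_ub; rewrite gt_eqF.
- move=> x _; have [xB|xB] := boolP (- B <= x <= B); last by rewrite fuv// mulr0 mul0r.
  rewrite mulrC ler_wpM2l// normal_pdf_lb//.
  rewrite (le_trans (ler_normB _ _))// addrC lerD//; last by rewrite ler_norml.
  rewrite normrM normfV (ger0_norm (ltW (d_gt0 R d2))) ler_pdivrMr ?d_gt0//.
  by rewrite (le_trans aA)// ler_peMr ?(le_trans _ aA)// ltW// ltr1n.
Qed.

Let s := (sigma * noise_scale) ^+ 2.

Lemma bm_sqr f : bm f -> bm (fun x => f x ^+ 2). Proof. by move=> bf; exact: bmX. Qed.

Lemma sqnorm_ge0 f : 0 <= sqnorm f.
Proof. by apply: Rintegral_ge0 => x _; exact: sqr_ge0. Qed.

(** Young's inequality. *)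
Lemma sqnormD_le (t : R) f g : 0 < t -> bm f -> bm g ->
  sqnorm (fun x => f x + g x) <= (1 + t) * sqnorm f + (1 + t^-1) * sqnorm g.
Proof.
move=> t0 bf bg; rewrite /sqnorm.
rewrite -(EZ nu (1 + t) (bm_sqr bf)) -(Elin nu (1 + t^-1) (bmZ (1 + t) (bm_sqr bf)) (bm_sqr bg)).
apply: le_E.
- by apply: bm_sqr; exact: bmD.
- by apply: bmD; apply: bmZ; exact: bm_sqr.
- move=> x; rewrite -subr_ge0.
  have -> : (1 + t) * f x ^+ 2 + (1 + t^-1) * g x ^+ 2 - (f x + g x) ^+ 2 =
     t^-1 * (t * f x - g x) ^+ 2 by field; rewrite gt_eqF.
  by rewrite mulr_ge0 ?sqr_ge0// invr_ge0 ltW.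
Qed.

Lemma Q_sqr_min n b : Q (fun x => Num.min (x ^+ 2) n%:R) b <= (b / d%:R) ^+ 2 + s.
Proof.
have [i e] := integral_normal_affine_sqr (sigma_gt0 R d2) (b / d%:R) noise_scale.
rewrite /s -e; apply: le_Rintegral => //; last by move=> x _; rewrite ge_min lexx.
apply: (integrableR_le _ _ i).
  apply: measurable_minr; last exact: measurable_cst.
  apply: measurable_funX; apply: measurable_funD => //; exact: measurable_funM.
move=> x; rewrite ger0_norm; last by rewrite le_min sqr_ge0 ler0n.
by rewrite ge_min lexx.
Qed.

(** A Schur test with the weight [a ^+ 2], whose image under [Q] is explicit:
    far from the origin [Q] contracts by almost [d ^- 2]. *)
Lemma sqnorm_Q_far f M : 0 < M -> bm f -> (forall x, x <= M -> f x = 0) ->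
  sqnorm (Q f) <= (d%:R ^- 4 + (s / d%:R ^+ 2 + s) / M ^+ 2) * sqnorm f.
Proof.
move=> M0 bf fM.
have [N fN] := bf.2.
have dp := d_gt0 R d2.
have sp : 0 <= s by exact: sqr_ge0.
(* The inverse of [x] on the support of [f], in a form known to be measurable. *)
pose r x : R := expR (- ln x).
have rE x : M < x -> r x = x^-1.
  by move=> Mx; rewrite /r expRN lnK// posrE (lt_trans M0).
pose g x := (f x * r x) ^+ 2.
have bg0 : bm (fun x => f x * r x).
  split.
    apply: measurable_funM; first exact: bf.1.
    apply: measurableT_comp => //; exact: measurableT_comp.
  exists (N / M) => x; have [xM|xM] := leP x M.
    by rewrite fM// mul0r normr0 divr_ge0 ?(ltW M0)// (le_trans _ (fN x)).
  have x0 : 0 < x by exact: lt_trans xM.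
  rewrite rE// normrM normfV (gtr0_norm x0) ler_pM ?invr_ge0 ?(ltW x0)//.
  by rewrite lef_pV2 ?posrE// ltW.
have bg : bm g := bm_sqr bg0.
(* [a ^+ 2] and [Q f] are truncated by [w n] and [ind n] to stay bounded. *)
pose w n (x : R) := Num.min (x ^+ 2) n%:R : R.
have bw n : bm (w n).
  split.
    by apply: measurable_minr; [exact: measurable_funX|exact: measurable_cst].
  exists n%:R => x; rewrite ger0_norm; last by rewrite le_min sqr_ge0 ler0n.
  by rewrite ge_min lexx orbT.
pose v n x := w n x / d%:R ^+ 2 + s.
have bv n : bm (v n).
  by rewrite /v; under eq_fun do rewrite mulrC; apply: bmD; [exact: bmZ|exact: bm_cst].
have CS a : Q f a ^+ 2 <= ((a / d%:R) ^+ 2 + s) * Q g a.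
  have [i e] := integral_normal_affine_sqr (sigma_gt0 R d2) (a / d%:R) noise_scale.
  rewrite /s -e /mehler.
  have zE z : z * (f z * r z) = f z.
    have [zM|zM] := leP z M; first by rewrite fM// mul0r mulr0.
    by rewrite rE// mulrCA divff ?mulr1// gt_eqF// (lt_trans M0).
  have -> : \int[nu]_y f (a / d%:R + noise_scale * y) = \int[nu]_y ((a / d%:R + noise_scale * y) *
      (f (a / d%:R + noise_scale * y) * r (a / d%:R + noise_scale * y))).
    by apply: eq_Rintegral => y _; rewrite zE.
  apply: Rintegral_CauchySchwarz => //.
  - exact: (bm_integrable nu (bmQ_in d a bg)).
  - by under eq_fun do rewrite zE; exact: (bm_integrable nu (bmQ_in d a bf)).
pose ind n (a : R) : R := (a ^+ 2 <= n%:R)%R%:R.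
have bind n : bm (ind n).
  split; last by exists 1 => a; rewrite /ind; case: (a ^+ 2 <= _); rewrite ?normr1 ?normr0.
  have mg : measurable_fun setT (fun a : R => a ^+ 2) by exact: measurable_funX.
  rewrite (_ : ind n = \1_((fun a : R => a ^+ 2) @^-1` `]-oo, n%:R])).
    by apply: measurable_indic; rewrite -[X in measurable X]setTI; exact: mg.
  apply/funext => a; rewrite indicE /ind; congr ((nat_of_bool _)%:R).
  by apply/idP/idP => [h|/set_mem]; [apply/mem_set|]; rewrite /= in_itv.
have step n : \int[nu]_a (Q f a ^+ 2 * ind n a) <=
    (d%:R ^- 4 + (s / d%:R ^+ 2 + s) / M ^+ 2) * sqnorm f.
  apply: (@le_trans _ _ (\int[nu]_a (v n a * Q g a))).
    apply: le_E.
    - by apply: bmM => //; apply: bm_sqr; exact: bm_Q.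
    - by apply: bmM => //; exact: bm_Q.
    - move=> a; have g0 : 0 <= Q g a by apply: Q_ge0 => x; exact: sqr_ge0.
      rewrite /ind /v /w; have [an|an] := lerP (a ^+ 2) n%:R; last first.
        by rewrite mulr0 mulr_ge0// addr_ge0// divr_ge0 ?exprn_ge0 ?(ltW dp)// ler0n.
      by rewrite mulr1 -expr_div_n.
  rewrite Q_sym// -EZ; last exact: bm_sqr.
  apply: le_E.
  - by apply: bmM => //; exact: bm_Q.
  - by apply: bmZ; exact: bm_sqr.
  - move=> b; rewrite /g.
    have [bM|bM] := leP b M; first by rewrite fM// mul0r expr0n mul0r mulr0.
    rewrite rE// exprMn exprVn -mulrA [leRHS]mulrC ler_wpM2l ?sqr_ge0//.
    have Qv : Q (v n) b = Q (w n) b / d%:R ^+ 2 + s.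
      rewrite /v; under [X in Q X]eq_fun do rewrite mulrC -[s]mulr1.
      by rewrite Qlin ?Qcst ?mulr1 ?QZ// ?[_ / _]mulrC//; [exact: bmZ|exact: bm_cst].
    have b0 : 0 < b by exact: lt_trans bM.
    apply: (@le_trans _ _ (b ^- 2 * (((b / d%:R) ^+ 2 + s) / d%:R ^+ 2 + s))).
      rewrite ler_wpM2l ?invr_ge0 ?sqr_ge0// Qv lerD2r ler_wpM2r ?invr_ge0 ?sqr_ge0//.
      exact: Q_sqr_min.
    have -> : b ^- 2 * (((b / d%:R) ^+ 2 + s) / d%:R ^+ 2 + s) =
        d%:R ^- 4 + (s / d%:R ^+ 2 + s) / b ^+ 2.
      by field; rewrite !gt_eqF.
    rewrite lerD2l ler_wpM2l ?addr_ge0 ?divr_ge0 ?sqr_ge0//.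
    rewrite lef_pV2 ?posrE ?exprn_gt0//.
    by rewrite lerXn2r// ?nnegrE ltW.
have cv : \int[nu]_a (Q f a ^+ 2 * ind n a) @[n --> \oo] --> \int[nu]_a (Q f a ^+ 2).
  apply: (E_cvg (M := N ^+ 2)).
  - by move=> n; case: (bmM (bm_sqr (bm_Q d bf)) (bind n)).
  - by case: (bm_sqr (bm_Q d bf)).
  - move=> n x; rewrite normrM -[leRHS]mulr1 ler_pM// /ind.
      rewrite normrX lerXn2r ?nnegrE//; last exact: Q_bound.
      exact: le_trans (fN 0).
    by case: (x ^+ 2 <= _); rewrite ?normr1 ?normr0.
  - move=> x; apply: cvg_near_cst; near=> n.
    rewrite /ind (_ : x ^+ 2 <= n%:R) ?mulr1//.
    by near: n; exact: nbhs_infty_ger.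
apply: (cvgr_to_le cv).
by near=> n; exact: step.
Unshelve. all: by end_near. Qed.

Lemma bm_pih h f : bm f -> bm (pih h f).
Proof. by move=> bf; apply: bmM => //; exact: bm_indic. Qed.

Lemma pih_ge0 h f : (forall x, 0 <= f x) -> forall x, 0 <= pih h f x.
Proof. by move=> f0 x; rewrite /pih mulr_ge0. Qed.

Lemma pihE h f x : pih h f x = if h <= x then f x else 0.
Proof.
rewrite /pih indicE; case: ifPn => hx.
  by rewrite mem_set ?mul1r//= in_itv/= hx.
by rewrite memNset ?mul0r//= in_itv/= andbT; apply/negP.
Qed.

Lemma opLhE h f a : opLh d h f a = if h <= a then d%:R * Q (pih h f) a else 0.
Proof. by rewrite /opLh pihE opLE. Qed.

Lemma bm_opLh h f : bm f -> bm (opLh d h f).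
Proof. by move=> bf; apply: bm_pih; apply: bmZ; apply: bm_Q; exact: bm_pih. Qed.

Lemma opLh_ge0 h f : (forall x, 0 <= f x) -> forall x, 0 <= opLh d h f x.
Proof.
move=> f0; apply: pih_ge0 => x; rewrite opLE mulr_ge0// Q_ge0//.
exact: pih_ge0.
Qed.

Lemma le_sqnorm f g : bm f -> bm g -> (forall x, f x ^+ 2 <= g x ^+ 2) ->
  sqnorm f <= sqnorm g.
Proof. by move=> bf bg fg; apply: le_E => //; exact: bm_sqr. Qed.

Lemma sqnorm_pih h f : bm f -> sqnorm (pih h f) <= sqnorm f.
Proof.
move=> bf; apply: le_sqnorm => // [|x]; first exact: bm_pih.
by rewrite pihE; case: ifP => // _; rewrite expr0n sqr_ge0.
Qed.

Lemma sqnormZ k f : bm f -> sqnorm (fun x => k * f x) = k ^+ 2 * sqnorm f.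
Proof.
move=> bf; rewrite /sqnorm -EZ; last exact: bm_sqr.
by apply: eq_Rintegral => x _; rewrite exprMn.
Qed.

Let norm_between (u v a : R) : u <= a -> a <= v -> `|a| <= `|u| + `|v|.
Proof.
have := ler_norm v; have := ler_norm (- u); rewrite normrN => u1 u2.
have := normr_ge0 u; have := normr_ge0 v.
by rewrite ler_norml => v1 v2 ua av; apply/andP; split; lra.
Qed.

Lemma nu_itv_gt0 u v : u < v -> 0 < \int[nu]_x (\1_(`[u, v[%classic : set R) x : R).
Proof.
move=> uv; rewrite (integral_normal_pdfM 0 sigma); last exact: bm_indic.
set m := normal_peak sigma * expR (- (`|u| + `|v|) ^+ 2 / (sigma ^+ 2 *+ 2)).
have m0 : 0 < m by rewrite mulr_gt0 ?expR_gt0// normal_peak_gt0// gt_eqF// sigma_gt0.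
have b1 : bm (\1_(`[u, v[%classic : set R)) by exact: bm_indic.
have i : mu.-integrable setT (fun x => (\1_(`[u, v[%classic : set R) x)%:E).
  apply: (integrable_compact (u := u) (v := v) b1) => x xuv.
  rewrite indicE memNset//= in_itv/= => /andP[ux xv].
  by move: xuv; rewrite ux ltW.
have e : \int[mu]_x (\1_(`[u, v[%classic : set R) x : R) = v - u.
  rewrite /Rintegral integral_indic//= setIT lebesgue_measure_itv/= lte_fin uv.
  by rewrite -EFinB.
apply: (@lt_le_trans _ _ (m * (v - u))); first by rewrite mulr_gt0// subr_gt0.
rewrite -e -RintegralZl//; apply: le_Rintegral => //.
- exact: integrableR_Z.
- apply: (integrableR_le _ _ (integrableR_Z (normal_peak sigma) i)).
    by apply: measurable_funM; [exact: b1.1|exact: measurable_normal_pdf].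
  move=> x; rewrite normrM !ger0_norm ?normal_pdf_ge0// mulrC ler_wpM2r//.
  by apply: normal_pdf_ub; rewrite gt_eqF// sigma_gt0.
- move=> x _; rewrite indicE; have [xuv|] := boolP (_ \in _); last by rewrite mulr0 mul0r.
  rewrite mulr1 mul1r /m; apply: normal_pdf_lb; first exact: sigma_gt0.
  move/set_mem : xuv; rewrite /= in_itv/= subr0 => /andP[ux xv].
  exact: norm_between (ltW xv).
Qed.

Let combine_far_near (g1 g2 n X : R) : g2 <= 1 / 2 * n -> g1 <= X ->
  (1 + 1 / 2) * g2 + (1 + (1 / 2)^-1) * g1 <= 3 / 4 * n + 3 * X.
Proof. by rewrite div1r invrK; lra. Qed.

Let combine_losses (N n c1 c2 J : R) : 0 < c1 -> 0 <= c2 ->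
  N + c1 * J <= n -> N <= 3 / 4 * n + c2 * J -> N <= (c2 + 3 / 4 * c1) / (c1 + c2) * n.
Proof.
move=> c10 c20 h1 h2; have c0 : 0 < c1 + c2 by rewrite ltr_pwDl.
rewrite mulrAC ler_pdivlMr//.
have := ler_wpM2l c20 h1; have := ler_wpM2l (ltW c10) h2; lra.
Qed.

(** The mass that [opLh d h1] puts on [h1, h2) is lost by [opLh d h2]. A test
    function can avoid losing a fixed proportion only by sitting far to the
    right, where [opLh] contracts. *)
Theorem strict_monotonicity h1 h2 : h1 < h2 ->
  (forall f, bm f -> (forall x, 0 <= f x) -> sqnorm (opLh d h1 f) <= sqnorm f) ->
  exists2 k, 0 <= k < 1 &
    forall f, bm f -> (forall x, 0 <= f x) -> sqnorm (opLh d h2 f) <= k * sqnorm f.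
Proof.
move=> h12 contr.
have dp := d_gt0 R d2; have dge := d_ge2 R d2.
have sp : 0 <= s by exact: sqr_ge0.
pose K := s + d%:R ^+ 2 * s.
have K0 : 0 <= K by rewrite addr_ge0// mulr_ge0// sqr_ge0.
(* For this [M], the constant of [sqnorm_Q_far] times [d ^+ 2] is at most 1/2. *)
pose M := 1 + `|h2| + 4 * K.
have M1 : 1 <= M by rewrite /M; have := normr_ge0 h2; lra.
have h2M : `|h2| <= M by rewrite /M; lra.
have KM : 4 * K <= M by rewrite /M; have := normr_ge0 h2; lra.
pose m := pdf_inf (`|h1| + `|h2|) M.
have m0 : 0 < m by exact: pdf_inf_gt0.
pose J := \int[nu]_x (\1_(`[h1, h2[%classic : set R) x : R).
have J0 : 0 < J by exact: nu_itv_gt0.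
have half_gt0 : 0 < 1 / 2 :> R by rewrite divr_gt0.
pose c1 := (d%:R * m) ^+ 2 * J.
have c10 : 0 < c1 by rewrite mulr_gt0// exprn_gt0// mulr_gt0.
pose c2 := 3 * (d%:R * normal_peak (noise_scale * sigma)) ^+ 2.
have c20 : 0 <= c2 by rewrite mulr_ge0// sqr_ge0.
have tau : d%:R ^+ 2 * (d%:R ^- 4 + (s / d%:R ^+ 2 + s) / M ^+ 2) <= 1 / 2.
  have -> : d%:R ^+ 2 * (d%:R ^- 4 + (s / d%:R ^+ 2 + s) / M ^+ 2) =
      d%:R ^- 2 + K / M ^+ 2.
    by rewrite /K; field; rewrite !gt_eqF//; exact: lt_le_trans M1.
  have a1 : d%:R ^- 2 <= 1 / 4 :> R.
    rewrite div1r lef_pV2 ?posrE ?exprn_gt0//; nra.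
  have a2 : K / M ^+ 2 <= 1 / 4.
    rewrite ler_pdivrMr; last by rewrite exprn_gt0// (lt_le_trans _ M1).
    by nra.
  lra.
exists ((c2 + 3 / 4 * c1) / (c1 + c2)).
  have c1c2 : 0 < c1 + c2 by rewrite ltr_pwDl.
  apply/andP; split.
    apply: divr_ge0; last exact: ltW.
    by apply: addr_ge0 => //; apply: mulr_ge0; [lra|exact: ltW].
  rewrite ltr_pdivrMr// mul1r addrC ltrD2r.
  by move: c1 c10 {c1c2} => c1 c10; lra.
move=> f bf f0.
pose F := pih h2 f.
have bF : bm F by exact: bm_pih.
have F0 x : 0 <= F x by exact: pih_ge0.
pose F1 x := if x <= M then F x else 0.
pose F2 x := if x <= M then 0 else F x.
have F1E : F1 = (fun x => \1_(`]-oo, M]%classic : set R) x * F x).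
  apply/funext => x; rewrite /F1 indicE; case: ifPn => xM.
    by rewrite mem_set ?mul1r//= in_itv.
  by rewrite memNset ?mul0r//= in_itv/=; apply/negP.
have bF1 : bm F1 by rewrite F1E; apply: bmM => //; exact: bm_indic.
have F12 x : F x = F2 x + F1 x by rewrite /F1 /F2; case: ifP; rewrite ?add0r ?addr0.
have F2E : F2 = (fun x => F x - F1 x) by apply/funext => x; rewrite F12 addrK.
have bF2 : bm F2 by rewrite F2E; exact: bmB.
have F10 x : 0 <= F1 x by rewrite /F1; case: ifP.
have F1M x : ~~ (- M <= x <= M) -> F1 x = 0.
  move=> nb; rewrite /F1; have [xM|//] := boolP (x <= M).
  rewrite /F pihE; have [h2x|//] := boolP (h2 <= x).
  exfalso; move/negP : nb; apply; rewrite xM andbT (le_trans _ h2x)// lerNl.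
  by rewrite (le_trans _ h2M)// -normrN ler_norm.
pose I := \int[mu]_x F1 x.
have I0 : 0 <= I by apply: Rintegral_ge0 => x _.
have QF1_le x : Q F1 x <= Q F x.
  by apply: le_Q => // y; rewrite F12 lerDr /F2; case: ifP.
(* The loss on [[h1, h2)], where [Q F] is at least [m * I]. *)
have E1 : sqnorm (opLh d h2 f) + c1 * I ^+ 2 <= sqnorm f.
  apply: (@le_trans _ _ (sqnorm F)); last exact: sqnorm_pih.
  apply: (le_trans _ (contr F bF F0)).
  have pF : pih h1 F = F.
    apply/funext => x; rewrite pihE; case: ifPn => // h1x; rewrite /F pihE.
    by case: ifPn => // h2x; case/negP : h1x; rewrite (le_trans (ltW h12)).
  rewrite /c1 /J -mulrA [J * _]mulrC mulrA -exprMn /sqnorm -Elin; last 2 first.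
  - by apply: bm_sqr; exact: bm_opLh.
  - exact: bm_indic.
  apply: le_E.
  - apply: bmD; [by apply: bm_sqr; exact: bm_opLh|by apply: bmZ; exact: bm_indic].
  - by apply: bm_sqr; exact: bm_opLh.
  - move=> a; rewrite !opLhE pF -/F indicE.
    have [h2a|ah2] := leP h2 a.
      rewrite (le_trans (ltW h12) h2a) memNset ?mulr0 ?addr0//= in_itv/=.
      by rewrite [a < _]ltNge h2a andbF.
    rewrite expr0n add0r; have [h1a|ah1] := leP h1 a; last first.
      by rewrite memNset ?mulr0 ?expr0n//= in_itv/= leNgt ah1.
    rewrite mem_set ?mulr1; last by rewrite /= in_itv/= h1a ah2.
    have u0 : 0 <= d%:R * m * I.
      by apply: mulr_ge0 => //; apply: mulr_ge0; exact: ltW.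
    have aA : `|a| <= `|h1| + `|h2| by exact: norm_between (ltW ah2).
    have uQ : d%:R * m * I <= d%:R * Q F a.
      rewrite -mulrA; apply: ler_wpM2l; first exact: ltW.
      exact: le_trans (Q_compact_lb bF1 F10 F1M aA) (QF1_le a).
    by rewrite lerXn2r// nnegrE (le_trans u0 uQ).
(* The part [F2] contracts; the part [F1] is bounded in terms of [I]. *)
have E2 : sqnorm (opLh d h2 f) <= 3 / 4 * sqnorm f + c2 * I ^+ 2.
  pose G1 a := d%:R * Q F1 a; pose G2 a := d%:R * Q F2 a.
  have bG1 : bm G1 by apply: bmZ; exact: bm_Q.
  have bG2 : bm G2 by apply: bmZ; exact: bm_Q.
  apply: (@le_trans _ _ (sqnorm (fun a => G2 a + G1 a))).
    apply: le_sqnorm; [exact: bm_opLh|exact: bmD|move=> a].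
    rewrite opLhE; case: ifP => _; last by rewrite expr0n sqr_ge0.
    rewrite /G1 /G2 -mulrDr -/F (_ : F = fun x => F2 x + 1 * F1 x).
      by rewrite Qlin// mul1r.
    by apply/funext => x; rewrite mul1r.
  apply: le_trans (sqnormD_le half_gt0 bG2 bG1) _.
  have n2 : sqnorm G2 <= 1 / 2 * sqnorm f.
    rewrite sqnormZ; last exact: bm_Q.
    have M0 : 0 < M by exact: lt_le_trans M1.
    have F2M x : x <= M -> F2 x = 0 by rewrite /F2 => ->.
    have h := sqnorm_Q_far M0 bF2 F2M.
    apply: (le_trans (ler_wpM2l (sqr_ge0 _) h)); rewrite mulrA.
    apply: (le_trans (ler_wpM2r (sqnorm_ge0 _) tau)).
    rewrite ler_wpM2l// (le_trans _ (sqnorm_pih h2 bf))//.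
    apply: le_sqnorm => // x; rewrite /F2 -/F; case: ifP => // _.
    by rewrite expr0n sqr_ge0.
  have n1 : sqnorm G1 <= (d%:R * normal_peak (noise_scale * sigma)) ^+ 2 * I ^+ 2.
    rewrite -exprMn -[leRHS](Ecst nu); apply: le_E; [exact: bm_sqr|exact: bm_cst|].
    move=> a; have u0 : 0 <= G1 a by apply: mulr_ge0; [exact: ltW|exact: Q_ge0].
    have uQ : G1 a <= d%:R * normal_peak (noise_scale * sigma) * I.
      rewrite -mulrA; apply: ler_wpM2l; first exact: ltW.
      exact: (Q_compact_ub _ bF1 F10 F1M).
    by rewrite lerXn2r// nnegrE (le_trans u0 uQ).
  by apply: (le_trans (combine_far_near n2 n1)); rewrite /c2 mulrA.
exact: combine_losses c10 c20 E1 E2.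
Qed.

End StrictMonotonicity.

(** * A bounded strict subeigenfunction *)

Section Subeigenfunction.
Variables (R : realType) (d : nat).
Hypothesis d2 : (2 <= d)%N.
Notation nu := (@nu R d).
Notation mu := (@lebesgue_measure R).
Local Notation sigma := (@sigma R d).
Local Notation noise_scale := (@noise_scale R d).
Local Notation Q := (@mehler R d).
Local Notation sqnorm := (@sqnorm R d).
Local Notation bm := (@bounded_measurable R _ (measurableTypeR R)).
Implicit Types f g : R -> R.
Variable h : R.
Local Notation L := (opLh d h).

Let dp : (0 : R) < d%:R := d_gt0 R d2.

Lemma pih_id f : pih h (pih h f) = pih h f.
Proof. by apply/funext => x; rewrite !pihE; case: (h <= x). Qed.

Lemma opLh_pih f : L (pih h f) = L f.
Proof. by apply/funext => x; rewrite /opLh pih_id. Qed.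

Lemma opLh_lin f g k : bm f -> bm g ->
  L (fun x => f x + k * g x) = (fun x => L f x + k * L g x).
Proof.
move=> bf bg; apply/funext => x; rewrite !opLhE; case: ifP => _; last first.
  by rewrite mulr0 addr0.
rewrite (_ : pih h _ = fun x => pih h f x + k * pih h g x).
  by rewrite Qlin; [ring|exact: bm_pih|exact: bm_pih].
by apply/funext => y; rewrite /pih; ring.
Qed.

Lemma opLh_sym f g : bm f -> bm g ->
  \int[nu]_x (g x * L f x) = \int[nu]_x (f x * L g x).
Proof.
move=> bf bg.
have e (u w : R -> R) : bm u -> bm w -> \int[nu]_x (u x * L w x) =
    d%:R * \int[nu]_x (pih h u x * Q (pih h w) x).
  move=> bu bw; rewrite -EZ.
    by apply: eq_Rintegral => x _; rewrite /opLh {1}/pih opLE /pih; ring.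
  by apply: bmM; [exact: bm_pih|apply: bm_Q; exact: bm_pih].
by rewrite (e _ _ bg bf) (e _ _ bf bg) (Q_sym d2 (bm_pih h bf) (bm_pih h bg)).
Qed.

Let bm_iter k f : bm f -> bm (iter k L f).
Proof. by move=> bf; elim: k => //= k IH; exact: bm_opLh. Qed.

Let iter_ge0 k f : (forall x, 0 <= f x) -> forall x, 0 <= iter k L f x.
Proof. by move=> f0; elim: k => //= k IH; exact: opLh_ge0. Qed.

Lemma E_iter f k : bm f ->
  \int[nu]_x (f x * iter (k + k) L f x) = sqnorm (iter k L f).
Proof.
move=> bf.
have step i j : \int[nu]_x (iter i L f x * iter (j + i) L f x) =
    \int[nu]_x (f x * iter (j + (i + i)) L f x).
  elim: i j => [|i IH] j; first by rewrite !addn0.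
  transitivity (\int[nu]_x (iter (j + i.+1) L f x * L (iter i L f) x)).
    by apply: eq_Rintegral => x _; rewrite mulrC.
  rewrite opLh_sym; [|exact: bm_iter|exact: bm_iter].
  transitivity (\int[nu]_x (iter i L f x * iter (j.+2 + i) L f x)).
    by apply: eq_Rintegral => x _; rewrite -iterS addnS.
  rewrite IH (_ : (j.+2 + (i + i) = j + (i.+1 + i.+1))%N)//.
  by rewrite !addSn !addnS.
rewrite -(step k 0%N) add0n /sqnorm.
by apply: eq_Rintegral => x _; rewrite expr2.
Qed.

Lemma E_CauchySchwarz f g : bm f -> bm g ->
  (\int[nu]_x (f x * g x)) ^+ 2 <= sqnorm f * sqnorm g.
Proof.
move=> bf bg; apply: Rintegral_CauchySchwarz.
- exact: (bm_integrable nu (bmX 2 bf)).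
- exact: (bm_integrable nu (bmX 2 bg)).
- exact: (bm_integrable nu (bmM bf bg)).
Qed.

(** Self-adjointness and the Cauchy-Schwarz inequality. *)
Lemma sqnorm_iter_logconvex f k : bm f ->
  sqnorm (iter k.+1 L f) ^+ 2 <= sqnorm (iter k L f) * sqnorm (iter k.+2 L f).
Proof.
move=> bf; have -> : sqnorm (iter k.+1 L f) =
    \int[nu]_x (iter k L f x * iter k.+2 L f x).
  rewrite [iter k.+2 _ _]iterS opLh_sym; [|exact: bm_iter|exact: bm_iter].
  by apply: eq_Rintegral => x _; rewrite -iterS expr2.
by apply: E_CauchySchwarz; exact: bm_iter.
Qed.

(** The successive ratios of a log-convex sequence do not decrease. *)
Lemma logconvex_growth (a : nat -> R) : (forall k, 0 <= a k) ->
    (forall k, a k.+1 ^+ 2 <= a k * a k.+2) -> a 0%N < a 1%N ->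
  0 < a 0%N /\ exists2 r, 1 < r & forall k, r ^+ k * a 0%N <= a k.
Proof.
move=> a_ge0 lc a01.
have a1 : 0 < a 1%N by exact: le_lt_trans a01.
have a0 : 0 < a 0%N.
  rewrite lt_neqAle a_ge0 andbT eq_sym; apply/eqP => a00.
  by have := lc 0%N; rewrite a00 mul0r leNgt exprn_gt0.
split => //; pose r := a 1%N / a 0%N.
have r1 : 1 < r by rewrite ltr_pdivlMr// mul1r.
have r0 : 0 < r by exact: lt_trans r1.
exists r => // k; suff : 0 < a k /\ r * a k <= a k.+1 /\ r ^+ k * a 0%N <= a k by case=> _ [].
elim: k => [|k [ak [rk IH]]].
  by split=> //; split; rewrite ?expr0 ?mul1r// /r divfK// gt_eqF.
have ak1 : 0 < a k.+1 by rewrite (lt_le_trans _ rk)// mulr_gt0.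
split => //; split; last first.
  by rewrite exprS -mulrA (le_trans _ rk)// ler_wpM2l// ltW.
rewrite -(ler_pM2l ak); apply: le_trans (lc k).
by rewrite mulrA [a k * r]mulrC expr2 ler_wpM2r// ltW.
Qed.

Lemma sqnorm_iter_growth f : bm f -> sqnorm f < sqnorm (L f) ->
  0 < sqnorm f /\ exists2 r, 1 < r & forall k, r ^+ k * sqnorm f <= sqnorm (iter k L f).
Proof.
move=> bf fL; apply: (@logconvex_growth (fun k => sqnorm (iter k L f))) => [k|k|].
- exact: sqnorm_ge0.
- exact: sqnorm_iter_logconvex.
- exact: fL.
Qed.

Section Compact.
Variables (F : R -> R) (B N : R).
Hypotheses (bF : bm F) (F0 : forall x, 0 <= F x) (FN : forall x, F x <= N).
Hypotheses (FB : forall x, ~~ (- B <= x <= B) -> F x = 0) (Fh : forall x, x < h -> F x = 0).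
Hypothesis (N0 : 0 < N).

Let C := d%:R * (pdf_inf d B B / (N * normal_peak sigma)).

Let peak0 : 0 < normal_peak sigma. Proof. by rewrite normal_peak_gt0// gt_eqF// sigma_gt0. Qed.

Let compact_lb_algebra (p k I q N' c : R) :
  0 <= k -> p * I <= c -> c <= N' * q -> p * (k * I) <= q * (N' * k).
Proof.
move=> k0 pI cq; rewrite (_ : p * (k * I) = k * (p * I)); last by ring.
rewrite (_ : q * (N' * k) = k * (N' * q)); last by ring.
by apply: ler_wpM2l => //; exact: le_trans pI cq.
Qed.

(** Positivity improvement: after one step the [nu]-mass against [F] is spread
    uniformly over the compact range of interest. *)
Lemma opLh_compact_lb g a : bm g -> (forall x, 0 <= g x) -> h <= a -> `|a| <= B ->
  C * \int[nu]_x (F x * g x) <= L g a.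
Proof.
move=> bg g0 ha aB; rewrite opLhE ha /C -mulrA ler_wpM2l ?(ltW dp)//.
pose G x := F x * g x.
have bG : bm G by exact: bmM.
have G0 x : 0 <= G x by exact: mulr_ge0.
have GB x : ~~ (- B <= x <= B) -> G x = 0 by move=> xB; rewrite /G FB// mul0r.
have iG := integrable_compact bG GB.
have h1 := Q_compact_lb d2 bG G0 GB aB.
have h2 : Q G a <= N * Q (pih h g) a.
  rewrite -QZ; last exact: bm_pih.
  apply: le_Q => //; first by apply: bmZ; exact: bm_pih.
  move=> x; rewrite /G pihE; case: (leP h x) => hx; first by rewrite ler_wpM2r.
  by rewrite Fh// mul0r mulr0.
have h3 : \int[nu]_x G x <= normal_peak sigma * \int[mu]_x G x.
  rewrite (integral_normal_pdfM 0 sigma bG) -RintegralZl//; apply: le_Rintegral => //.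
  - apply: (integrableR_le _ _ (integrableR_Z (normal_peak sigma) iG)).
      by apply: measurable_funM; [exact: bG.1|exact: measurable_normal_pdf].
    move=> x; rewrite normrM !ger0_norm ?normal_pdf_ge0// mulrC ler_wpM2r//.
    by apply: normal_pdf_ub; rewrite gt_eqF// sigma_gt0.
  - exact: integrableR_Z.
  - by move=> x _; rewrite mulrC ler_wpM2r// normal_pdf_ub// gt_eqF// sigma_gt0.
rewrite mulrAC ler_pdivrMr; last exact: mulr_gt0.
have p0 : 0 < pdf_inf d B B := pdf_inf_gt0 d2 B B.
apply: (le_trans (ler_wpM2l (ltW p0) h3)).
exact: (compact_lb_algebra (ltW peak0) h1 h2).
Qed.

(** The witness is [v = \sum_(j <= n) t ^+ j * L^j F], for which [t * L v - v]
    telescopes to [t ^+ n.+1 * L^n.+1 F - F]. On the support of [F],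
    [opLh_compact_lb] bounds [L^n.+1 F] from below by a multiple of
    [<F, L^n F> = sqnorm (L^k F)] with [n = 2 k], which grows like [r ^+ k]. *)
Lemma subeigenfunction_compact : sqnorm F < sqnorm (L F) ->
  exists v t, [/\ bm v, forall x, 0 <= v x, 0 < t < 1, 0 < \int[nu]_x v x &
    forall x, v x <= t * L v x].
Proof.
move=> /(sqnorm_iter_growth bF)[n0 [r r1 gr]].
have r0 : 0 < r by exact: lt_trans r1.
(* Any [t < 1] with [t ^+ 2 * r > 1] would do. *)
pose x0 := (1 - r^-1) / 4.
have rV : r^-1 < 1 by rewrite invf_lt1.
have rV0 : 0 < r^-1 by rewrite invr_gt0.
pose t := 1 - x0.
have t01 : 0 < t < 1 by rewrite /t /x0; apply/andP; split; lra.
have [t0 t1] := andP t01.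
have tr : 1 < t ^+ 2 * r.
  rewrite -ltr_pdivrMr// div1r /t; have : r^-1 < 1 - 2 * x0 by rewrite /x0; lra.
  by move=> /lt_le_trans; apply; have := sqr_ge0 x0; lra.
have C0 : 0 < C.
  by rewrite mulr_gt0// divr_gt0 ?pdf_inf_gt0// mulr_gt0.
have K0 : 0 < t * C * sqnorm F by exact: mulr_gt0 (mulr_gt0 t0 C0) n0.
have [k Nk] : exists k, N <= t * C * sqnorm F * (t ^+ 2 * r) ^+ k.
  have y0 : 0 < t ^+ 2 * r - 1 by rewrite subr_gt0.
  pose y := N / (t * C * sqnorm F) / (t ^+ 2 * r - 1).
  exists (Num.bound y).
  rewrite mulrC -ler_pdivrMr//.
  apply: le_trans (_ : 1 + (Num.bound y)%:R * (t ^+ 2 * r - 1) <= _).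
    rewrite -[leLHS](@divfK _ (t ^+ 2 * r - 1)) ?gt_eqF// -/y.
    apply: (@le_trans _ _ ((Num.bound y)%:R * (t ^+ 2 * r - 1))); last by rewrite lerDr.
    rewrite ler_wpM2r ?(ltW y0)//.
    have y_ge0 : 0 <= y by rewrite /y !divr_ge0// ltW.
    exact/ltW/(archi_boundP y_ge0).
  have := @bernoulli_ge R (t ^+ 2 * r - 1) (Num.bound y).
  by rewrite (_ : 1 + (t ^+ 2 * r - 1) = t ^+ 2 * r); [apply; lra|ring].
pose n := (k + k)%N.
have pt a : F a <= t ^+ n.+1 * iter n.+1 L F a.
  have [aB|/FB ->] := boolP (- B <= a <= B); last first.
    by rewrite mulr_ge0 ?exprn_ge0 ?(ltW t0)//; exact: iter_ge0.
  have [ha|/Fh ->] := leP h a; last first.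
    by rewrite mulr_ge0 ?exprn_ge0 ?(ltW t0)//; exact: iter_ge0.
  apply: (le_trans (FN a)); apply: (le_trans Nk).
  have aB' : `|a| <= B by rewrite ler_norml.
  have := opLh_compact_lb (bm_iter n bF) (iter_ge0 n F0) ha aB'.
  rewrite E_iter// -iterS => lb.
  have lb' := le_trans (ler_wpM2l (ltW C0) (gr k)) lb.
  apply: le_trans (ler_wpM2l (exprn_ge0 n.+1 (ltW t0)) lb').
  rewrite le_eqVlt; apply/orP; left; apply/eqP.
  rewrite (_ : t ^+ n.+1 = t * (t ^+ 2) ^+ k); last by rewrite -exprM mul2n exprS /n addnn.
  by rewrite exprMn; ring.
pose v m x := \sum_(j < m) t ^+ j * iter j L F x.
have bv m : bm (v m).
  by apply: bm_sum => j; apply: bmZ; exact: bm_iter.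
have Lv m : (fun x => t * L (v m) x) = fun x => \sum_(j < m) t ^+ j.+1 * iter j.+1 L F x.
  elim: m => [|m IH].
    apply/funext => x; rewrite big_ord0 (_ : v 0%N = fun=> 0).
      rewrite opLhE; case: ifP => _; rewrite ?mulr0// (_ : pih h _ = fun=> 0) ?Qcst ?mulr0//.
      by apply/funext => y; rewrite /pih mulr0.
    by apply/funext => y; rewrite /v big_ord0.
  have -> : v m.+1 = fun x => v m x + t ^+ m * iter m L F x.
    by apply/funext => x; rewrite /v big_ord_recr.
  rewrite opLh_lin; [|exact: bv|exact: bm_iter].
  apply/funext => x; rewrite big_ord_recr /= -(congr1 (fun f => f x) IH) /= exprS; ring.
exists (v n.+1), t; split => //.
- by move=> x; apply: sumr_ge0 => j _; rewrite mulr_ge0 ?exprn_ge0 ?(ltW t0)//; exact: iter_ge0.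
- apply: (@lt_le_trans _ _ (N^-1 * sqnorm F)); first by rewrite mulr_gt0// invr_gt0.
  rewrite /sqnorm -EZ; last exact: bm_sqr.
  apply: le_E => //; first by apply: bmZ; exact: bm_sqr.
  move=> x; apply: (@le_trans _ _ (F x)).
    by rewrite mulrC ler_pdivrMr// expr2 ler_wpM2l.
  rewrite /v big_ord_recl expr0 mul1r /= lerDl; apply: sumr_ge0 => j _.
  by rewrite mulr_ge0 ?exprn_ge0 ?(ltW t0)//; exact: (@iter_ge0 (bump 0 j)).
- move=> x; rewrite [leRHS](congr1 (fun f => f x) (Lv n.+1)).
  rewrite /v big_ord_recl [leRHS]big_ord_recr /= expr0 mul1r [leRHS]addrC.
  by apply: lerD => //; exact: pt.
Qed.

End Compact.

(** Cutting [f] off outside [[h, n]] preserves the strict inequality for large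
    [n], by bounded convergence. *)
Theorem subeigenfunction f : bm f -> (forall x, 0 <= f x) -> sqnorm f < sqnorm (L f) ->
  exists v t, [/\ bm v, forall x, 0 <= v x, 0 < t < 1, 0 < \int[nu]_x v x &
    forall x, v x <= t * L v x].
Proof.
move=> bf f0 fL; have [N fN] := bf.2.
pose g (n : nat) x := \1_(`]-oo, n%:R]%classic : set R) x * f x.
have bg n : bm (g n) by apply: bmM => //; exact: bm_indic.
have gE n x : g n x = if x <= n%:R then f x else 0.
  rewrite /g indicE; case: ifPn => xn; first by rewrite mem_set ?mul1r//= in_itv.
  by rewrite memNset ?mul0r//= in_itv/=; apply/negP.
have gN n x : `|g n x| <= N.
  by rewrite gE; case: ifP => // _; rewrite normr0 (le_trans _ (fN x)).
have gf x : g n x @[n --> \oo] --> f x.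
  apply: cvg_near_cst; near=> n; rewrite gE ifT//.
  by apply: ltW; near: n; exact: nbhs_infty_gtr.
have Lg x : L (g n) x @[n --> \oo] --> L f x.
  rewrite opLhE; under eq_fun do rewrite opLhE; case: ifP => hx; last exact: cvg_cst.
  apply: cvgMl_tmp; apply: (Q_cvg (M := N)).
  - by move=> n; exact: bm_pih.
  - exact: bm_pih.
  - by move=> n y; rewrite pihE; case: ifP => // _; rewrite normr0 (le_trans _ (fN y)).
  - move=> y; rewrite pihE; under eq_fun do rewrite pihE.
    by case: ifP => _; [exact: gf|exact: cvg_cst].
have LgN n x : `|L (g n) x| <= d%:R * N.
  have N0 : 0 <= N by exact: le_trans (fN 0).
  rewrite opLhE; case: ifP => _; last by rewrite normr0 mulr_ge0// ltW.
  rewrite normrM (gtr0_norm dp) ler_wpM2l ?(ltW dp)// Q_bound//; first exact: bm_pih.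
  by move=> y; rewrite pihE; case: ifP => // _; rewrite normr0.
have cv : sqnorm (L (g n)) @[n --> \oo] --> sqnorm (L f).
  apply: (E_cvg (M := (d%:R * N) ^+ 2)).
  - by move=> n; case: (bm_sqr (bm_opLh d h (bg n))).
  - by case: (bm_sqr (bm_opLh d h bf)).
  - move=> n x; rewrite normrX lerXn2r ?nnegrE//.
    exact: le_trans (LgN n x).
  - by move=> x; rewrite expr2; under eq_fun do rewrite expr2; apply: cvgM; exact: Lg.
have [n hn] : exists n, sqnorm f < sqnorm (L (g n)).
  near \oo => n; exists n; near: n; exact: (cvgr_gt _ cv).
pose B := n%:R + `|h|.
apply: (@subeigenfunction_compact (pih h (g n)) B (N + 1)).
- exact: bm_pih.
- by apply: pih_ge0 => x; rewrite gE; case: ifP.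
- move=> x; rewrite (le_trans (ler_norm _))// (@le_trans _ _ N)//; last by rewrite lerDl.
  by rewrite pihE; case: ifP => // _; rewrite normr0 (le_trans _ (fN x)).
- move=> x; rewrite pihE gE; case: (leP h x) => // hx; case: (leP x n%:R) => // xn /negP; case.
  have := ler_norm h; have := ler_norm (- h); rewrite normrN => h1 h3.
  have h4 : (0 : R) <= n%:R by [].
  rewrite /B; move: h1 h3 h4 hx xn; move: `|h| (n%:R : R) => a b; clear=> h1 h3 h4 hx xn.
  by apply/andP; split; lra.
- by move=> x hx; rewrite pihE leNgt hx.
- by rewrite (@le_lt_trans _ _ N)// ?ltrDl// (le_trans _ (fN 0)).
- rewrite opLh_pih; apply: le_lt_trans hn.
  apply: (le_trans (sqnorm_pih d h (bg n))); apply: le_sqnorm => // x.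
  by rewrite gE; case: ifP => // _; rewrite expr0n sqr_ge0.
Unshelve. all: by end_near. Qed.

End Subeigenfunction.

(** * The operator norm at the critical level *)

Section OperatorNorm.
Variables (R : realType) (d : nat).
Hypothesis d2 : (2 <= d)%N.
Notation nu := (@nu R d).
Local Notation noise_scale := (@noise_scale R d).
Local Notation Q := (@mehler R d).
Local Notation sqnorm := (@sqnorm R d).
Local Notation bm := (@bounded_measurable R _ (measurableTypeR R)).
Implicit Types f g : R -> R.

(** The integral of a nonnegative function is a supremum over the simple
    functions below it, whether or not the function is measurable. *)
Lemma le_integral_ge0 (f1 f2 : R -> \bar R) :
  (forall x, 0 <= f1 x)%E -> (forall x, f1 x <= f2 x)%E ->
  (\int[nu]_x f1 x <= \int[nu]_x f2 x)%E.
Proof.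
move=> f10 f12; have f20 x : (0 <= f2 x)%E by exact: le_trans (f12 x).
rewrite !ge0_integralTE//; apply: le_ereal_sup => _ [g gf <-]; exists g => // x.
exact: le_trans (gf x) (f12 x).
Qed.

Lemma Lnorm2_sqr f :
  ('N[nu]_2%:E[EFin \o f] `^ 2)%E = (\int[nu]_x ((f x ^+ 2)%:E))%E.
Proof.
rewrite powR_Lnorm; last by rewrite pnatr_eq0.
apply: eq_integral => x _ /=.
by rewrite powR_mulrn// real_normK// num_real.
Qed.

Lemma Lnorm2_le f (c : R) : 0 <= c ->
  ('N[nu]_2%:E[EFin \o f] <= c%:E)%E <-> (\int[nu]_x ((f x ^+ 2)%:E) <= (c ^+ 2)%:E)%E.
Proof.
move=> c0; have c2 : (c ^+ 2)%:E = (c%:E `^ 2)%E by rewrite poweR_EFin powR_mulrn.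
split=> h.
  rewrite -Lnorm2_sqr c2; apply: gt0_ler_poweR => //.
  - by rewrite in_itv/= Lnorm_ge0 leey.
  - by rewrite in_itv/= lee_fin c0 leey.
have half0 : (0 : R) <= 2^-1 by rewrite invr_ge0.
have r1 (x : \bar R) : (0 <= x -> (x `^ 2) `^ 2^-1 = x)%E.
  by move=> x0; rewrite -poweRrM mulfV ?poweRe1.
rewrite -(r1 _ (Lnorm_ge0 _ _ _)) -(r1 c%:E)//; apply: gt0_ler_poweR => //.
- by rewrite in_itv/= ?poweR_ge0 leey.
- by rewrite in_itv/= ?lee_fin ?powR_ge0 ?poweR_ge0 leey.
- by rewrite Lnorm2_sqr -c2.
Qed.

Lemma sqnorm_Lnorm2_le f (c : R) : bm f -> 0 <= c ->
  ('N[nu]_2%:E[EFin \o f] <= c%:E)%E <-> sqnorm f <= c ^+ 2.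
Proof.
move=> bf c0; rewrite Lnorm2_le//.
by rewrite -(EFinE nu (bm_sqr bf)) lee_fin.
Qed.

Lemma contraction_of_lambda_le1 h : (lambda d h <= 1%:E :> \bar R)%E ->
  forall f, bm f -> sqnorm (opLh d h f) <= sqnorm f.
Proof.
move=> lam f bf; apply/ler_addgt0Pr => e e0.
have S0 := sqnorm_ge0 d f.
(* The term [e] keeps [c] positive when [f] vanishes almost everywhere. *)
pose c := Num.sqrt (sqnorm f + e).
have c0 : 0 < c by rewrite sqrtr_gt0 ltr_wpDl.
have cE : c ^+ 2 = sqnorm f + e by rewrite sqr_sqrtr// addr_ge0// ltW.
pose g x := c^-1 * f x.
have bg : bm g by exact: bmZ.
have sg1 : sqnorm g <= 1 ^+ 2.
  rewrite sqnormZ// exprVn expr1n mulrC ler_pdivrMr ?exprn_gt0// mul1r cE lerDl.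
  exact: ltW.
have g1 : ('N[nu]_2%:E[EFin \o g] <= 1%:E)%E by apply/sqnorm_Lnorm2_le.
have : ('N[nu]_2%:E[EFin \o opLh d h g] <= 1%:E)%E.
  apply: le_trans lam; apply: ereal_sup_ubound; exists g => //; split => //.
  apply/andP; split; first by rewrite inE; exact: bg.1.
  by rewrite inE /= /finite_norm (le_lt_trans g1)// ltry.
move/(sqnorm_Lnorm2_le (bm_opLh d h bg) ler01).
have -> : opLh d h g = fun x => c^-1 * opLh d h f x.
  apply/funext => x; rewrite !opLhE; case: ifP => _; last by rewrite mulr0.
  rewrite (_ : pih h g = fun y => c^-1 * pih h f y).
    by rewrite QZ; [ring|exact: bm_pih].
  by apply/funext => y; rewrite /pih /g; ring.
rewrite sqnormZ; last exact: bm_opLh.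
by rewrite exprVn expr1n mulrC ler_pdivrMr ?exprn_gt0// mul1r cE.
Qed.

Let maff (a : R) : measurable_fun setT (fun y : R => a / d%:R + noise_scale * y).
Proof. by apply: measurable_funD => //; exact: measurable_funM. Qed.

(** When the integral of [f] is infinite, the left-hand side is 0 by the
    convention on [fine]. *)
Lemma Q_abs_le f a : measurable_fun setT f ->
  (`|Q f a|%:E <= \int[nu]_y (`|f (a / d%:R + noise_scale * y)|)%:E)%E.
Proof.
move=> mf; pose F y := (f (a / d%:R + noise_scale * y))%:E.
have mF : measurable_fun setT F.
  by apply/measurable_EFinP; exact: (measurableT_comp mf (maff a)).
apply: le_trans (le_abse_integral nu measurableT mF).
rewrite /mehler /Rintegral -/F.
by case: (\int[nu]_x F x)%E => [r| |] //=; rewrite normr0 leey.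
Qed.

Lemma Q_abs_approx f a b : measurable_fun setT f -> b < `|Q f a| ->
  exists n : nat, b < Q (fun x => Num.min `|f x| n%:R) a.
Proof.
move=> mf bQ.
pose g (n : nat) (x : R) := Num.min `|f x| n%:R.
have mg n : measurable_fun setT (g n).
  by apply: measurable_minr => //; exact: measurableT_comp.
have g0 n x : 0 <= g n x by rewrite le_min normr_ge0 ler0n.
have bg n : bm (g n).
  split; [exact: mg|exists n%:R => x]; rewrite ger0_norm// /g ge_min.
  by rewrite lexx orbT.
have gf x : g n x @[n --> \oo] --> `|f x|.
  apply: cvg_near_cst; near=> n; rewrite /g; apply/min_idPl/ltW.
  by near: n; exact: nbhs_infty_gtr.
have gE n : (Q (g n) a)%:E = (\int[nu]_y (g n (a / d%:R + noise_scale * y))%:E)%E.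
  by rewrite (EFinE nu (bmQ_in d a (bg n))).
have cv : (Q (g n) a)%:E @[n --> \oo] -->
    (\int[nu]_y (`|f (a / d%:R + noise_scale * y)|)%:E)%E.
  under eq_fun do rewrite gE.
  pose G n y := (g n (a / d%:R + noise_scale * y))%:E.
  have limG y : limn (G^~ y) = (`|f (a / d%:R + noise_scale * y)|)%:E.
    by apply/cvg_lim => //; apply: cvg_EFin; [exact: nearW|exact: gf].
  have <- : (\int[nu]_z limn (G^~ z) = \int[nu]_y (`|f (a / d%:R + noise_scale * y)|)%:E)%E.
    by apply: eq_integral => z _; rewrite limG.
  apply: cvg_monotone_convergence => //.
  - by move=> n; apply/measurable_EFinP; exact: (measurableT_comp (mg n) (maff a)).
  - by move=> n y _; rewrite lee_fin.
  - move=> y _ m n mn; rewrite lee_fin /g le_min ge_min lexx/= ge_min.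
    by rewrite ler_nat mn orbT.
have bI : (b%:E < \int[nu]_y (`|f (a / d%:R + noise_scale * y)|)%:E)%E.
  by apply: lt_le_trans (Q_abs_le a mf); rewrite lte_fin.
apply: contrapT => nex; move: bI; rewrite -(cvg_lim _ cv)// ltNge => /negP; apply.
apply: lime_le; first by apply/cvg_ex; eexists; exact: cv.
apply: nearW => n; rewrite lee_fin leNgt; apply/negP => bn; apply: nex.
by exists n.
Unshelve. all: by end_near. Qed.

Let sqrt_lt (m c : R) : 0 <= m -> 0 <= c -> (Num.sqrt m < c) = (m < c ^+ 2).
Proof. by move=> m0 c0; rewrite -{2}(sqr_sqrtr m0) ltr_pXn2r// nnegrE sqrtr_ge0. Qed.

(** The supremum [lambda] ranges over unbounded functions; the bounded functions
    [Num.min `|f x| n%:R] approach the image of [`|f|] from below, the kernel of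
    [Q] being positive. *)
Lemma lambda_lt1 h k : 0 <= k < 1 ->
  (forall f, bm f -> (forall x, 0 <= f x) -> sqnorm (opLh d h f) <= k * sqnorm f) ->
  (lambda d h < 1%:E :> \bar R)%E.
Proof.
move=> /andP[k0 k1] contr.
apply: (@le_lt_trans _ _ (Num.sqrt k)%:E); last first.
  by rewrite lte_fin -sqrtr1 ltr_sqrt.
apply: ge_ereal_sup => _ [f [Lf f1] <-].
have mf : measurable_fun setT f by move: Lf => /andP[+ _]; rewrite inE.
have {f1} : ('N[nu]_2%:E[EFin \o f] <= 1%:E)%E := f1.
move=> /(Lnorm2_le _ ler01); rewrite expr1n => f1.
apply/Lnorm2_le; rewrite ?sqrtr_ge0// sqr_sqrtr//.
pose g (n : nat) (x : R) := Num.min `|f x| n%:R.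
have mg n : measurable_fun setT (g n).
  by apply: measurable_minr => //; exact: measurableT_comp.
have g0 n x : 0 <= g n x by rewrite le_min normr_ge0 ler0n.
have bg n : bm (g n).
  split; [exact: mg|exists n%:R => x]; rewrite ger0_norm// /g ge_min.
  by rewrite lexx orbT.
pose u n a := opLh d h (g n) a ^+ 2.
have u_mono a : {homo u^~ a : m n / (m <= n)%N >-> m <= n}.
  move=> m n mn; rewrite /u lerXn2r ?nnegrE ?opLh_ge0//.
  rewrite !opLhE; case: ifP => // _; rewrite ler_wpM2l//.
  apply: le_Q; try exact: bm_pih.
  move=> x; rewrite !pihE; case: ifP => // _.
  by rewrite /g le_min ge_min lexx/= ge_min ler_nat mn orbT.
apply: (@le_trans _ _ (\int[nu]_a limn (fun n => (u n a)%:E))%E).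
  apply: le_integral_ge0 => [x|a]; first by rewrite lee_fin sqr_ge0.
  have nd : {homo (fun n => (u n a)%:E) : m n / (m <= n)%N >-> (m <= n)%E}.
    by move=> m n mn; rewrite lee_fin u_mono.
  rewrite (cvg_lim _ (ereal_nondecreasing_cvgn nd))//.
  rewrite leNgt; apply/negP => sup_lt.
  have [m mE] : exists m : R, ereal_sup (range (fun n => (u n a)%:E)) = m%:E.
    case: (ereal_sup _) (@ereal_sup_ubound _ (range (fun n => (u n a)%:E)) (u 0%N a)%:E
      (ex_intro2 _ _ 0%N I erefl)) sup_lt => [m| |] //; by exists m.
  have um n : u n a <= m.
    by rewrite -lee_fin -mE; apply: ereal_sup_ubound; exists n.
  have m0 : 0 <= m by exact: le_trans (sqr_ge0 _) (um 0%N).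
  move: sup_lt; rewrite mE lte_fin opLhE.
  case: ifP => ha; last by rewrite expr0n/= ltNge m0.
  have dp := d_gt0 R d2.
  rewrite -real_normK ?num_real// normrM (gtr0_norm dp) => mlt.
  have : Num.sqrt m / d%:R < `|Q (pih h f) a|.
    by rewrite ltr_pdivrMr// mulrC sqrt_lt// mulr_ge0// ltW.
  have mpf : measurable_fun setT (pih h f).
    by apply: measurable_funM => //; exact: measurable_indic.
  move=> /(Q_abs_approx mpf)[n]; rewrite ltr_pdivrMr//.
  have -> : (fun x => Num.min `|pih h f x| n%:R) = pih h (g n).
    apply/funext => x; rewrite !pihE; case: ifP => // _.
    by rewrite normr0; apply/min_idPl; rewrite ler0n.
  move=> sm; have := um n; rewrite /u opLhE ha leNgt => /negP; apply.
  rewrite -sqrt_lt//; first by rewrite mulrC.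
  by rewrite mulr_ge0 ?(ltW dp)// Q_ge0// => x; exact: pih_ge0.
have cvu : (\int[nu]_a (u n a)%:E)%E @[n --> \oo] -->
    (\int[nu]_a limn (fun n => (u n a)%:E))%E.
  apply: cvg_monotone_convergence => //.
  - by move=> n; apply/measurable_EFinP; exact: (bm_sqr (bm_opLh d h (bg n))).1.
  - by move=> n a _; rewrite lee_fin sqr_ge0.
  - by move=> a _ m n mn; rewrite lee_fin u_mono.
rewrite -(cvg_lim _ cvu)//; apply: lime_le; first by apply/cvg_ex; eexists; exact: cvu.
apply: nearW => n; rewrite -(EFinE nu (bm_sqr (bm_opLh d h (bg n)))).
apply: (@le_trans _ _ (k * sqnorm (g n))%:E).
  by rewrite lee_fin; exact: contr.
rewrite -[leRHS]mule1 EFinM lee_wpmul2l ?lee_fin//.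
rewrite -lee_fin; apply: le_trans f1; rewrite (EFinE nu (bm_sqr (bg n))).
apply: le_integral_ge0 => x; rewrite lee_fin ?sqr_ge0//.
rewrite -[leRHS]real_normK ?num_real// lerXn2r ?nnegrE//.
by rewrite /g ge_min lexx.
Qed.

Lemma contraction_above hs h : lambda d hs = 1%E :> \bar R -> hs < h ->
  exists2 k, 0 <= k < 1 &
    forall f, bm f -> (forall x, 0 <= f x) -> sqnorm (opLh d h f) <= k * sqnorm f.
Proof.
move=> l1 hsh; apply: (strict_monotonicity d2 hsh) => f bf _.
by apply: contraction_of_lambda_le1 => //; rewrite l1.
Qed.

(** Otherwise [opLh d h] would not increase the norm, and strict monotonicity
    would make [lambda d hs] smaller than 1. *)
Lemma expansion_below hs h : lambda d hs = 1%E :> \bar R -> h < hs ->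
  exists f, [/\ bm f, forall x, 0 <= f x & sqnorm f < sqnorm (opLh d h f)].
Proof.
move=> l1 hhs; apply: contrapT => nex.
have [f bf f0|k k01 hk] := strict_monotonicity d2 hhs _.
  by rewrite leNgt; apply/negP => lt; apply: nex; exists f.
by have := lambda_lt1 k01 hk; rewrite l1 ltxx.
Qed.

End OperatorNorm.

(** * Recursion for the extinction probabilities *)

Section Recursion.
Variables (R : realType) (d : nat).
Hypothesis d2 : (2 <= d)%N.
Notation nu := (@nu R d).
Local Notation Q := (@mehler R d).
Local Notation sqnorm := (@sqnorm R d).
Local Notation bm := (@bounded_measurable R _ (measurableTypeR R)).
Local Notation mean := (@mean_functional R d).
Implicit Types f g : R -> R.
Variable h : R.

Let dp : (0 : R) < d%:R := d_gt0 R d2.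

(** With these levels a [functional] indicates that the exploration of
    [{phi >= h}] stops: at the vertex itself or in each of its offspring. *)
Definition extinction : (R -> R) * (R -> R) :=
  (fun x => (x < h)%R%:R, fun x => (h <= x)%R%:R).

(** A level that the exploration crosses whatever the field there. *)
Definition pass : (R -> R) * (R -> R) := (fun=> 0, fun=> 1).

Let bm_ge : bm (fun x => (h <= x)%R%:R).
Proof.
rewrite (_ : (fun _ => _) = \1_(`[h, +oo[%classic : set R)); first exact: bm_indic.
apply/funext => x; rewrite indicE; congr ((nat_of_bool _)%:R).
by rewrite mem_setE in_itv/= andbT.
Qed.

Let bm_lt : bm (fun x => (x < h)%R%:R).
Proof.
rewrite (_ : (fun _ => _) = fun x => 1 - (h <= x)%R%:R).
  by apply: bmB => //; exact: bm_cst.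
by apply/funext => x; rewrite ltNge; case: (h <= x); rewrite ?subrr ?subr0.
Qed.

Lemma bm_levels_extinction m n : bm_levels (nseq m pass ++ nseq n extinction).
Proof.
elim: m => [|m IH] /=; last by split => //; exact: bm_cst.
by elim: n => [|n IH] //=.
Qed.

Let bm_mean_ext m n : bm (mean (nseq m pass ++ nseq n extinction)).
Proof. exact/bm_mean/bm_levels_extinction. Qed.

Let q01 f (M : R) a : bm f -> (forall x, 0 <= f x <= M) -> 0 <= Q f a <= M.
Proof.
move=> bf f01; rewrite Q_ge0/=; last by move=> x; case/andP: (f01 x).
rewrite -(Qcst d M a); apply: le_Q => //; first exact: bm_cst.
by move=> x; case/andP: (f01 x).
Qed.

Lemma mean_extinction_itv m n x : 0 <= mean (nseq m pass ++ nseq n extinction) x <= 1.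
Proof.
elim: m x => [|m IH] x /=; last first.
  have /andP[q0 q1] := q01 x (bm_mean_ext m n) IH.
  by rewrite add0r mul1r exprn_ge0// exprn_ile1.
elim: n x => [|n IH] x /=; first by rewrite lexx ler01.
have /andP[q0 q1] := q01 x (bm_mean_ext 0 n) IH.
rewrite ltNge; case: (h <= x); rewrite ?add0r ?mul1r ?mul0r ?addr0 ?ler01 ?lexx//.
by rewrite exprn_ge0// exprn_ile1.
Qed.

Lemma mean_extinctionS n x : mean (nseq n.+1 extinction) x =
  (x < h)%R%:R + (h <= x)%R%:R * Q (mean (nseq n extinction)) x ^+ d.
Proof. by []. Qed.

Let QB f a : bm f -> Q (fun x => 1 - f x) a = 1 - Q f a.
Proof.
move=> bf; rewrite (_ : (fun x => _) = fun x => (fun=> 1) x + (-1) * f x).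
  by rewrite Qlin ?Qcst ?mulN1r//; exact: bm_cst.
by apply/funext => x; rewrite mulN1r.
Qed.

Section Above.
Variable k : R.
Hypothesis k01 : 0 <= k < 1.
Hypothesis contr : forall f, bm f -> (forall x, 0 <= f x) ->
  sqnorm (opLh d h f) <= k * sqnorm f.

Let s n x := 1 - mean (nseq n extinction) x.

Let bs n : bm (s n).
Proof. by apply: bmB; [exact: bm_cst|exact: (bm_mean_ext 0)]. Qed.

Let s01 n x : 0 <= s n x <= 1.
Proof.
have /andP[t0 t1] := mean_extinction_itv 0 n x.
by rewrite /s subr_ge0 t1 lerBlDr lerDl.
Qed.

(** A union bound over the [d] offspring, in the form of Bernoulli's inequality. *)
Let s_le n x : s n.+2 x <= opLh d h (s n.+1) x.
Proof.
rewrite {1}/s mean_extinctionS.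
rewrite opLhE ltNge; case: ifP => hx; last by rewrite mul0r addr0 subrr.
rewrite add0r mul1r.
rewrite (_ : pih h (s n.+1) = s n.+1); last first.
  apply/funext => y; rewrite pihE; case: (leP h y) => // yh.
  by rewrite /s mean_extinctionS yh [h <= y]leNgt yh mul0r addr0 subrr.
rewrite QB; last exact: (bm_mean_ext 0 n.+1).
set q := Q _ x.
have /andP[q0 q1] : 0 <= q <= 1 by exact: q01 (bm_mean_ext 0 n.+1) (mean_extinction_itv 0 n.+1).
have q2 : -1 <= q - 1 by lra.
have := bernoulli_ge d q2; rewrite [1 + (q - 1)](_ : _ = q); last by ring.
by lra.
Qed.

Let sqnorm_s n : sqnorm (s n.+1) <= k ^+ n.
Proof.
have [k0 k1] := andP k01.
elim: n => [|n IH].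
  rewrite expr0 -[leRHS](Ecst nu); apply: le_E; [exact: bm_sqr|exact: bm_cst|].
  by move=> x; have /andP[s0 s1] := s01 1%N x; rewrite exprn_ile1.
have s_ge0 m x : 0 <= s m x by case/andP: (s01 m x).
apply: (@le_trans _ _ (sqnorm (opLh d h (s n.+1)))).
  apply: le_sqnorm; [exact: bs|exact: bm_opLh|move=> x].
  by rewrite lerXn2r ?nnegrE ?s_le// opLh_ge0.
by apply: le_trans (contr (bs _) (s_ge0 _)) _; rewrite exprS ler_wpM2l.
Qed.

(** The survival probabilities decay in norm like the powers of [k]. *)
Lemma mean_extinction_cvg1 : \int[nu]_x mean (nseq n extinction) x @[n --> \oo] --> (1 : R).
Proof.
have [k0 k1] := andP k01.
have e n : \int[nu]_x mean (nseq n extinction) x = 1 - \int[nu]_x s n x.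
  rewrite /s EB; [|exact: bm_cst|exact: (bm_mean_ext 0)].
  by rewrite Ecst subKr.
under eq_fun do rewrite e.
suff c0 : \int[nu]_x s n x @[n --> \oo] --> (0 : R).
  have c1 : (fun=> 1 : R) @ \oo --> (1 : R) by exact: cvg_cst.
  have c2 := cvgB c1 c0; rewrite subr0 in c2; exact: c2.
rewrite -(cvg_shiftn 1); apply/cvgrPdist_lt => eps eps0; near=> n.
have s_ge0 : 0 <= \int[nu]_x s (n + 1)%N x.
  by apply: Rintegral_ge0 => x _; case/andP: (s01 (n + 1) x).
rewrite sub0r normrN ger0_norm// -(ltr_pXn2r (ltn0Sn 1)) ?nnegrE ?(ltW eps0)//.
apply: (@le_lt_trans _ _ (k ^+ n)).
  have := E_CauchySchwarz d (bm_cst 1) (bs (n + 1)).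
  under eq_Rintegral do rewrite mul1r.
  move/le_trans; apply; rewrite addn1.
  have -> : sqnorm (fun=> 1) = 1 by rewrite /sqnorm Ecst expr1n.
  by rewrite mul1r.
near: n; apply: (@cvgr_lt _ _ _ _ (fun n => k ^+ n) 0); last by rewrite exprn_gt0.
by apply: cvg_expr; rewrite ger0_norm.
Unshelve. all: by end_near. Qed.

End Above.
Section Below.
Variables (v : R -> R) (t : R).
Hypotheses (bv : bm v) (v0 : forall x, 0 <= v x) (t01 : 0 < t < 1).
Hypotheses (Ev : 0 < \int[nu]_x v x) (subv : forall x, v x <= t * opLh d h v x).

Let damping_algebra (a z : R) : 0 < a -> a < 1 -> 0 <= z -> z <= 1 - a ->
  1 <= (1 - a * z) * (1 + z).
Proof.
move=> a0 a1 z0 za.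
have az : a * z <= 1 - a by rewrite (le_trans _ za)// ler_piMl// ltW.
have : 0 <= z * (1 - a - a * z) by rewrite mulr_ge0// subr_ge0.
rewrite (_ : (1 - a * z) * (1 + z) = 1 + z * (1 - a - a * z)); last by ring.
by rewrite lerDl.
Qed.

(** A small multiple of [v]: the factor [t < 1] pays for the nonlinear correction
    in [1 - (1 - y) ^+ d >= d * y / (1 + d * y)]. *)
Lemma subsolution : exists u, [/\ bm u, forall x, 0 <= u x <= 1, 0 < \int[nu]_x u x,
  forall x, x < h -> u x = 0 & forall x, u x <= 1 - (1 - Q u x) ^+ d].
Proof.
have [t0 t1] := andP t01.
have [M vM] := bv.2.
pose B := M + 1.
have M0 : 0 <= M by exact: le_trans (vM 0).
have B0 : 0 < B by rewrite ltr_wpDl.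
have vB x : v x <= B by rewrite (le_trans (ler_norm _))// (le_trans (vM x))// lerDl.
have B1 : 1 <= B by rewrite lerDr.
pose e := (1 - t) / (d%:R * B).
have e0 : 0 < e by rewrite divr_gt0 ?mulr_gt0// subr_gt0.
have vh x : x < h -> v x = 0.
  move=> xh; apply/eqP; rewrite eq_le v0 andbT (le_trans (subv x))//.
  by rewrite opLhE [h <= x]leNgt xh mulr0.
have pv : pih h v = v by apply/funext => x; rewrite pihE; case: (leP h x) => // /vh.
have u_le x : 0 <= e * v x <= (1 - t) / d%:R.
  rewrite mulr_ge0 ?(ltW e0)//=; apply: (le_trans (ler_wpM2l (ltW e0) (vB x))).
  by rewrite /e invfM mulrA divfK// gt_eqF.
have td : (1 - t) / d%:R <= 1.
  rewrite ler_pdivrMr// mul1r (@le_trans _ _ 1)// ?lerBlDr ?lerDl ?(ltW t0)//.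
  by rewrite ler1n (leq_trans _ d2).
exists (fun x => e * v x); split.
- exact: bmZ.
- by move=> x; have /andP[-> /le_trans->] := u_le x.
- by rewrite EZ// mulr_gt0.
- by move=> x xh; rewrite vh// mulr0.
move=> x; have /andP[y0 y1] := q01 x (bmZ e bv) u_le.
set y := Q _ x in y0 y1 *.
have y11 : 0 <= y <= 1 by rewrite y0 (le_trans y1).
have dy : d%:R * y <= 1 - t by rewrite mulrC -ler_pdivlMr.
have dy0 : 0 <= d%:R * y by rewrite mulr_ge0// ltW.
have uy : e * v x <= t * (d%:R * y).
  apply: (le_trans (ler_wpM2l (ltW e0) (subv x))); rewrite opLhE pv.
  case: ifP => _; last by rewrite !mulr0 mulr_ge0// ltW.
  by rewrite /y QZ// mulrCA [e * (_ * _)]mulrCA.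
have := expr_1B_le d y11; have D0 : 0 < 1 + d%:R * y by rewrite ltr_pwDl.
move: uy dy dy0 D0; move: ((1 - y) ^+ d) (d%:R * y) (e * v x) => q z w uy dy dy0 D0 hq.
have : (1 + z)^-1 <= 1 - t * z.
  by rewrite -[leLHS]mul1r ler_pdivrMr//; exact: damping_algebra.
lra.
Qed.

Section Limit.
Variable u : R -> R.
Hypotheses (bu : bm u) (u01 : forall x, 0 <= u x <= 1) (Eu : 0 < \int[nu]_x u x).
Hypotheses (uh : forall x, x < h -> u x = 0) (usub : forall x, u x <= 1 - (1 - Q u x) ^+ d).

(** Bounds for the probabilities that the exploration dies out below every
    vertex at depth [m], see [mean_pass_le]. *)
Let r := fix r m : R -> R := if m is m'.+1 then fun x => Q (r m') x ^+ d else fun x => 1 - u x.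

Let br m : bm (r m).
Proof. by elim: m => [|m IH] /=; [apply: bmB => //; exact: bm_cst|apply: bmX; exact: bm_Q]. Qed.

Let r01 m x : 0 <= r m x <= 1.
Proof.
elim: m x => [|m IH] x /=.
  by have /andP[u0 u1] := u01 x; rewrite subr_ge0 u1 lerBlDr lerDl.
by have /andP[q0 q1] := q01 x (br m) IH; rewrite exprn_ge0// exprn_ile1.
Qed.

Let le_Qd f g x : bm f -> bm g -> (forall y, 0 <= f y <= 1) -> (forall y, f y <= g y) ->
  Q f x ^+ d <= Q g x ^+ d.
Proof.
move=> bf bg f0 fg; have fg' := le_Q d x bf bg fg.
have /andP[q0 _] := q01 x bf f0.
by rewrite lerXn2r ?nnegrE// (le_trans q0).
Qed.

Lemma mean_extinction_le n x : mean (nseq n extinction) x <= 1 - u x.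
Proof.
elim: n x => [|n IH] x; first by rewrite /= subr_ge0; case/andP: (u01 x).
rewrite mean_extinctionS ltNge; case: (leP h x) => hx /=; last first.
  by rewrite mul0r addr0 uh// subr0.
rewrite add0r mul1r lerBrDr -lerBrDl; apply: le_trans (usub x) _.
rewrite lerB// -QB//; apply: le_Qd => //.
- exact: (bm_mean_ext 0).
- by apply: bmB => //; exact: bm_cst.
- exact: (mean_extinction_itv 0).
Qed.

Lemma mean_pass_le m n x : mean (nseq m pass ++ nseq n extinction) x <= r m x.
Proof.
elim: m x => [|m IH] x; first exact: mean_extinction_le.
rewrite /= add0r mul1r; apply: le_Qd; [exact: bm_mean_ext|exact: br| |exact: IH].
exact: mean_extinction_itv.
Qed.

Let r_anti m x : r m.+1 x <= r m x.
Proof.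
elim: m x => [|m IH] x; last first.
  by apply: (@le_Qd (r m.+1) (r m)); [exact: br|exact: br|exact: r01|exact: IH].
by rewrite /= QB// lerBrDr -lerBrDl; exact: usub.
Qed.

Let rinf x := limn (r ^~ x).

Let r_cvg x : r m x @[m --> \oo] --> rinf x.
Proof.
apply: nonincreasing_is_cvgn.
  by apply/nonincreasing_seqP => m; exact: r_anti.
by exists 0 => _ [m _ <-]; case/andP: (r01 m x).
Qed.

Let rinf01 x : 0 <= rinf x <= 1.
Proof.
apply/andP; split.
  by apply: limr_ge; [exact: r_cvg|apply: nearW => m; case/andP: (r01 m x)].
by apply: limr_le; [exact: r_cvg|apply: nearW => m; case/andP: (r01 m x)].
Qed.

Let rinf_le m x : rinf x <= r m x.
Proof.
apply: (@nonincreasing_cvgn_ge _ (r ^~ x)); last by apply/cvg_ex; exists (rinf x); exact: (@r_cvg x).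
by apply/nonincreasing_seqP => k; exact: r_anti.
Qed.

Let brinf : bm rinf.
Proof.
split; last first.
  by exists 1 => x; have /andP[r0 r1] := rinf01 x; rewrite ger0_norm.
apply: (measurable_fun_cvg (h := r)) => [m|x _]; first exact: (br m).1.
exact: r_cvg.
Qed.

Let norm_r m x : `|r m x| <= 1.
Proof. by have /andP[r0 r1] := r01 m x; rewrite ger0_norm. Qed.

Let rinf_fix x : rinf x = Q rinf x ^+ d.
Proof.
have c1 : r m.+1 x @[m --> \oo] --> rinf x.
  by rewrite (cvg_shiftS (r ^~ x)); exact: (@r_cvg x).
have c2 : r m.+1 x @[m --> \oo] --> Q rinf x ^+ d.
  apply: (@continuous_cvg _ _ _ _ _ _ (fun y : R => y ^+ d)); first exact: exprn_continuous.
  exact: (Q_cvg br brinf norm_r r_cvg).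
exact: (cvg_unique _ c1 c2).
Qed.

Let q := Q rinf.

Let bq : bm q. Proof. exact: bm_Q. Qed.

Let qitv x : 0 <= q x <= 1. Proof. exact: q01 brinf rinf01. Qed.

(** Since [nu] is invariant and [d >= 2],
    [\int rinf = \int q ^+ d <= \int q ^+ 2 <= \int q = \int rinf]. *)
Let E_qBq2 : \int[nu]_x (q x * (1 - q x)) = 0.
Proof.
apply/eqP; rewrite eq_le; apply/andP; split; last first.
  apply: Rintegral_ge0 => x _; have /andP[q0 q1] := qitv x.
  by rewrite mulr_ge0// subr_ge0.
have h1 : \int[nu]_x rinf x <= \int[nu]_x (q x ^+ 2).
  apply: le_E => //; first exact: bmX.
  move=> x; rewrite rinf_fix; have /andP[q0 q1] := qitv x.
  by rewrite -/q; apply: ler_wiXn2l.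
have h2 : \int[nu]_x (q x * (1 - q x)) = \int[nu]_x q x - \int[nu]_x (q x ^+ 2).
  rewrite -EB//; last exact: bmX.
  by apply: eq_Rintegral => x _; ring.
by rewrite h2 /q E_Q// subr_le0.
Qed.

(** The kernel of [Q] is positive: apply [opLh_compact_lb] to a window that
    carries some mass of [rinf]. *)
Let q_gt0 : 0 < \int[nu]_x rinf x -> forall x, 0 < q x.
Proof.
move=> Er x.
pose F (n : nat) : R -> R := \1_(`[- n%:R, n%:R]%classic : set R).
have bF n : bm (F n) by exact: bm_indic.
have FE n y : F n y = (- n%:R <= y <= n%:R)%R%:R.
  by rewrite /F indicE mem_setE in_itv.
have cv : \int[nu]_y (F n y * rinf y) @[n --> \oo] --> \int[nu]_y rinf y.
  apply: (E_cvg (M := 1)).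
  - by move=> n; case: (bmM (bF n) brinf).
  - exact: brinf.1.
  - move=> n y; have /andP[r0 r1] := rinf01 y; rewrite normrM FE [`|rinf y|]ger0_norm//.
    by case: (_ <= _ <= _); rewrite ?normr1 ?normr0 ?mul1r ?mul0r.
  - move=> y; apply: cvg_near_cst; near=> n; rewrite FE.
    rewrite -ler_norml (_ : `|y| <= n%:R) ?mul1r//.
    by apply: ltW; near: n; exact: nbhs_infty_gtr.
have [n [xn En]] : exists n : nat, `|x| <= n%:R /\ 0 < \int[nu]_y (F n y * rinf y).
  near \oo => n; exists n; split; last by near: n; exact: (cvgr_gt _ cv).
  by apply: ltW; near: n; exact: nbhs_infty_gtr.
have F1 y : F n y <= 1 by rewrite FE; case: (_ <= _ <= _).
have F0 y : 0 <= F n y by rewrite FE.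
have FB y : ~~ (- n%:R <= y <= n%:R) -> F n y = 0 by rewrite FE => /negbTE ->.
have Fh y : y < - n%:R -> F n y = 0.
  by move=> yn; apply: FB; rewrite negb_and -ltNge yn.
have r0 y : 0 <= rinf y by case/andP: (rinf01 y).
have xn' : - n%:R <= x by have := xn; rewrite ler_norml => /andP[].
have := opLh_compact_lb d2 (bF n) F0 F1 FB Fh ltr01 brinf r0 xn' xn.
rewrite opLhE xn' => lb.
have : 0 < d%:R * Q (pih (- n%:R) rinf) x.
  apply: lt_le_trans lb; apply: mulr_gt0 => //; apply: mulr_gt0 => //.
  apply: divr_gt0; first exact: pdf_inf_gt0.
  by rewrite mul1r normal_peak_gt0// gt_eqF// sigma_gt0.
rewrite pmulr_rgt0// => /lt_le_trans; apply; apply: le_Q => //; first exact: bm_pih.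
by move=> y; rewrite pihE; case: ifP.
Unshelve. all: by end_near. Qed.

(** Otherwise [q] is positive, hence almost everywhere 1 by [E_qBq2], so that
    [rinf] has integral 1, against [rinf <= 1 - u]. *)
Let E_rinf : \int[nu]_x rinf x = 0.
Proof.
apply/eqP; rewrite eq_sym eq_le Rintegral_ge0/=; last by move=> x _; case/andP: (rinf01 x).
rewrite leNgt; apply/negP => Er; have q0 := q_gt0 Er.
(* Since [q > 0], these functions increase to [1 - q], while their integrals are
   at most [n * 0]. *)
pose f (n : nat) x := Num.min (1 - q x) (n%:R * (q x * (1 - q x))).
have q1 x : 0 <= 1 - q x by rewrite subr_ge0; case/andP: (qitv x).
have bq1 : bm (fun x => q x * (1 - q x)).
  by apply: bmM => //; apply: bmB => //; exact: bm_cst.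
have f01 n x : 0 <= f n x <= 1.
  rewrite /f le_min q1 !mulr_ge0 ?(ltW (q0 x))//= ge_min; apply/orP; left.
  by rewrite lerBlDr lerDl ltW.
have bf n : bm (f n).
  split; last by exists 1 => x; have /andP[f0 f1] := f01 n x; rewrite ger0_norm.
  apply: measurable_minr; first by case: (bmB (bm_cst 1) bq).
  by case: (bmZ n%:R bq1).
have cv : \int[nu]_x f n x @[n --> \oo] --> \int[nu]_x (1 - q x).
  apply: (E_cvg (M := 1)).
  - by move=> n; case: (bf n).
  - by case: (bmB (bm_cst 1) bq).
  - by move=> n x; have /andP[f0 f1] := f01 n x; rewrite ger0_norm.
  - move=> x; apply: cvg_near_cst; near=> n; rewrite /f; apply/min_idPl.
    rewrite mulrA -[leLHS]mul1r ler_wpM2r// -ler_pdivrMr//.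
    by apply: ltW; near: n; exact: nbhs_infty_gtr.
have : \int[nu]_x (1 - q x) <= 0.
  rewrite -(cvg_lim _ cv)//; apply: limr_le; first by apply/cvg_ex; eexists; exact: cv.
  apply: nearW => n; rewrite -(mulr0 n%:R) -E_qBq2 -EZ//; apply: le_E => //; first exact: bmZ.
  by move=> x; rewrite /f ge_min lexx orbT.
rewrite EB//; last exact: bm_cst.
rewrite Ecst /q E_Q// subr_le0 => E1.
have : \int[nu]_x rinf x <= \int[nu]_x (1 - u x).
  by apply: le_E => //; [exact: (br 0)|exact: (rinf_le 0)].
rewrite EB//; last exact: bm_cst.
by move/(le_trans E1); rewrite Ecst lerDl oppr_ge0 leNgt Eu.
Unshelve. all: by end_near. Qed.

Lemma mean_pass_cvg0 : exists2 rho : nat -> R, rho m @[m --> \oo] --> (0 : R) &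
  forall m n, \int[nu]_x mean (nseq m pass ++ nseq n extinction) x <= rho m.
Proof.
exists (fun m => \int[nu]_x r m x).
  rewrite -E_rinf; apply: (E_cvg (M := 1)) => //.
  - by move=> m; exact: (br m).1.
  - exact: brinf.1.
by move=> m n; apply: le_E => // x; exact: mean_pass_le.
Qed.

End Limit.
End Below.

Theorem extinction_bound_below : (exists f, [/\ bm f, forall x, 0 <= f x &
    sqnorm f < sqnorm (opLh d h f)]) ->
  exists2 rho : nat -> R, rho m @[m --> \oo] --> (0 : R) &
  forall m n, \int[nu]_x mean (nseq m pass ++ nseq n extinction) x <= rho m.
Proof.
move=> [f [bf f0 lt]]; have [v [t [bv v0 t01 Ev sv]]] := subeigenfunction d2 bf f0 lt.
have [u [bu u01 Eu uh us]] := subsolution bv v0 t01 Ev sv.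
exact: mean_pass_cvg0 bu u01 Eu uh us.
Qed.

End Recursion.

(** * Exploring a branch of the tree *)

Section Exploration.
Variables (V : choiceType) (adj : rel V) (d : nat).
Hypothesis tree : regular_tree adj d.+1.
Local Notation nb := (nonbacktracking adj).
Local Notation kids := (kids tree).
Local Notation nbrs := (nbrs tree).
Implicit Types (p x y z : V) (s : seq V) (A : pred V).

Fixpoint reaches A n p x : bool :=
  if n is n'.+1 then A x && has (reaches A n' x) (kids p x) else true.

(** Many vertices at depth [m] give many nearly independent attempts to survive;
    this is what drives the failure probability to 0. *)
Fixpoint reaches_below A m n p x : bool :=
  if m is m'.+1 then has (reaches_below A m' n x) (kids p x) else reaches A n p x.

Lemma reachesW A n p x : reaches A n.+1 p x -> reaches A n p x.
Proof.
elim: n p x => [//|n IH] p x /andP[Ax /hasP[y yk r]] /=.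
by rewrite Ax; apply/hasP; exists y => //; exact: IH.
Qed.

Lemma reaches_belowW A m n p x : reaches_below A m n.+1 p x -> reaches_below A m n p x.
Proof.
elim: m p x => [|m IH] p x; first exact: reachesW.
by move=> /hasP[y yk r]; apply/hasP; exists y => //; exact: IH.
Qed.

Lemma pigeonhole (b : nat -> pred V) s : (forall n y, b n.+1 y -> b n y) ->
  (forall n, has (b n) s) -> exists2 y, y \in s & forall n, b n y.
Proof.
move=> bW; have bWm k n y : (k <= n)%N -> b n y -> b k y.
  move/subnK <-; elim: (n - k)%N => // j IH; rewrite addSn => /bW; exact: IH.
elim: s => [|y s IH] h; first by have := h 0%N.
have [Hy|Hy] := pselect (forall n, b n y); first by exists y; rewrite ?inE ?eqxx.
have [n0 yn0] : exists n, ~~ b n y.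
  by apply: contrapT => nex; apply: Hy => n; apply: contrapT => /negP bn; apply: nex; exists n.
have [n|z zs bz] := IH; last by exists z; rewrite ?inE ?zs ?orbT.
have /hasP[z] := h (n + n0)%N; rewrite inE => /predU1P[->|zs] bz.
  by case/negP: yn0; exact: bWm (leq_addl n n0) bz.
by apply/hasP; exists z => //; exact: bWm (leq_addr n0 n) bz.
Qed.

Lemma reaches_below_all A m p x : adj p x -> (forall n, reaches_below A m n p x) ->
  exists q y, adj q y /\ forall n, reaches A n q y.
Proof.
elim: m p x => [|m IH] p x px h; first by exists p, x.
have [|y yk hy] := @pigeonhole (fun n => reaches_below A m n x) (kids p x) _ h.
  by move=> n y; exact: reaches_belowW.
by move: yk; rewrite mem_kids => /andP[xy _]; exact: IH xy hy.
Qed.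

Lemma reaches_path A n p x : reaches A n.+1 p x ->
  exists s, [/\ nb p x s, size s = n & all A (x :: s)].
Proof.
elim: n p x => [|n IH] p x; first by move=> /andP[Ax _]; exists [::]; rewrite /= Ax.
move=> /andP[Ax /hasP[y]]; rewrite mem_kids => /andP[xy yp] /IH[s [nbs sz As]].
by exists (y :: s); split; rewrite /= ?xy ?yp ?nbs ?sz ?Ax//; case/andP: As => -> ->.
Qed.

(** Non-backtracking walks are simple, so that open walks of every length yield
    arbitrarily many vertices. *)
Lemma infinite_component A p x : adj p x -> (forall n, reaches A n p x) ->
  exists C : set V, is_component adj [set y | A y] C /\ infinite_set C.
Proof.
move=> px h; have Ax : A x by have /andP[] := h 1%N.
exists [set y | connected_in adj [set y | A y] x y]; split; first by exists x.
move=> /finite_seqP[c cE].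
have [s [nbs sz As]] := reaches_path (h (size c).+1).
have us : uniq (x :: s) by have := nb_uniq tree px nbs; rewrite cons_uniq => /andP[].
suff /(uniq_leq_size us) : {subset x :: s <= c} by rewrite /= sz ltnn.
move=> z zs; suff : [set` c] z by [].
rewrite -cE /=; have ps : path adj x s by have /andP[] := nb_path px nbs.
case/splitPl: zs ps As => s1 s2 e.
rewrite cat_path -cat_cons all_cat => /andP[ps1 _] /andP[/allP As1 _].
by exists s1; split.
Qed.

Lemma finite_branch A n p x : ~~ reaches A n p x ->
  finite_set [set z | exists s, [/\ nb p x s, all A (x :: s) & last x s = z]].
Proof.
elim: n p x => [//|n IH] p x /=; rewrite negb_and => /orP[Ax|].
  apply: (@sub_finite_set _ _ set0) => // z [s [_ As _]].
  by move: As; rewrite /= (negbTE Ax).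
move=> /hasPn hk.
apply: (@sub_finite_set _ _ ([set x] `|` \bigcup_(y in [set` kids p x])
    [set z | exists s, [/\ nb x y s, all A (y :: s) & last y s = z]])).
  move=> z [[|y s] [nbs As e]]; first by left.
  move: nbs As => /and3P[xy yp nbs] /andP[_ As].
  by right; exists y; [rewrite /= mem_kids xy yp|exists s].
rewrite finite_setU; split; first exact: finite_set1.
apply: bigcup_finite; first by apply/finite_seqP; exists (kids p x).
by move=> y /hk; exact: IH.
Qed.

(** A simple path from [x] is a walk along one of the finitely many edges at
    [x]. *)
Lemma finite_components A : (forall p x, adj p x -> exists n, ~~ reaches A n p x) ->
  forall C : set V, is_component adj [set y | A y] C -> finite_set C.
Proof.
move=> h C [x Ax ->].
apply: (@sub_finite_set _ _ ([set x] `|` \bigcup_(y in [set` nbrs x])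
    [set z | exists s, [/\ nb x y s, all A (y :: s) & last y s = z]])).
  move=> z [s0 [ps0 e0 As0]]; move: e0 As0.
  case/shortenP: ps0 => s ps us ss e As; case: s ps us ss e => [|y s] ps us ss e; first by left.
  right; exists y; first by rewrite /= mem_nbrs; case/andP: ps.
  exists s; split => //; first exact: uniq_nb.
  by apply/allP => a /ss as0; apply: As; rewrite inE as0 orbT.
rewrite finite_setU; split; first exact: finite_set1.
apply: bigcup_finite; first by apply/finite_seqP; exists (nbrs x).
by move=> y; rewrite /= mem_nbrs => /h[n]; exact: finite_branch.
Qed.

Fixpoint sphere x n : seq V :=
  if n is n'.+1 then flatten [seq nbrs y | y <- sphere x n'] else [:: x].

Lemma mem_sphere x y : exists n, y \in sphere x n.
Proof.
have [s xs <-] := tree_connected tree x y.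
elim/last_ind: s xs => [|s z IH]; first by exists 0%N; rewrite inE.
rewrite rcons_path last_rcons => /andP[/IH[n sn] sz]; exists n.+1.
by apply/flatten_mapP; exists (last x s) => //; rewrite mem_nbrs.
Qed.

(** A connected locally finite graph is countable. *)
Lemma edge_enumeration x0 : exists e : nat -> V * V,
  forall p x, adj p x -> exists n, e n = (p, x).
Proof.
pose f (k : nat * nat * nat) :=
  let p := nth x0 (sphere x0 k.1.1) k.1.2 in (p, nth x0 (nbrs p) k.2).
exists (fun n => if unpickle n is Some k then f k else (x0, x0)) => p x px.
have [n pn] := mem_sphere x0 p.
exists (pickle (n, index p (sphere x0 n), index x (nbrs p))).
by rewrite pickleK /f /= !nth_index// mem_nbrs.
Qed.

End Exploration.

(** * Percolation *)

Section Percolation.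
Variables (R : realType) (V : choiceType) (adj : rel V) (d : nat).
Hypothesis tree : regular_tree adj d.+1.
Hypothesis d2 : (2 <= d)%N.
Context {dO : measure_display} {Omega : measurableType dO}.
Variables (P : probability Omega R) (phi : V -> {RV P >-> R}).
Local Notation tree_green := (@tree_green R V adj d tree).
Hypothesis field : centered_gaussian_field phi (fun x y => (tree_green x y)%:E).
Local Notation nu := (@nu R d).
Local Notation mean := (@mean_functional R d).
Local Notation functional := (functional tree phi).
Local Notation bmR := (@bounded_measurable R _ (measurableTypeR R)).
Variable h : R.
Local Notation open w := (fun x => h <= phi x w).
Local Notation levels m n := (nseq m (pass R) ++ nseq n (extinction h)).
Implicit Types (p x y z : V).

Lemma E_phi_nu (f : R -> R) x : bmR f -> \int[P]_w f (phi x w) = \int[nu]_y f y.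
Proof.
move=> bf; have sp := sigma_gt0 R d2.
have law (B : set R) : measurable B -> P (phi x @^-1` B) = nu (id @^-1` B).
  move=> mB; have g0 : 0 < tree_green x x by rewrite tree_green_diag// exprn_gt0.
  have e : Num.sqrt (tree_green x x) = Num.sqrt (d%:R / (d%:R ^+ 2 - 1)).
    by rewrite tree_green_diag// sqrtr_sqr gtr0_norm.
  by have := law_phi field g0 mB; rewrite e; apply.
have mphi : measurable_fun setT (phi x : Omega -> R) by exact: measurable_funP.
by have [] := eq_law_Rintegral (P2 := nu) (X2 := id) mphi (@measurable_id _ _ _) law bf.1 (bm_integrable nu bf).
Qed.

Lemma functional_levels m n p x w :
  functional (levels m n) p x w = (~~ reaches_below tree (open w) m n p x)%:R.
Proof.
have prodN (b : pred V) (F : V -> R) s : (forall y, F y = (~~ b y)%:R) ->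
    \prod_(y <- s) F y = (~~ has b s)%:R.
  move=> Fb; elim: s => [|y s IH]; first by rewrite big_nil.
  by rewrite big_cons IH Fb /= negb_or; case: (b y); rewrite ?mul0r ?mul1r.
elim: m p x => [|m IH] p x; last first.
  by rewrite /= add0r mul1r (prodN _ _ _ (fun y => IH x y)).
elim: n p x => [|n IH] p x //=.
rewrite (prodN _ _ _ (fun y => IH x y)) ltNge negb_and.
by case: (h <= phi x w); rewrite /= ?add0r ?mul1r// mul0r addr0.
Qed.

Let extinct m n p x : set Omega := [set w | ~~ reaches_below tree (open w) m n p x].

Lemma extinct_indic m n p x : \1_(extinct m n p x) = functional (levels m n) p x :> (_ -> R).
Proof.
apply/funext => w; rewrite indicE functional_levels; congr ((nat_of_bool _)%:R).
by apply/idP/idP; rewrite inE.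
Qed.

Lemma measurable_extinct m n p x : adj p x -> measurable (extinct m n p x).
Proof.
move=> px.
have [mF _] := cylinder_bm (functional_cylinder tree phi (bm_levels_extinction h m n) px).
rewrite -(_ : functional (levels m n) p x @^-1` [set 1] = extinct m n p x).
  by rewrite -[X in measurable X]setTI; exact: mF.
apply/seteqP; split => w /=; rewrite functional_levels /extinct /=.
  by case: (~~ _) => // /eqP; rewrite eq_sym oner_eq0.
by move=> ->.
Qed.

(** The law [nu] of [phi p] being invariant, [Q] disappears. *)
Lemma P_extinct m n p x : adj p x ->
  P (extinct m n p x) = (\int[nu]_y mean (levels m n) y)%:E.
Proof.
move=> px; have bl := bm_levels_extinction h m n.
rewrite -(E_indic P (measurable_extinct m n px)) extinct_indic; congr EFin.
have := functional_mean d2 field bl px (cylinder_cst phi _ 1).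
under eq_Rintegral do rewrite mul1r.
under [X in _ = X]eq_Rintegral do rewrite mul1r.
move=> ->; apply: (etrans (E_phi_nu p (bm_Q d (bm_mean d bl)))).
by apply: (etrans (E_Q d2 (bm_mean d bl))).
Qed.

Lemma finite_above (k : R) : 0 <= k < 1 ->
  (forall f : R -> R, bmR f -> (forall a, 0 <= f a) -> sqnorm d (opLh d h f) <= k * sqnorm d f) ->
  {ae P, forall w, forall C : set V,
    is_component adj [set x | h <= phi x w] C -> finite_set C}.
Proof.
move=> k01 contr.
have [x0] := tree_inhabited tree.
have [e eP] := edge_enumeration tree x0.
pose bad n := if adj (e n).1 (e n).2 then
  \bigcap_j (~` extinct 0 j (e n).1 (e n).2) else set0.
apply: (negligibleS (A := \bigcup_n bad n)).
  move=> w /= nw; apply: contrapT => nbad; apply: nw => C.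
  apply: (@finite_components _ _ _ tree (open w)) => p x px; have [n en] := eP p x px.
  apply: contrapT => nex; apply: nbad; exists n => //; rewrite /bad en /= px => j _.
  by move=> wj; apply: nex; exists j.
apply: negligible_bigcup => n; rewrite /bad; case: ifP => px; last exact: negligible_set0.
move: (e n).1 (e n).2 px => p x px.
have mE j : measurable (~` extinct 0 j p x).
  by apply: measurableC; exact: measurable_extinct.
exists (\bigcap_j ~` extinct 0 j p x); split => //; first exact: bigcapT_measurable.
apply/eqP; rewrite eq_le measure_ge0 andbT.
have cv := mean_extinction_cvg1 k01 contr.
have cv0 : (1 - \int[nu]_y mean (nseq j (extinction h)) y)%:E @[j --> \oo] --> (0 : \bar R).
  apply: cvg_EFin; first exact: nearW.
  have c1 : (fun=> 1 : R) @ \oo --> (1 : R) by exact: cvg_cst.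
  have c2 := cvgB c1 cv; rewrite subrr in c2; exact: c2.
rewrite -(cvg_lim _ cv0)//; apply: lime_ge; first by apply/cvg_ex; eexists; exact: cv0.
apply: nearW => j; apply: (@le_trans _ _ (P (~` extinct 0 j p x))).
  by apply: le_measure; rewrite ?inE//; [exact: bigcapT_measurable|exact: bigcap_inf].
rewrite probability_setC ?EFinB; last exact: measurable_extinct.
by rewrite (P_extinct 0 j px).
Qed.

(** For each [m], the exploration survives below depth [m] with probability at
    least [1 - rho m]; hence it almost surely does so for some [m]. *)
Lemma infinite_below (rho : nat -> R) : rho m @[m --> \oo] --> (0 : R) ->
  (forall m n, \int[nu]_x mean (levels m n) x <= rho m) ->
  {ae P, forall w, exists C : set V,
    is_component adj [set x | h <= phi x w] C /\ infinite_set C}.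
Proof.
move=> rho0 rhoP.
have [p] := tree_inhabited tree.
have [x px] : exists x, adj p x.
  have := size_nbrs tree p; case: (nbrs tree p) (mem_nbrs tree p) => // x s hx _.
  by exists x; rewrite -hx inE eqxx.
pose F m n := extinct m n p x.
have mF m n : measurable (F m n) by exact: measurable_extinct.
have mU m : measurable (\bigcup_n F m n) by exact: bigcupT_measurable.
exists (\bigcap_m \bigcup_n F m n); split.
- exact: bigcapT_measurable.
- apply/eqP; rewrite eq_le measure_ge0 andbT.
  have cv0 : (rho m)%:E @[m --> \oo] --> (0 : \bar R).
    by apply: cvg_EFin; [exact: nearW|exact: rho0].
  rewrite -(cvg_lim _ cv0)//; apply: lime_ge; first by apply/cvg_ex; eexists; exact: cv0.
  apply: nearW => m; apply: (@le_trans _ _ (P (\bigcup_n F m n))).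
    by apply: le_measure; rewrite ?inE//; [exact: bigcapT_measurable|exact: bigcap_inf].
  have mono : {homo F m : i j / (i <= j)%N >-> (i <= j)%O}.
    apply/nondecreasing_seqP => n; apply/subsetPset => w /=.
    by apply: contra; exact: reaches_belowW.
  have cF := nondecreasing_cvg_mu (mu := P) (mF m) (mU m) mono.
  rewrite -(cvg_lim _ cF)//; apply: lime_le; first by apply/cvg_ex; eexists; exact: cF.
  by apply: nearW => n; rewrite /= /F P_extinct// lee_fin.
- move=> w /= nw m _; apply: contrapT => nm; apply: nw.
  have [|q [y [qy hy]]] := @reaches_below_all _ _ _ tree (open w) m p x px.
    move=> n; apply: contrapT => /negP nr; apply: nm; exists n => //.
  exact: infinite_component qy hy.
Qed.

End Percolation.

Theorem proposition3p3 (R : realType) (d : nat) (V : choiceType) (adj : rel V)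
    (dW : measure_display) (W : measurableType dW)
    (Px : V -> probability W R) (Z : nat -> W -> V)
    (dO : measure_display) (Omega : measurableType dO)
    (PG : probability Omega R) (phi : V -> {RV PG >-> R}) (hstar : R) :
  (2 <= d)%N ->
  regular_tree adj d.+1 ->
  (forall x, simple_random_walk adj d x (Px x) Z) ->
  centered_gaussian_field phi (green d Px Z) ->
  lambda d hstar = 1%E ->
  (forall h : R, h < hstar ->
    {ae PG, forall w, exists C : set V,
      is_component adj [set x | h <= phi x w] C /\ infinite_set C}) /\
  (forall h : R, hstar < h ->
    {ae PG, forall w, forall C : set V,
      is_component adj [set x | h <= phi x w] C -> finite_set C}).
Proof.
move=> d2 tree srw field lam.
have greenE : green d Px Z = fun x y => (tree_green R tree x y)%:E.
  by apply/funext => x; apply/funext => y; exact: (green_series tree d2 (srw x) y).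
rewrite greenE in field; split => h hh.
  have [rho rho0 rhoP] := extinction_bound_below d2 (expansion_below d2 lam hh).
  exact: (infinite_below d2 field rho0 rhoP).
have [k k01 contr] := contraction_above d2 lam hh.
exact: (finite_above d2 field k01 contr).
Qed.
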